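(* Let $X^\circ$ be a random element in $(E,\mathcal E)$ and $\xi^\circ$ a random measure on $\mathbb R^d$ (not necessarily diffuse), and let $\lambda_1$ be Lebesgue measure on $\mathbb R$. The pair $(X^\circ,\xi^\circ)$ is mass-stationary if and only if $(X^\circ,\xi^\circ\otimes\lambda_1)$ (where $\xi^\circ\otimes\lambda_1$ is a random measure on $\mathbb R^{d+1}$) is distributionally invariant under preserving shifts against any stationary independent background.
   Context: Setting. $(\Omega,\mathcal F,\mathbf P^\circ)$ is a measure space (not necessarily a probability space; extended if further randomization is needed). $\lambda$ is Lebesgue measure on $\mathbb R^d$. For a measure $\mu$ and a set $A$ with $0<\mu(A)<\infty$, $\mu(\cdot\mid A):=\mu(\cdot\cap A)/\mu(A)$. The symbol $\overset{D}{=}$ denotes equality of distributions (under $\mathbf P^\circ$). $(E,\mathcal E)$ is a measurable space on which the additive group $\mathbb R^d$ acts by maps $\theta_t$, such that $(t,x)\mapsto\theta_tx$ is measurable. $X^\circ$ is a random element in $(E,\mathcal E)$ and $\xi^\circ$ is a random (locally finite) measure on $\mathbb R^d$ having $0$ in its support $\mathbf P^\circ$-a.e. For a measure $\eta$ on $\mathbb R^k$, $\theta_t\eta(B):=\eta(B+t)$ for $t\in\mathbb R^k$ and Borel $B\subseteq\mathbb R^k$; shifts act componentwise on tuples. The distribution of $(X^\circ,\xi^\circ)$ under $\mathbf P^\circ$ is $\sigma$-finite. The action on $E$ is extended to $\mathbb R^{d+1}$ by $\theta_tx:=\theta_{(t_1,\dots,t_d)}x$ for $t=(t_1,\dots,t_{d+1})\in\mathbb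 R^{d+1}$, $x\in E$. Mass-stationarity: $(X^\circ,\xi^\circ)$ is mass-stationary (under $\mathbf P^\circ$) if for all bounded Borel $C\subset\mathbb R^d$ with $\lambda(C)>0$ and $\lambda(\partial C)=0$, $$(\theta_{V_C}(X^\circ,\xi^\circ),V_C+U_C)\overset{D}{=}((X^\circ,\xi^\circ),U_C),$$ where the conditional distribution of $U_C$ given $(X^\circ,\xi^\circ)$ is uniform on $C$ and the conditional distribution of $V_C$ given $((X^\circ,\xi^\circ),U_C)$ is $\xi^\circ(\cdot\mid C-U_C)$, with $C-x:=\{y-x:y\in C\}$. Write $\hat\xi:=\xi^\circ\otimes\lambda_1$. A stationary independent background (for $(X^\circ,\hat\xi)$) is a random element $Y^\circ$ in a measurable space on which $\mathbb R^{d+1}$ acts measurably (possibly obtained by extending the underlying space), which is stationary ($\theta_tY^\circ\overset{D}{=}Y^\circ$ for all $t\in\mathbb R^{d+1}$) and independent of $(X^\circ,\hat\xi)$; independence means that the joint distribution of $Y^\circ$ and $(X^\circ,\hat\xi)$ is the product of a shift-invariant probability measure (the law of $Y^\circ$) and the $\sigma$-finite distribution of $(X^\circ,\hat\xi)$. Preserving shifts: let $\pi$ be a measurable map taking $(Y^\circ,\hat\xi)$ to a location $\pi(Y^\circ,\hat\xi)\in\mathbb R^{d+1}$, with induced allocation rule $\tau(s):=s+\pi(\theta_s(Y^\circ,\hat\xi))$, $s\in\mathbb R^{d+1}$. $\pi$ is a preserving shift if for each fixed value of $(Y^\circ,\hat\xi)$, $\hat\xi(\{s\in\mathbb R^{d+1}:\tau(s)\in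 B\})=\hat\xi(B)$ for all Borel $B\subseteq\mathbb R^{d+1}$. $(X^\circ,\hat\xi)$ is distributionally invariant under preserving shifts against any stationary independent background if for all stationary independent backgrounds $Y^\circ$ and all preserving shifts $\pi$, $$\theta_{\pi(Y^\circ,\hat\xi)}(Y^\circ,X^\circ,\hat\xi)\overset{D}{=}(Y^\circ,X^\circ,\hat\xi).$$ *)

(* Defs.v *)
From HB Require Import structures.
From mathcomp Require Import all_boot all_order all_algebra.
From mathcomp Require Import all_classical all_reals all_analysis.
From mathcomp Require Import measurable_realfun.

Set Implicit Arguments.
Unset Strict Implicit.
Unset Printing Implicit Defensive.

Import Order.TTheory GRing.Theory Num.Theory.
Import numFieldTopology.Exports numFieldNormedType.Exports.

Local Open Scope classical_set_scope.
Local Open Scope ring_scope.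

(* R^k is 'rV[R]_k, with its Borel sigma-algebra. *)
Section borel_rV.
Context (R : realType) (k : nat).

HB.instance Definition _ := @isMeasurable.Build
  (sigma_display (@open 'rV[R]_k)) 'rV[R]_k <<s @open 'rV[R]_k >>
  (@sigma_algebra0 _ setT _) (@sigma_algebraC _ _)
  (@sigma_algebra_bigcup _ setT _).

Lemma open_measurable_rV (U : set 'rV[R]_k) : open U -> measurable U.
Proof. exact: sub_sigma_algebra. Qed.

Lemma measurable_coord (i : 'I_k) :
  measurable_fun setT (fun x : 'rV[R]_k => x ord0 i : R).
Proof.
apply: (measurability _ (RGenOpens.measurableE R)).
move=> _ [_ [a [b ->] <-]]; rewrite setTI; apply: open_measurable_rV.
have /continuousP := @coord_continuous R 1 k ord0 i.
by apply; exact: interval_open.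
Qed.

Let box (p : 'rV[rat]_k * nat) : set 'rV[R]_k :=
  [set x | forall i, `|ratr (p.1 ord0 i) - x ord0 i| < p.2.+1%:R^-1].

Lemma measurable_rVP d (T : measurableType d) (f : T -> 'rV[R]_k) :
  (forall i, measurable_fun setT (fun t => f t ord0 i : R)) ->
  measurable_fun setT f.
Proof.
move=> mf; apply: (@measurability _ _ _ _ _ _ (@open 'rV[R]_k)) => //.
move=> _ [U oU <-]; rewrite setTI.
have -> : U = \bigcup_p (if `[< box p `<=` U >] then box p else set0).
  apply/seteqP; split=> x /=; last first.
    by move=> [p _]; case: ifPn => // /asboolP; apply.
  move=> Ux; have /nbhs_ballP[e /= e0 xeU] := open_nbhs_nbhs (conj oU Ux).
  have [n ne] : exists n, n.+1%:R^-1 < e / 2 :> R.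
    have [n] := ltr_add_invr (divr_gt0 e0 (ltr0Sn _ 1)).
    by rewrite add0r; exists n.
  have n0 : 0 < n.+1%:R^-1 :> R by rewrite invr_gt0.
  have /(_ _)/cid2 q i : exists2 q : rat, true &
      `|ratr q - x ord0 i| < n.+1%:R^-1.
    have : x ord0 i - n.+1%:R^-1 < x ord0 i + n.+1%:R^-1.
      by rewrite ltrD2l gtrN.
    move=> /rat_in_itvoo[q]; rewrite in_itv/= => qx; exists q => //.
    by rewrite distrC ltr_distlC.
  exists (\row_i s2val (q i), n) => //.
  have boxx : box (\row_i s2val (q i), n) x.
    by move=> i /=; rewrite mxE; exact: s2valP' (q i).
  case: ifPn => // /asboolPn[] y /= boxy.
  apply: xeU; split => // j i; rewrite ord1 /ball/=.
  rewrite (le_lt_trans (ler_distD (ratr (s2val (q i))) _ _))//.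
  rewrite (splitr e) ltrD// (lt_trans _ ne)//.
    by rewrite distrC; exact: s2valP' (q i).
  by have := boxy i; rewrite mxE.
rewrite preimage_bigcup; apply: countable_bigcupT_measurable => // p.
case: ifPn => _; last by rewrite preimage_set0.
rewrite (_ : _ @^-1` _ = \bigcap_(i in [set: 'I_k])
  [set t | `|ratr (p.1 ord0 i) - f t ord0 i| < p.2.+1%:R^-1]); last first.
  by apply/seteqP; split=> t /= h i; [move=> _|]; exact: h.
apply: fin_bigcap_measurable => // i _.
rewrite (_ : [set _ | _] = (fun t => f t ord0 i) @^-1`
  (ball (ratr (p.1 ord0 i) : R) p.2.+1%:R^-1)); last by [].
by rewrite -[X in measurable X]setTI; apply: mf => //;
  apply: open_measurable; exact: ball_open.
Qed.
End borel_rV.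

Lemma bounded_rVP (R : realType) (k : nat) (B : set 'rV[R]_k) :
  bounded_set B <-> exists M, forall x, B x -> `|x| <= M.
Proof.
split=> [/pinfty_ex_gt0[M _ BM]|[M BM]]; first by exists M.
exists M; split; first exact: num_real.
by move=> N MN x Bx /=; rewrite (le_trans (BM _ Bx))// ltW.
Qed.

Section lf_measure.
Context (R : realType) (k : nat).

(* Locally finite measures on R^k, with the sigma-algebra generated by the
   evaluations at Borel sets; a random measure is a measurable map into this
   type. Values of a measure outside the Borel sets are irrelevant. *)
Record lf_measure := LfMeasure {
  lf_val :> {measure set 'rV[R]_k -> \bar R};
  lf_fin : forall B : set 'rV[R]_k,
    measurable B -> bounded_set B -> (lf_val B < +oo)%E }.

Lemma mzero_lf (B : set 'rV[R]_k) : measurable B -> bounded_set B ->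
  (@mzero _ 'rV[R]_k R B < +oo)%E.
Proof. by move=> _ _; exact: ltry. Qed.

HB.instance Definition _ := gen_eqMixin lf_measure.
HB.instance Definition _ := gen_choiceMixin lf_measure.
HB.instance Definition _ := isPointed.Build lf_measure (LfMeasure mzero_lf).

Definition lf_evaluations : set (set lf_measure) :=
  \bigcup_(B in @measurable _ 'rV[R]_k)
    preimage_set_system [set: lf_measure] (fun mu => mu B) measurable.

HB.instance Definition _ := @isMeasurable.Build
  (sigma_display lf_evaluations) lf_measure <<s lf_evaluations >>
  (@sigma_algebra0 _ setT _) (@sigma_algebraC _ _)
  (@sigma_algebra_bigcup _ setT _).

End lf_measure.

Section shift.
Context (R : realType) (k : nat).
Implicit Types (t : 'rV[R]_k) (B : set 'rV[R]_k).

Lemma measurable_subr_rV t : measurable_fun setT (fun x : 'rV[R]_k => x - t).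
Proof.
apply: measurable_rVP => i.
under eq_fun do rewrite !mxE.
by apply: measurable_funB => //; exact: measurable_coord.
Qed.

Lemma addr_image_rV t B : [set x + t | x in B] = (fun x => x - t) @^-1` B.
Proof.
apply/seteqP; split=> [_ [y By <-]|x /= Bx]; first by rewrite /= addrK.
by exists (x - t) => //; rewrite subrK.
Qed.

Lemma measurable_addr_image_rV t B :
  measurable B -> measurable [set x + t | x in B].
Proof.
move=> mB; rewrite addr_image_rV -[X in measurable X]setTI.
exact: measurable_subr_rV.
Qed.

Lemma bounded_addr_image_rV t B :
  bounded_set B -> bounded_set [set x + t | x in B].
Proof.
move=> /bounded_rVP[M BM]; apply/bounded_rVP; exists (M + `|t|) => _ [x Bx <-] /=.
by rewrite (le_trans (ler_normD _ _))// lerD2r; exact: BM.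
Qed.

Section shift_val.
Variables (t : 'rV[R]_k) (mu : {measure set 'rV[R]_k -> \bar R}).

Definition shift_val : set 'rV[R]_k -> \bar R :=
  fun B => mu [set x + t | x in B].

Let shift_valE : shift_val = pushforward mu (fun x => x - t).
Proof. by apply/funext => B; rewrite /shift_val addr_image_rV. Qed.

Let shift_val0 : shift_val set0 = 0%E.
Proof. by rewrite /shift_val image_set0 measure0. Qed.

Let shift_val_ge0 B : (0 <= shift_val B)%E.
Proof. exact: measure_ge0. Qed.

Let shift_val_sigma_additive : semi_sigma_additive shift_val.
Proof.
rewrite shift_valE.
exact: (@measure_semi_sigma_additive _ _ _
  (measure_function_pushforward__canonical__measure_function_Measure mu
    (measurable_subr_rV t))).
Qed.

HB.instance Definition _ := isMeasure.Build _ _ _ shift_val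
  shift_val0 shift_val_ge0 shift_val_sigma_additive.

End shift_val.

Lemma shift_lf t (mu : lf_measure R k) B :
  measurable B -> bounded_set B -> (shift_val t mu B < +oo)%E.
Proof.
move=> mB bB; apply: lf_fin; first exact: measurable_addr_image_rV.
exact: bounded_addr_image_rV.
Qed.

Definition shift t (mu : lf_measure R k) : lf_measure R k :=
  LfMeasure (shift_lf t mu).

End shift.

Section product_with_lebesgue.
Context (R : realType) (k : nat).

Definition snoc (p : 'rV[R]_k * measurableTypeR R) : 'rV[R]_k.+1 :=
  \row_(i < k.+1) oapp (p.1 ord0) p.2 (unlift ord_max i).

(* The first k coordinates of a vector of R^(k+1). *)
Definition init (t : 'rV[R]_k.+1) : 'rV[R]_k := col' ord_max t.

Lemma init_snoc p : init (snoc p) = p.1.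
Proof. by apply/rowP => i; rewrite !mxE liftK. Qed.

Lemma snoc_max p : snoc p ord0 ord_max = p.2.
Proof. by rewrite mxE unlift_none. Qed.

Lemma measurable_init : measurable_fun setT init.
Proof.
apply: measurable_rVP => i; under eq_fun do rewrite mxE.
exact: measurable_coord.
Qed.

Lemma measurable_snoc : measurable_fun setT snoc.
Proof.
apply: measurable_rVP => i; under eq_fun do rewrite mxE.
case: (unlift ord_max i) => [j|] /=; last exact: measurable_snd.
apply: (measurableT_comp (measurable_coord j)); exact: measurable_fst.
Qed.

Section prod_lebesgue.
Variable mu : {measure set 'rV[R]_k -> \bar R}.

Definition prod_lebesgue : set 'rV[R]_k.+1 -> \bar R :=
  pushforward (mu \x @lebesgue_measure R)%E snoc.

Let prod_lebesgue0 : prod_lebesgue set0 = 0%E.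
Proof. by rewrite /prod_lebesgue /pushforward preimage_set0 measure0. Qed.

Let prod_lebesgue_ge0 B : (0 <= prod_lebesgue B)%E.
Proof. by rewrite /prod_lebesgue /pushforward measure_ge0. Qed.

Let prod_lebesgue_sigma_additive : semi_sigma_additive prod_lebesgue.
Proof.
exact: (@measure_semi_sigma_additive _ _ _
  (measure_function_pushforward__canonical__measure_function_Measure _
    measurable_snoc)).
Qed.

HB.instance Definition _ := isMeasure.Build _ _ _ prod_lebesgue
  prod_lebesgue0 prod_lebesgue_ge0 prod_lebesgue_sigma_additive.

End prod_lebesgue.

Section prod_lebesgue_sigma_finite.
Variable mu : {sigma_finite_measure set 'rV[R]_k -> \bar R}.

Let prod_lebesgue_sigma_finite : sigma_finite setT (prod_lebesgue mu).
Proof.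
have /sigma_finiteP[F [TF ndF Foo]] := sigma_finiteT mu.
have /sigma_finiteP[G [TG ndG Goo]] := sigma_finiteT (@lebesgue_measure R).
exists (fun n => (fun x => (init x, x ord0 ord_max)) @^-1` (F n `*` G n)).
  apply/seteqP; split=> // x _.
  have : [set: 'rV[R]_k] (init x) by [].
  have : [set: measurableTypeR R] (x ord0 ord_max) by [].
  rewrite TF TG => -[m _ Gm] [n _ Fn]; exists (maxn n m) => //; split => /=.
    by move: Fn; exact/subsetPset/ndF/leq_maxl.
  by move: Gm; exact/subsetPset/ndG/leq_maxr.
move=> n; have [[mF Fn] [mG Gn]] := (Foo n, Goo n); split.
  rewrite -[X in measurable X]setTI.
  apply: measurable_fun_pair => //; last exact: measurableX.
    exact: measurable_init.
  exact: measurable_coord.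
rewrite /prod_lebesgue /pushforward (_ : _ @^-1` _ = F n `*` G n); last first.
  by apply/seteqP; split=> -[x r] /=; rewrite init_snoc snoc_max.
by rewrite product_measure1E// lte_mul_pinfty// ge0_fin_numE.
Qed.

HB.instance Definition _ := Measure_isSigmaFinite.Build _ _ _
  (prod_lebesgue mu) prod_lebesgue_sigma_finite.

End prod_lebesgue_sigma_finite.

Lemma prod_lebesgue_lf (mu : lf_measure R k) (B : set 'rV[R]_k.+1) :
  measurable B -> bounded_set B -> (prod_lebesgue mu B < +oo)%E.
Proof.
move=> mB /bounded_rVP[M BM].
have coordM (x : 'rV[R]_k.+1) i : B x -> `|x ord0 i| <= M.
  move=> /BM/=; rewrite [`|x|]mx_normrE => /bigmax_leP[_ /(_ (ord0, i))].
  exact.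
pose A := [set x : 'rV[R]_k | forall i, `|x ord0 i| <= M].
have mA : measurable A.
  rewrite (_ : A = \bigcap_(i in [set: 'I_k])
      ((fun x : 'rV[R]_k => x ord0 i) @^-1` [set` `[- M, M]])); last first.
    apply/seteqP; split=> x /= h i.
      by move=> _ /=; rewrite in_itv/= -ler_norml.
    by have := h i I; rewrite /= in_itv/= -ler_norml.
  apply: fin_bigcap_measurable => // i _.
  rewrite -[X in measurable X]setTI; exact: measurable_coord.
have bA : bounded_set A.
  apply/bounded_rVP; exists `|M| => x Ax /=.
  rewrite [`|x|]mx_normrE; apply/bigmax_leP; split => // -[j i] _ /=.
  by rewrite ord1 (le_trans (Ax i))// ler_norm.
pose I : set (measurableTypeR R) := [set` `[- M, M]].
have mI : measurable I by exact: measurable_itv.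
have BAI : snoc @^-1` B `<=` A `*` I.
  move=> [x r] /= Bxr; split => /=.
    move=> i; have := coordM _ (lift ord_max i) Bxr.
    by rewrite mxE liftK.
  by have := coordM _ ord_max Bxr; rewrite snoc_max /I/= in_itv/= -ler_norml.
apply: (@le_lt_trans _ _ ((mu \x @lebesgue_measure R) (A `*` I))%E).
  rewrite /= /prod_lebesgue /pushforward.
  apply: le_measure => //; rewrite inE; last exact: measurableX.
  by rewrite -[X in measurable X]setTI; exact: measurable_snoc.
rewrite product_measure1E// lte_mul_pinfty//.
- by rewrite ge0_fin_numE//; exact: lf_fin.
- have : (lebesgue_measure ([set` `[(- M)%R, M]] : set R) < +oo)%E by
    rewrite lebesgue_measure_itv; case: ifPn => //= _; rewrite ?ltry.
  exact.
Qed.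

(* The product of mu and the Lebesgue measure of R, on R^(k+1). *)
Definition hat (mu : lf_measure R k) : lf_measure R k.+1 :=
  LfMeasure (prod_lebesgue_lf mu).

End product_with_lebesgue.

(* Lebesgue measure on R^k, as an iterated product. *)
Fixpoint lebesgue_rV (R : realType) (k : nat) :
    {sigma_finite_measure set 'rV[R]_k -> \bar R} :=
  match k with
  | 0 => dirac (0 : 'rV[R]_0)
  | k'.+1 => prod_lebesgue (lebesgue_rV R k')
  end.

Definition boundary (T : topologicalType) (A : set T) : set T :=
  closure A `\` interior A.

Definition msupport (R : realType) (k : nat)
    (mu : {measure set 'rV[R]_k -> \bar R}) : set 'rV[R]_k :=
  [set x | forall U, open U -> U x -> (0 < mu U)%E].

(* mu(. | A); only meaningful when 0 < mu A < +oo. *)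
Definition cond_measure d (T : measurableType d) (R : realType)
    (mu : {measure set T -> \bar R}) (A : set T) : set T -> \bar R :=
  fun B => (mu (B `&` A) / mu A)%E.

Record action (R : realType) (k : nat) d (F : measurableType d) := Action {
  act :> 'rV[R]_k -> F -> F;
  act0 : forall x, act 0 x = x;
  actD : forall s t x, act (s + t) x = act s (act t x);
  measurable_act : measurable_fun setT (fun p : 'rV[R]_k * F => act p.1 p.2) }.

Section extend_action.
Context (R : realType) (k : nat) d (F : measurableType d).
Variable th : action R k F.

Let eact (t : 'rV[R]_k.+1) (x : F) := th (init t) x.

Let eact0 x : eact 0 x = x.
Proof. by rewrite /eact /init [col' _ 0]linear0 act0. Qed.

Let eactD s t x : eact (s + t) x = eact s (eact t x).
Proof. by rewrite /eact /init linearD actD. Qed.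

Let measurable_eact :
  measurable_fun setT (fun p : 'rV[R]_k.+1 * F => eact p.1 p.2).
Proof.
have mg : measurable_fun setT (fun p : 'rV[R]_k.+1 * F => (init p.1, p.2)).
  apply: measurable_fun_pair; last exact: measurable_snd.
  exact: (measurableT_comp (@measurable_init R k) measurable_fst).
exact: (measurableT_comp (measurable_act th) mg).
Qed.

Definition extend_action : action R k.+1 F :=
  Action eact0 eactD measurable_eact.

End extend_action.

Section distributions.
Context (R : realType) dO (Omega : measurableType dO).
Variable P : {measure set Omega -> \bar R}.
Local Open Scope ereal_scope.

Definition same_distribution d (T : measurableType d) (f g : Omega -> T) :=
  forall A, measurable A -> pushforward P f A = pushforward P g A.

(* kappa (Z, .) is the conditional distribution of V given Z. *)
Definition conditional_distribution d (T : measurableType d)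
    d' (T' : measurableType d') (V : Omega -> T') (Z : Omega -> T)
    (kappa : T -> set T' -> \bar R) :=
  forall A B, measurable A -> measurable B ->
    P (Z @^-1` A `&` V @^-1` B) = \int[P]_(w in Z @^-1` A) kappa (Z w) B.

(* (Omega', P') extends (Omega, P) if p maps P' to P; random elements f of
   Omega are identified with f \o p. *)
Definition extension dO' (Omega' : measurableType dO')
    (P' : {measure set Omega' -> \bar R}) (p : Omega' -> Omega) :=
  measurable_fun setT p /\
  forall A, measurable A -> pushforward P' p A = P A.

(* Y is stationary, independent of Z; nu is the law of Y. P need not be finite,
   so that independence refers to the product of nu and the law of Z. *)
Definition stationary_independent k dF (F : measurableType dF)
    (thF : action R k F) d (T : measurableType d)
    (Y : Omega -> F) (Z : Omega -> T) :=
  exists nu : probability F R,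
    (forall t A, measurable A -> pushforward nu (thF t) A = nu A) /\
    (forall A B, measurable A -> measurable B ->
      P (Y @^-1` A `&` Z @^-1` B) = nu A * pushforward P Z B).

End distributions.

Section mass_stationarity.
Context (R : realType) (d : nat) dE (E : measurableType dE).
Context dO (Omega : measurableType dO).
Variables (th : action R d E) (P : {measure set Omega -> \bar R}).
Variables (X : Omega -> E) (xi : Omega -> lf_measure R d).

(* U and V are external randomizations, living on an extension; the joint law of
   ((X', xi'), U, V) does not depend on the extension chosen. *)
Definition mass_stationary :=
  forall C : set 'rV[R]_d,
    measurable C -> bounded_set C ->
    (0 < lebesgue_rV R d C)%E -> lebesgue_rV R d (boundary C) = 0%E ->
  forall dO' (Omega' : measurableType dO') (P' : {measure set Omega' -> \bar R})
    (p : Omega' -> Omega) (U V : Omega' -> 'rV[R]_d),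
    extension P P' p -> measurable_fun setT U -> measurable_fun setT V ->
    let X' := X \o p in let xi' := xi \o p in
    conditional_distribution P' U (fun w => (X' w, xi' w))
      (fun _ => cond_measure (lebesgue_rV R d) C) ->
    conditional_distribution P' V (fun w => ((X' w, xi' w), U w))
      (fun z => cond_measure z.1.2 [set y - z.2 | y in C]) ->
  same_distribution P'
    (fun w => ((th (V w) (X' w), shift (V w) (xi' w)), V w + U w))
    (fun w => ((X' w, xi' w), U w)).

End mass_stationarity.

Section preserving_shifts.
Context (R : realType) (k : nat).

Definition allocation dF (F : measurableType dF) (thF : action R k F)
    (pi : F * lf_measure R k -> 'rV[R]_k) (y : F) (eta : lf_measure R k)
    (s : 'rV[R]_k) : 'rV[R]_k :=
  s + pi (thF s y, shift s eta).

(* Preservation is required at every value (Y w, zeta w) taken by (Y, zeta). *)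
Definition preserving_shift dF (F : measurableType dF) (thF : action R k F)
    dO (Omega : measurableType dO) (Y : Omega -> F)
    (zeta : Omega -> lf_measure R k) (pi : F * lf_measure R k -> 'rV[R]_k) :=
  measurable_fun setT pi /\
  forall w B, measurable B ->
    zeta w (allocation thF pi (Y w) (zeta w) @^-1` B) = zeta w B.

Definition invariant_under_preserving_shifts dE (E : measurableType dE)
    (th : action R k E) dO (Omega : measurableType dO)
    (P : {measure set Omega -> \bar R})
    (X : Omega -> E) (zeta : Omega -> lf_measure R k) :=
  forall dO' (Omega' : measurableType dO') (P' : {measure set Omega' -> \bar R})
    (p : Omega' -> Omega), extension P P' p ->
  let X' := X \o p in let zeta' := zeta \o p in
  forall dF (F : measurableType dF) (thF : action R k F) (Y : Omega' -> F),
    measurable_fun setT Y ->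
    stationary_independent P' thF Y (fun w => (X' w, zeta' w)) ->
  forall pi : F * lf_measure R k -> 'rV[R]_k,
    preserving_shift thF Y zeta' pi ->
  same_distribution P'
    (fun w => let t := pi (Y w, zeta' w) in
      (thF t (Y w), th t (X' w), shift t (zeta' w)))
    (fun w => (Y w, X' w, zeta' w)).

End preserving_shifts.

(* Main.v *)
(* Mass-stationarity and invariance are linked by the Mecke identity: the measure
   P(dw) xi_w(dv) is invariant under (z, v) |-> (theta_v z, -v), where z = (X, xi).

   Mass-stationarity on a window C is an identity for the measure
   P(dw) 1_C(u) du 1_C(u + v) xi_w(dv) / xi_w(C - u). Multiplying test functions by
   xi_w(C - u) removes the normalization, and letting C vary over intersections of a
   cube with sets of null boundary yields the Mecke identity.

   The Mecke identity passes from xi to xi (x) lambda_1 and absorbs an independent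
   stationary Y. Transporting a unit of mass spread around the origin shows that a
   preserving shift of the resulting triple leaves its law unchanged.

   Conversely, given a window C inside a cell, let Y be a uniform phase on the torus
   of that cell times an interval. Over the phases with first coordinates u in C the
   mass sees C - u, and the last coordinate of the phase, on which xi (x) lambda_1 is
   uniform, serves to sample V from xi(. | C - u). Moving by (V, .) preserves
   xi (x) lambda_1 on every translate of the cell, and invariance under this shift is
   mass-stationarity on C. *)
Require Import Defs.
From HB Require Import structures.
From mathcomp Require Import all_boot all_order all_algebra.
From mathcomp Require Import all_classical all_reals all_analysis.
From mathcomp Require Import measurable_realfun.
From mathcomp Require Import ring lra.

Set Implicit Arguments.
Unset Strict Implicit.
Unset Printing Implicit Defensive.

Import Order.TTheory GRing.Theory Num.Theory.
Import numFieldTopology.Exports numFieldNormedType.Exports.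

Local Open Scope classical_set_scope.
Local Open Scope ring_scope.

Local Notation shift := Defs.shift.
Local Notation image_measure :=
  measure_function_pushforward__canonical__measure_function_Measure.

(** * Locally finite measures as kernels *)

(** Three obstacles shape the proof. The measure [xi] may have atoms, and no shift that moves whole
    points can split an atom; the factor [lambda_1] spreads each atom over a line, so that its mass
    can be distributed at will. A stationary background must have an invariant law of total mass
    one, which excludes Lebesgue measure on the whole space as the law of a position and leads to a
    torus. Finally the normalization by [xi (C - u)] may meet a zero mass. Since 0 lies in the
    support of [xi] and the boundary of [C] is null, the mass is positive for almost every [u] in
    [C]; elsewhere the inverse mass reads 0. The support condition also excludes the event [xi = 0],
    on which the Mecke identity says nothing.

    All laws are sigma-finite at best, and [xi] has unbounded local masses. Two such measures cannot
    be compared on a generating pi-system at once; they are compared on countably many pieces where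
    both the law and the mass of a cube are bounded. *)

Lemma preimage_measurable d1 d2 (T1 : measurableType d1) (T2 : measurableType d2)
    (f : T1 -> T2) (A : set T2) :
  measurable_fun setT f -> measurable A -> measurable (f @^-1` A).
Proof. by move=> mf mA; rewrite -[X in measurable X]setTI; exact: mf. Qed.

Section cube.
Context (R : realType) (k : nat).

Definition cube (n : nat) : set 'rV[R]_k := [set x | `|x| < n%:R].

Lemma measurable_cube n : measurable (cube n).
Proof.
apply: open_measurable_rV; rewrite (_ : cube n = ball (0 : 'rV[R]_k) n%:R).
  exact: ball_open.
by apply/seteqP; split=> x; rewrite -ball_normE /ball_ /cube /= sub0r normrN.
Qed.

Lemma bounded_cube n : bounded_set (cube n).
Proof. by apply/bounded_rVP; exists n%:R => x /ltW. Qed.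

Lemma subset_cube m n : (m <= n)%N -> cube m `<=` cube n.
Proof. by move=> mn x /lt_le_trans; apply; rewrite ler_nat. Qed.

Lemma bigcup_cube : \bigcup_n cube n = setT.
Proof.
apply/seteqP; split=> // x _; exists (Num.truncn `|x|).+1 => //=.
exact: truncnS_gt.
Qed.

Lemma bounded_sub_cube (B : set 'rV[R]_k) :
  bounded_set B -> exists n, B `<=` cube n.
Proof.
move=> /bounded_rVP[M BM]; exists (Num.truncn M).+1 => x /BM /=.
by move=> /le_lt_trans; apply; exact: truncnS_gt.
Qed.

End cube.

Section measurable_lf.
Context (R : realType) (k : nat).
Local Notation M := (lf_measure R k).
Local Notation V := 'rV[R]_k.

Lemma measurable_lf_eval (B : set V) :
  measurable B -> measurable_fun setT (fun mu : M => mu B).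
Proof.
move=> mB _ Y mY; rewrite setTI; apply: sub_sigma_algebra.
by exists B => //; exists Y => //; rewrite setTI.
Qed.

Lemma measurable_lfP d (T : measurableType d) (f : T -> M) :
  (forall B, measurable B -> measurable_fun setT (fun t => f t B)) ->
  measurable_fun setT f.
Proof.
move=> mf; apply: (@measurability _ _ _ _ _ _ (@lf_evaluations R k)) => //.
move=> _ [_ [B mB [Y mY <-]] <-]; rewrite !setTI.
by have := mf B mB measurableT Y mY; rewrite setTI.
Qed.

(* [lf_equiv] is weaker than equality, as measures may differ off the Borel sets,
   but measurable sets and measurable maps do not see the difference. *)
Definition lf_equiv (mu nu : M) := forall B, measurable B -> mu B = nu B.

(** The sets that do not separate [mu] from [nu] form a sigma-algebra, and it contains the
    generating evaluation sets. *)
Lemma lf_equiv_mem (mu nu : M) (A : set M) :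
  lf_equiv mu nu -> measurable A -> A mu = A nu.
Proof.
move=> munu; rewrite /measurable /=.
suff : <<s @lf_evaluations R k >> `<=` [set A | A mu = A nu] by exact.
apply: smallest_sub; last first.
  by move=> _ [B mB [Y mY <-]] /=; rewrite munu.
split=> /=; first by [].
  by move=> B BE; rewrite /= BE.
move=> F FE /=; apply/propext; split=> -[n _ Fn]; exists n => //.
  by rewrite -FE.
by rewrite FE.
Qed.

Lemma lf_equiv_ereal (f : M -> \bar R) (mu nu : M) :
  measurable_fun setT f -> lf_equiv mu nu -> f mu = f nu.
Proof.
move=> mf munu; have := lf_equiv_mem munu (mf measurableT _ (emeasurable_set1 (f nu))).
by rewrite setTI /= => ->.
Qed.

Lemma lf_equiv_mem_pair d (T : measurableType d) (x : T) (mu nu : M)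
    (A : set (T * M)) :
  lf_equiv mu nu -> measurable A -> A (x, mu) = A (x, nu).
Proof.
move=> munu mA; pose B := (fun nu : M => (x, nu)) @^-1` A.
suff /(lf_equiv_mem munu) : measurable B by [].
exact: (preimage_measurable (measurable_fun_pair2 x (@measurable_id _ _ setT))).
Qed.

Lemma lf_equiv_rV m (f : M -> 'rV[R]_m) (mu nu : M) :
  measurable_fun setT f -> lf_equiv mu nu -> f mu = f nu.
Proof.
move=> mf munu; apply/rowP => i.
have mfi : measurable_fun setT (fun mu => (f mu ord0 i)%:E).
  apply/measurable_EFinP.
  exact: (measurableT_comp (measurable_coord i) mf).
by have [] := lf_equiv_ereal mfi munu.
Qed.

Section kernel_integral.
Context d (T : measurableType d) (f : T -> M).
Hypothesis mf : measurable_fun setT f.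

Let kf (t : T) : {measure set V -> \bar R} := lf_val (f t).

Let measurable_kf U : measurable U -> measurable_fun setT (kf ^~ U).
Proof. by move=> mU; exact: (measurableT_comp (measurable_lf_eval mU) mf). Qed.

HB.instance Definition _ := isKernel.Build _ _ _ _ _ kf measurable_kf.

(** Sections are first cut down to a cube, where local finiteness gives a finite measure; the cubes
    are then exhausted by continuity from below. *)
Lemma measurable_lf_xsection (S : set (T * V)) : measurable S ->
  measurable_fun setT (fun t => f t (xsection S t)).
Proof.
move=> mS.
have mSn n : measurable_fun setT
    (fun t => mrestr (kf t) (@measurable_cube R k n) (xsection S t)).
  have [|//] := @measurable_prod_subset_xsection_kernel _ _ _ _ _ kf _
    (@measurable_cube R k n) _ _ mS.
  (* The bound asked for is strict, hence the added 1. *)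
  move=> t; exists (fine (f t (cube n)) + 1) => B mB.
  apply: (@le_lt_trans _ _ (f t (cube n))).
    apply: le_measure; rewrite ?inE; last exact: subIsetr.
      by apply: measurableI => //; exact: measurable_cube.
    exact: measurable_cube.
  have fin : f t (@cube R k n) \is a fin_num.
    rewrite ge0_fin_numE//; apply: lf_fin; first exact: measurable_cube.
    exact: bounded_cube.
  by rewrite -[X in (X < _)%E]fineK// lte_fin ltrDl.
apply: (emeasurable_fun_cvg _ _ mSn) => t _.
have SE : xsection S t = \bigcup_n (xsection S t `&` cube n).
  by rewrite -setI_bigcupr bigcup_cube setIT.
rewrite [X in _ --> f t X]SE.
apply: (@nondecreasing_cvg_mu _ _ _ (lf_val (f t))).
- move=> n; apply: measurableI; first exact: measurable_xsection.
  exact: measurable_cube.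
- rewrite -setI_bigcupr bigcup_cube setIT; exact: measurable_xsection.
- by move=> m n mn; apply/subsetPset; apply: setIS; exact: subset_cube.
Qed.

Import HBNNSimple.

Lemma measurable_lf_integral (g : T * V -> \bar R) :
  (forall z, 0 <= g z)%E -> measurable_fun setT g ->
  measurable_fun setT (fun t => \int[f t]_v g (t, v))%E.
Proof.
move=> g0 mg; pose g_ := nnsfun_approx measurableT mg.
apply: (@measurable_fun_xsection_integral _ _ _ _ _ g kf g_).
- by move=> a b ab; exact/nd_nnsfun_approx.
- by move=> z; exact/cvg_nnsfun_approx.
- move=> n r; apply: measurable_lf_xsection.
  exact: measurable_funPTI.
Qed.

End kernel_integral.

End measurable_lf.

Lemma pmule_inj (R : realType) (c : R) :
  (0 < c)%R -> injective (fun x : \bar R => c%:E * x)%E.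
Proof.
move=> c0 x y /(congr1 (fun z => (c^-1)%:E * z)%E).
by rewrite !muleA -EFinM mulVf ?gt_eqF// !mul1e.
Qed.

(** * Tonelli's theorem, measures equal on a countable cover, semidirect products *)

Section measure_kit.
Local Open Scope ereal_scope.
Context (R : realType).

Lemma integral_pushT d1 d2 (T1 : measurableType d1) (T2 : measurableType d2)
    (mu : {measure set T1 -> \bar R}) (phi : T1 -> T2) (f : T2 -> \bar R) :
  measurable_fun setT phi -> measurable_fun setT f -> (forall y, 0 <= f y) ->
  \int[pushforward mu phi]_y f y = \int[mu]_x f (phi x).
Proof.
move=> mphi mf f0.
by rewrite ge0_integral_pushforward// preimage_setT.
Qed.

Lemma eq_integral_measure d (T : measurableType d)
    (mu nu : {measure set T -> \bar R}) (f : T -> \bar R) :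
  (forall A, measurable A -> mu A = nu A) -> \int[mu]_x f x = \int[nu]_x f x.
Proof. by move=> munu; apply: eq_measure_integral => A mA _; exact: munu. Qed.

Section pack.
Context d (T : measurableType d) (mu : {measure set T -> \bar R}).
Hypothesis smu : sigma_finite setT mu.
(** A copy of [mu] under a new name: sigma-finiteness known from a hypothesis becomes a canonical
    instance, and product measures and Tonelli's theorem apply. *)
Definition sigma_finite_pack : set T -> \bar R := mu.
HB.instance Definition _ := Measure.on sigma_finite_pack.
HB.instance Definition _ :=
  Measure_isSigmaFinite.Build _ _ _ sigma_finite_pack smu.
Definition sigma_finite_of : {sigma_finite_measure set T -> \bar R} :=
  sigma_finite_pack.
End pack.

Section tonelli.
Context d1 d2 (T1 : measurableType d1) (T2 : measurableType d2).
Variables (mu : {measure set T1 -> \bar R}) (nu : {measure set T2 -> \bar R}).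
Variable f : T1 * T2 -> \bar R.
Hypotheses (mf : measurable_fun setT f) (f0 : forall z, 0 <= f z).

Lemma measurable_integral_snd : sigma_finite setT nu ->
  measurable_fun setT (fun x => \int[nu]_y f (x, y)).
Proof.
by move=> snu; have := @measurable_fun_fubini_tonelli_F _ _ _ _ _
  (sigma_finite_of snu) _ mf f0.
Qed.

Lemma tonelli : sigma_finite setT mu -> sigma_finite setT nu ->
  \int[mu]_x \int[nu]_y f (x, y) = \int[nu]_y \int[mu]_x f (x, y).
Proof.
by move=> smu snu; exact: (@fubini_tonelli _ _ _ _ _
  (sigma_finite_of smu) (sigma_finite_of snu) _ mf f0).
Qed.

End tonelli.

(** The index is any countable type, so that vectors of integers can index the cells of a lattice;
    [unpickle] makes a sequence of the cover, padded with empty sets. *)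
Lemma measure_eq_cover (I : countType) d (T : measurableType d) (g : I -> set T)
    (mu nu : {measure set T -> \bar R}) :
  (forall i, measurable (g i)) -> (forall x, exists i, g i x) ->
  (forall i A, measurable A -> A `<=` g i -> mu A = nu A) ->
  forall A, measurable A -> mu A = nu A.
Proof.
move=> mg cg munu A mA.
pose g' n := if unpickle n is Some i then g i else set0.
have mg' n : measurable (g' n) by rewrite /g'; case: unpickle.
apply: (@g_sigma_algebra_measure_unique_cover _ _ _ measurable _ g').
- by [].
- by [].
- apply/seteqP; split=> // x _; have [i gix] := cg x.
  by exists (pickle i) => //; rewrite /g' pickleK.
- move=> n B; rewrite sigma_algebra_id; last exact: sigma_algebra_measurable.
  move=> mB; rewrite /g'; case: unpickle => [i|]; last by rewrite set0I !measure0.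
  by apply: (munu i); [exact: measurableI|exact: subIsetl].
- exact: sub_sigma_algebra.
Qed.

Section semidirect_product.
Context d1 d2 (T1 : measurableType d1) (T2 : measurableType d2).
Variables (mu : {measure set T1 -> \bar R}).
Variables (kap : T1 -> {measure set T2 -> \bar R}).

(** The kernels used here take infinite values; measurability is asked on sections directly, the
    form in which the semidirect product integrates it. *)
Definition xsection_measurable := forall S : set (T1 * T2), measurable S ->
  measurable_fun setT (fun x => kap x (xsection S x)).

Hypothesis mkap : xsection_measurable.

(** The measure [mu (dx) kap_x (dy)]. The proof of measurability is an argument, so that the measure
    structure can be attached to the term. *)
Definition semidirect of xsection_measurable := fun S : set (T1 * T2) =>
  \int[mu]_x kap x (xsection S x).

Local Notation m := (semidirect mkap).

Let m0 : m set0 = 0.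
Proof. by rewrite [LHS]integral0_eq// => x/= _; rewrite xsection0 measure0. Qed.

Let m_ge0 A : 0 <= m A.
Proof. by apply: integral_ge0 => // *. Qed.

Let m_sigma_additive : semi_sigma_additive m.
Proof.
move=> F mF tF mUF.
rewrite [X in _ --> X](_ : _ = \sum_(n <oo) m (F n)).
  by apply/cvg_closeP; split; [exact: is_cvg_nneseries|rewrite closeE].
rewrite -integral_nneseries//; last by move=> n; exact: mkap.
apply: eq_integral => x _; apply/esym/cvg_lim => //=; rewrite xsection_bigcup.
apply: (measure_sigma_additive _ (trivIset_xsection tF)) => ?.
exact: measurable_xsection.
Qed.

HB.instance Definition _ := isMeasure.Build _ _ _ m m0 m_ge0 m_sigma_additive.

Import HBNNSimple.

Section integral.
Variable f : T1 * T2 -> \bar R.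
Hypotheses (mf : measurable_fun setT f) (f0 : forall z, 0 <= f z).

Lemma measurable_integral_semidirect :
  measurable_fun setT (fun x => \int[kap x]_y f (x, y)).
Proof.
pose g_ := nnsfun_approx measurableT mf.
apply: (@measurable_fun_xsection_integral _ _ _ _ _ f kap g_).
- by move=> a b ab; exact/nd_nnsfun_approx.
- by move=> z; exact/cvg_nnsfun_approx.
- by move=> n r; apply: mkap; exact: measurable_funPTI.
Qed.

End integral.

Let semidirect_indic (A : set (T1 * T2)) : measurable A ->
  \int[m]_z (\1_A z)%:E = \int[mu]_x \int[kap x]_y (\1_A (x, y))%:E.
Proof.
move=> mA; rewrite integral_indic// setIT; apply: eq_integral => x _.
rewrite integral_indic//; last first.
  exact: (preimage_measurable (measurable_fun_pair2 x (@measurable_id _ _ setT))).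
by rewrite setIT; congr (kap x _); apply/seteqP; split=> y; rewrite /xsection /= inE.
Qed.

Let semidirect_nnsfun (g : {nnsfun T1 * T2 >-> R}) :
  \int[m]_z (g z)%:E = \int[mu]_x \int[kap x]_y (g (x, y))%:E.
Proof.
have mi r x : measurable_fun setT (fun y => (r * \1_(g @^-1` [set r]) (x, y))%:E).
  apply/measurable_EFinP; apply: measurable_funM => //.
  exact: (measurable_fun_pair2 x (measurable_indic _)).
under [in LHS]eq_integral do rewrite fimfunE -fsumEFin//.
rewrite ge0_integral_fsum//; last 2 first.
- by move=> r; exact/measurable_EFinP/measurableT_comp.
- by move=> r z _; rewrite EFinM nnfun_muleindic_ge0.
transitivity (\int[mu]_x \sum_(r \in range g)
    \int[kap x]_y (r * \1_(g @^-1` [set r]) (x, y))%:E); last first.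
  apply: eq_integral => x _; rewrite -ge0_integral_fsum//; last first.
    by move=> r y _; rewrite EFinM nnfun_muleindic_ge0.
  by apply: eq_integral => y _; rewrite fsumEFin// -fimfunE.
have mI r : measurable_fun setT
    (fun x => \int[kap x]_y (\1_(g @^-1` [set r]) (x, y))%:E).
  apply: (@measurable_integral_semidirect (fun z => (\1_(g @^-1` [set r]) z)%:E)).
    exact/measurable_EFinP/measurable_indic.
  by move=> z; rewrite lee_fin.
have E r x : \int[kap x]_y (r * \1_(g @^-1` [set r]) (x, y))%:E =
    r%:E * \int[kap x]_y (\1_(g @^-1` [set r]) (x, y))%:E.
  have [r0|r0] := leP 0%R r.
    under eq_integral do rewrite EFinM.
    rewrite ge0_integralZl//; apply/measurable_EFinP.
    exact: (measurable_fun_pair2 x (measurable_indic _)).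
  rewrite preimage_nnfun0//.
  by rewrite !integral0_eq ?mule0// => y _; rewrite indic0 ?mulr0.
rewrite ge0_integral_fsum//; last 2 first.
- move=> r; under eq_fun do rewrite E.
  exact: measurable_funeM.
- move=> r x _; apply: integral_ge0 => y _.
  by rewrite EFinM nnfun_muleindic_ge0.
apply: eq_fsbigr => r _.
rewrite (integralZl_indic _ (fun r => g @^-1` [set r]))//; last first.
  by move=> r0; rewrite preimage_nnfun0.
rewrite semidirect_indic; last exact: measurable_funPTI.
under [RHS]eq_integral do rewrite E.
have [r0|r0] := leP 0%R r.
  rewrite ge0_integralZl// => x _; apply: integral_ge0 => y _.
  by rewrite lee_fin.
rewrite preimage_nnfun0//.
rewrite [in RHS]integral0_eq; last first.
  by move=> x _; rewrite integral0_eq ?mule0// => y _; rewrite indic0.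
rewrite integral0_eq ?mule0// => x _.
by rewrite integral0_eq// => y _; rewrite indic0.
Qed.

(** Tonelli's theorem for a measure followed by a kernel, through indicators, simple functions and
    monotone limits. *)
Lemma integral_semidirect (f : T1 * T2 -> \bar R) :
  measurable_fun setT f -> (forall z, 0 <= f z) ->
  \int[m]_z f z = \int[mu]_x \int[kap x]_y f (x, y).
Proof.
move=> mf f0; pose f_ := nnsfun_approx measurableT mf.
have mfn n : measurable_fun setT (fun z => (f_ n z)%:E) by exact/measurable_EFinP.
have mfx n x : measurable_fun setT (fun y => (f_ n (x, y))%:E).
  exact: (measurable_fun_pair2 x (mfn n)).
have ndf z a b : (a <= b)%N -> (f_ a z)%:E <= (f_ b z)%:E.
  by move=> ab; rewrite lee_fin; exact/lefP/nd_nnsfun_approx.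
transitivity (\int[m]_z limn (fun n => (f_ n z)%:E)).
  by apply/eq_integral => z _; apply/esym/cvg_lim => //=; exact: cvg_nnsfun_approx.
rewrite monotone_convergence//; last 2 first.
- by move=> n z _; rewrite lee_fin.
- by move=> z _ a b ab; exact: ndf.
under eq_fun do rewrite semidirect_nnsfun.
transitivity (\int[mu]_x limn (fun n => \int[kap x]_y (f_ n (x, y))%:E)).
  rewrite monotone_convergence//.
  - move=> n; apply: (@measurable_integral_semidirect (fun z => (f_ n z)%:E)) => //.
    by move=> z; rewrite lee_fin.
  - by move=> n x _; apply: integral_ge0 => y _; rewrite lee_fin.
  - move=> x _ a b ab; apply: ge0_le_integral => //.
    by move=> y _; rewrite lee_fin.
    by move=> y _; exact: ndf.
apply: eq_integral => x _; rewrite -monotone_convergence//.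
- by apply: eq_integral => y _; apply/cvg_lim => //; exact: cvg_nnsfun_approx.
- by move=> n y _; rewrite lee_fin.
- by move=> y _ a b ab; exact: ndf.
Qed.

End semidirect_product.

End measure_kit.

(** * Shifts and products with Lebesgue measure *)

Section lebesgue_line.
Local Open Scope ereal_scope.
Context (R : realType).
Local Notation L := (@lebesgue_measure R).

Lemma sigma_finite_lebesgue : sigma_finite setT L.
Proof. exact: sigma_finiteT. Qed.

(** Translation keeps the length of half-open intervals, which determine the measure. *)
Lemma lebesgue_measureD (t : R) (A : set (measurableTypeR R)) : measurable A ->
  L ((fun x => x + t)%R @^-1` A) = L A.
Proof.
move=> mA.
have mD : measurable_fun setT ((fun x => x + t)%R : measurableTypeR R -> measurableTypeR R).
  by apply: measurable_funD.
pose m := image_measure L mD.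
apply/esym/(@lebesgue_measure_unique _ m) => // _ [[a b]] _ <-.
rewrite /m /= /pushforward.
rewrite (_ : _ @^-1` _ = [set` `](a - t)%R, (b - t)%R]]); last first.
  by apply/seteqP; split=> x; rewrite /= !in_itv /= ltrBlDr lerBrDr.
rewrite !lebesgue_measure_itv/= !lte_fin ltrD2r; case: ifPn => // _.
by rewrite -!EFinB opprB addrA subrK.
Qed.

Lemma integral_lebesgueN (f : measurableTypeR R -> \bar R) :
  measurable_fun setT f -> (forall x, 0 <= f x) ->
  \int[L]_x f (- x)%R = \int[L]_x f x.
Proof.
move=> mf f0.
have mN : measurable_fun setT (-%R : measurableTypeR R -> measurableTypeR R).
  by [].
rewrite -(integral_pushT L mN mf f0).
have := @eq_integral_measure R _ _
  (image_measure L mN) L f.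
by apply=> A mA; exact: lebesgue_measureN.
Qed.

End lebesgue_line.

Section lf_shift.
Local Open Scope ereal_scope.
Context (R : realType) (k : nat).
Local Notation M := (lf_measure R k).
Local Notation V := 'rV[R]_k.

Lemma sigma_finite_lf (mu : M) : sigma_finite setT mu.
Proof.
exists (@cube R k); first by rewrite bigcup_cube.
move=> n; split; first exact: measurable_cube.
by apply: lf_fin; [exact: measurable_cube|exact: bounded_cube].
Qed.

Lemma lf_equiv_trans (mu nu rho : M) :
  lf_equiv mu nu -> lf_equiv nu rho -> lf_equiv mu rho.
Proof. by move=> h1 h2 B mB; rewrite h1// h2. Qed.

Lemma shiftE t (mu : M) B : shift t mu B = mu ((fun x => x - t)%R @^-1` B).
Proof. by rewrite -addr_image_rV. Qed.

Lemma integral_shift t (mu : M) (f : V -> \bar R) :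
  measurable_fun setT f -> (forall x, 0 <= f x) ->
  \int[shift t mu]_v f v = \int[mu]_v f (v - t)%R.
Proof.
move=> mf f0; rewrite -(integral_pushT mu (measurable_subr_rV t) mf f0).
have := @eq_integral_measure R _ _ (lf_val (shift t mu))
  (image_measure mu
    (measurable_subr_rV t)) f.
by apply=> A mA; rewrite shiftE.
Qed.

Lemma shift_equiv t (mu nu : M) :
  lf_equiv mu nu -> lf_equiv (shift t mu) (shift t nu).
Proof.
move=> h B mB; rewrite !shiftE h//.
exact: (preimage_measurable (measurable_subr_rV t)).
Qed.

Lemma shift_shift s t (mu : M) :
  lf_equiv (shift s (shift t mu)) (shift (s + t)%R mu).
Proof.
move=> B mB; rewrite !shiftE; congr (mu _); apply/seteqP; split=> x /=.
  by rewrite opprD addrAC addrA.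
by rewrite opprD addrAC addrA.
Qed.

Lemma measurable_addr_rV d (T : measurableType d) (f g : T -> V) :
  measurable_fun setT f -> measurable_fun setT g ->
  measurable_fun setT (fun x => f x + g x)%R.
Proof.
move=> mf mg; apply: measurable_rVP => i; under eq_fun do rewrite mxE.
by apply: measurable_funD; exact: (measurableT_comp (measurable_coord i)).
Qed.

Lemma measurable_oppr_rV d (T : measurableType d) (f : T -> V) :
  measurable_fun setT f -> measurable_fun setT (fun x => - f x)%R.
Proof.
move=> mf; apply: measurable_rVP => i; under eq_fun do rewrite mxE.
by apply: measurable_funN; exact: (measurableT_comp (measurable_coord i)).
Qed.

Lemma measurable_subr2_rV d (T : measurableType d) (f g : T -> V) :
  measurable_fun setT f -> measurable_fun setT g ->
  measurable_fun setT (fun x => f x - g x)%R.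
Proof.
by move=> mf mg; apply: measurable_addr_rV => //; exact: measurable_oppr_rV.
Qed.

Lemma measurable_shift d (T : measurableType d) (f : T -> V) (g : T -> M) :
  measurable_fun setT f -> measurable_fun setT g ->
  measurable_fun setT (fun x => shift (f x) (g x)).
Proof.
move=> mf mg; apply: measurable_lfP => B mB.
pose S := (fun z : T * V => z.2 - f z.1)%R @^-1` B.
have mS : measurable S.
  apply: preimage_measurable mB; apply: measurable_subr2_rV => //.
  exact: measurableT_comp.
have := measurable_lf_xsection mg mS.
congr (measurable_fun _ _); apply/funext => x; rewrite shiftE.
by congr (g x _); apply/seteqP; split=> v; rewrite /xsection /= inE.
Qed.

End lf_shift.

Section snoc_lemmas.
Context (R : realType) (k : nat).

Lemma snocE (t : 'rV[R]_k.+1) : snoc (init t, t ord0 ord_max) = t.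
Proof.
apply/rowP => i; rewrite mxE; case: unliftP => [j ->|->] /=; last by [].
by rewrite mxE.
Qed.

Lemma snocD (p q : 'rV[R]_k * measurableTypeR R) :
  snoc p + snoc q = snoc (p.1 + q.1, p.2 + q.2).
Proof. by apply/rowP => i; rewrite !mxE; case: unliftP => [j _|_] /=; rewrite ?mxE. Qed.

Lemma snocN (p : 'rV[R]_k * measurableTypeR R) :
  - snoc p = snoc (- p.1, - p.2).
Proof. by apply/rowP => i; rewrite !mxE; case: unliftP => [j _|_] /=; rewrite ?mxE. Qed.

Lemma initD (s t : 'rV[R]_k.+1) : init (s + t) = init s + init t.
Proof. by apply/rowP => i; rewrite !mxE. Qed.

Lemma initN (s : 'rV[R]_k.+1) : init (- s) = - init s.
Proof. by apply/rowP => i; rewrite !mxE. Qed.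

End snoc_lemmas.

Section lf_hat.
Local Open Scope ereal_scope.
Context (R : realType) (k : nat).
Local Notation M := (lf_measure R k).
Local Notation L := (@lebesgue_measure R).

Lemma integral_hat (mu : M) (f : 'rV[R]_k.+1 -> \bar R) :
  measurable_fun setT f -> (forall x, 0 <= f x) ->
  \int[hat mu]_v f v = \int[mu]_v \int[L]_r f (snoc (v, r)).
Proof.
move=> mf f0.
have mfs : measurable_fun setT (fun z => f (snoc z)).
  exact: (measurableT_comp mf (@measurable_snoc R k)).
pose m := sigma_finite_of (sigma_finite_lf mu).
have -> : \int[hat mu]_v f v = \int[pushforward (m \x L) (@snoc R k)]_v f v by [].
rewrite integral_pushT//; last exact: measurable_snoc.
by rewrite fubini_tonelli1.
Qed.

Lemma integral_hat' (mu : M) (f : 'rV[R]_k.+1 -> \bar R) :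
  measurable_fun setT f -> (forall x, 0 <= f x) ->
  \int[hat mu]_v f v = \int[L]_r \int[mu]_v f (snoc (v, r)).
Proof.
move=> mf f0; rewrite integral_hat//.
apply: (tonelli (f := fun z => f (snoc z))) => //.
- exact: (measurableT_comp mf (@measurable_snoc R k)).
- exact: sigma_finite_lf.
- exact: sigma_finite_lebesgue.
Qed.

Lemma hat_equiv (mu nu : M) : lf_equiv mu nu -> lf_equiv (hat mu) (hat nu).
Proof. by move=> h B mB; apply: eq_integral_measure. Qed.

Lemma hatE (mu : M) B : measurable B ->
  hat mu B = \int[mu]_v L ((fun r => snoc (v, r)) @^-1` B).
Proof.
move=> mB; apply: eq_integral => v _ /=; congr (L _).
by apply/seteqP; split=> r; rewrite /xsection /= inE.
Qed.

Lemma measurable_snoc_r (v : 'rV[R]_k) :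
  measurable_fun setT (fun r : measurableTypeR R => snoc (v, r)).
Proof. exact: (measurable_fun_pair2 v (@measurable_snoc R k)). Qed.

Lemma measurable_snoc_section (B : set 'rV[R]_k.+1) : measurable B ->
  measurable_fun setT (fun v : 'rV[R]_k => L ((fun r => snoc (v, r)) @^-1` B)).
Proof.
move=> mB; have := @measurable_fun_xsection _ _ _ _ _ L _
  (preimage_measurable (@measurable_snoc R k) mB).
congr (measurable_fun _ _); apply/funext => v /=; congr (L _).
by apply/seteqP; split=> r; rewrite /xsection /= inE.
Qed.

(** The last coordinate of [t] disappears because [lambda_1] is translation invariant. *)
Lemma shift_hat t (mu : M) :
  lf_equiv (shift t (hat mu)) (hat (shift (init t) mu)).
Proof.
move=> B mB; rewrite shiftE !hatE//; last first.
  exact: (preimage_measurable (measurable_subr_rV t)).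
rewrite integral_shift//; last exact: measurable_snoc_section.
apply: eq_integral => v _.
rewrite -[RHS](lebesgue_measureD (- t ord0 ord_max)%R); last first.
  exact: (preimage_measurable (measurable_snoc_r _)).
congr (L _); apply/seteqP; split=> r /=.
  by rewrite -{1}[t]snocE snocN snocD.
by rewrite -{3}[t]snocE snocN snocD.
Qed.

Lemma measurable_hat d (T : measurableType d) (g : T -> M) :
  measurable_fun setT g -> measurable_fun setT (fun x => hat (g x)).
Proof.
move=> mg; apply: measurable_lfP => B mB; under eq_fun do rewrite hatE//.
apply: (measurable_lf_integral mg (g := fun z => L ((fun r => snoc (z.2, r)) @^-1` B))).
  by [].
exact: (measurableT_comp (measurable_snoc_section mB) measurable_snd).
Qed.

End lf_hat.

Section hat_sets.
Local Open Scope ereal_scope.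
Context (R : realType) (k : nat).
Local Notation M := (lf_measure R k).
Local Notation L := (@lebesgue_measure R).

Lemma measurable_indicE d (T : measurableType d) (A : set T) : measurable A ->
  measurable_fun setT (fun x => (\1_A x)%:E : \bar R).
Proof. by move=> mA; exact/measurable_EFinP/measurable_indic. Qed.

Lemma integral_indicT d (T : measurableType d) (mu : {measure set T -> \bar R})
    (A : set T) : measurable A -> \int[mu]_x (\1_A x)%:E = mu A.
Proof. by move=> mA; rewrite integral_indic// setIT. Qed.

Lemma hatE_swap (mu : M) B : measurable B ->
  hat mu B = \int[L]_r mu ((fun v => snoc (v, r)) @^-1` B).
Proof.
move=> mB; rewrite -(integral_indicT (lf_val (hat mu)) mB).
rewrite integral_hat'//; last exact: measurable_indicE.
apply: eq_integral => r _; rewrite -integral_indicT//.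
exact: preimage_measurable (measurable_fun_pair1 r (@measurable_snoc R k)) mB.
Qed.

Lemma hat_setX (mu : M) (A : set 'rV[R]_k) (J : set (measurableTypeR R)) :
  measurable A -> measurable J ->
  hat mu [set x | A (init x) /\ J (x ord0 ord_max)] = mu A * L J.
Proof.
move=> mA mJ; have -> : hat mu [set x | A (init x) /\ J (x ord0 ord_max)] =
    (mu \x L) (A `*` J).
  rewrite /= /prod_lebesgue /pushforward; congr ((_ \x _) _).
  by apply/seteqP; split=> -[x r] /=; rewrite init_snoc snoc_max.
by rewrite product_measure1E.
Qed.

Lemma measurable_setX_snoc (A : set 'rV[R]_k) (J : set (measurableTypeR R)) :
  measurable A -> measurable J ->
  measurable [set x : 'rV[R]_k.+1 | A (init x) /\ J (x ord0 ord_max)].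
Proof.
move=> mA mJ; apply: measurableI.
  exact: preimage_measurable (@measurable_init R k) mA.
exact: preimage_measurable (@measurable_coord R k.+1 ord_max) mJ.
Qed.

End hat_sets.

Section unhat.
Local Open Scope ereal_scope.
Context (R : realType) (k : nat).
Local Notation L := (@lebesgue_measure R).

(** The interval [0, 1] has length one: restricting [hat mu] to this slab and forgetting the last
    coordinate gives back [mu]. Thus [mu] is a measurable function of [hat mu], which is all that
    independence and preserving shifts refer to. *)
Definition unit_slab : set 'rV[R]_k.+1 := [set x | x ord0 ord_max \in `[0%R, 1%R]].

Lemma measurable_unit_slab : measurable unit_slab.
Proof.
apply: (@preimage_measurable _ _ _ (measurableTypeR R)
  (fun x : 'rV[R]_k.+1 => x ord0 ord_max) [set` `[0%R, 1%R]]) => //.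
exact: measurable_coord.
Qed.

Lemma le_coord_norm m (x : 'rV[R]_m) i : (`|x ord0 i| <= `|x|)%R.
Proof.
have := lexx `|x|%R; rewrite {1}[`|x|%R]mx_normrE => /bigmax_leP[_].
by move=> /(_ (ord0, i)); exact.
Qed.

Lemma rV_norm_le m (x : 'rV[R]_m) (b : R) : (0 <= b)%R ->
  (forall i, `|x ord0 i| <= b)%R -> (`|x| <= b)%R.
Proof.
move=> b0 xb; rewrite [leLHS]mx_normrE; apply/bigmax_leP; split => // -[j i] _ /=.
by rewrite ord1.
Qed.

Section val.
Variable eta : lf_measure R k.+1.

Definition unhat_val : set 'rV[R]_k -> \bar R :=
  pushforward (mrestr eta measurable_unit_slab) (@init R k).

HB.instance Definition _ := Measure.copy unhat_val
  (image_measure (mrestr eta measurable_unit_slab) (@measurable_init R k)).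

Lemma unhat_lf (B : set 'rV[R]_k) :
  measurable B -> bounded_set B -> unhat_val B < +oo.
Proof.
move=> mB /bounded_rVP[b Bb]; apply: lf_fin.
  apply: measurableI; last exact: measurable_unit_slab.
  exact: preimage_measurable (@measurable_init R k) mB.
apply/bounded_rVP; exists (Num.max `|b| 1)%R => x [/Bb xb].
rewrite /unit_slab /= in_itv /= => /andP[x0 x1].
apply: rV_norm_le => [|i]; first by rewrite le_max normr_ge0.
rewrite le_max; case: (unliftP ord_max i) => [j ->|->].
  rewrite (le_trans _ (ler_norm b))// (le_trans _ xb)//.
  by have := le_coord_norm (init x) j; rewrite mxE.
by rewrite ger0_norm// x1 orbT.
Qed.

Definition unhat : lf_measure R k := LfMeasure unhat_lf.

End val.

Lemma unhatE eta B : unhat eta B = eta (@init R k @^-1` B `&` unit_slab).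
Proof. by []. Qed.

Lemma unhat_hat (mu : lf_measure R k) : lf_equiv (unhat (hat mu)) mu.
Proof.
move=> B mB; rewrite unhatE (hat_setX mu mB (measurable_itv `[0%R, 1%R])).
by rewrite lebesgue_measure_itv /= lte_fin ltr01 sube0 mule1.
Qed.

Lemma unhat_equiv (eta zeta : lf_measure R k.+1) :
  lf_equiv eta zeta -> lf_equiv (unhat eta) (unhat zeta).
Proof.
move=> h B mB; rewrite !unhatE h//; apply: measurableI.
  exact: preimage_measurable (@measurable_init R k) mB.
exact: measurable_unit_slab.
Qed.

Lemma measurable_unhat d (T : measurableType d) (g : T -> lf_measure R k.+1) :
  measurable_fun setT g -> measurable_fun setT (fun x => unhat (g x)).
Proof.
move=> mg; apply: measurable_lfP => B mB; under eq_fun do rewrite unhatE.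
apply: (measurableT_comp (measurable_lf_eval _) mg); apply: measurableI.
  exact: preimage_measurable (@measurable_init R k) mB.
exact: measurable_unit_slab.
Qed.

End unhat.

Section lebesgue_space.
Local Open Scope ereal_scope.
Context (R : realType).
Local Notation L := (@lebesgue_measure R).

Lemma lebesgue_rV_lf k (B : set 'rV[R]_k) :
  measurable B -> bounded_set B -> lebesgue_rV R k B < +oo.
Proof.
elim: k B => [|k IH] B mB bB; last exact: (@prod_lebesgue_lf _ _ (LfMeasure IH)).
by rewrite /= diracE ltry.
Qed.

Definition leb k : lf_measure R k := LfMeasure (@lebesgue_rV_lf k).

Lemma lebE k B : leb k B = lebesgue_rV R k B. Proof. by []. Qed.

Lemma leb_hat k B : leb k.+1 B = hat (leb k) B. Proof. by []. Qed.

Lemma leb_shift k t : lf_equiv (shift t (leb k)) (leb k).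
Proof.
elim: k t => [|k IH] t.
  by move=> B mB; rewrite shiftE; congr (leb 0 _); apply/seteqP; split=> x /=;
    rewrite [x]thinmx0 [t]thinmx0 subr0.
apply: lf_equiv_trans (hat_equiv (IH (init t))).
exact: (shift_hat t (leb k)).
Qed.

Lemma integral_lebD k t (f : 'rV[R]_k -> \bar R) :
  measurable_fun setT f -> (forall x, 0 <= f x) ->
  \int[leb k]_v f (v + t)%R = \int[leb k]_v f v.
Proof.
move=> mf f0; have := integral_shift (- t)%R (leb k) mf f0.
rewrite opprK => <-; apply: eq_integral_measure; exact: leb_shift.
Qed.

(** By slicing: the sections are hyperplanes of one dimension less or, for the last coordinate,
    single points of the line. *)
Lemma leb_hyperplane k (i : 'I_k) a : leb k [set x | x ord0 i = a] = 0.
Proof.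
elim: k i => [[] //|k IH] i.
have mH m (j : 'I_m) : measurable [set x : 'rV[R]_m | x ord0 j = a].
  exact: preimage_measurable (measurable_coord j) (measurable_set1 a).
rewrite leb_hat; case: (unliftP ord_max i) => [j|] ->.
  rewrite hatE_swap; last exact: mH.
  rewrite integral0_eq// => r _; rewrite -[RHS](IH j).
  by congr (leb k _); apply/seteqP; split=> v /=; rewrite mxE liftK.
rewrite hatE; last exact: mH.
rewrite integral0_eq// => v _; rewrite -[RHS](lebesgue_measure_set1 a).
by congr (L _); apply/seteqP; split=> r /=; rewrite snoc_max.
Qed.

End lebesgue_space.

(** * Cells and Jordan measurable sets *)

Section cells.
Local Open Scope ereal_scope.
Context (R : realType).

(** Half-open, so that its translates by [2 * a] times the integer vectors tile the space. *)
Definition cell k (a : R) : set 'rV[R]_k :=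
  [set x | forall i, (- a <= x ord0 i < a)%R].

Lemma cellS k (a : R) (x : 'rV[R]_k.+1) :
  cell a x <-> cell a (init x) /\ [set` `[(- a)%R, a[] (x ord0 ord_max).
Proof.
split=> [ax|[ax xa] i]; first by split=> [i|] /=; rewrite ?mxE ?in_itv /=; apply: ax.
by case: (unliftP ord_max i) => [j ->|->] //; have := ax j; rewrite mxE.
Qed.

Lemma measurable_cell k (a : R) : measurable (@cell k a).
Proof.
elim: k => [|k IH].
  by rewrite (_ : cell a = setT)//; apply/seteqP; split=> // x _ [].
have := measurable_setX_snoc IH (measurable_itv `[(- a)%R, a[).
by congr measurable; apply/seteqP; split=> x /cellS.
Qed.

Lemma leb_cell k (a : R) : (0 < a)%R -> leb R k (cell a) = ((2 * a) ^+ k)%:E.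
Proof.
move=> a0; elim: k => [|k IH].
  rewrite (_ : cell a = setT); first by rewrite lebE /= diracE in_setT.
  by apply/seteqP; split=> // x _ [].
rewrite leb_hat (_ : cell a = [set x | @cell k a (init x) /\
    [set` `[(- a)%R, a[] (x ord0 ord_max)]); last first.
  by apply/seteqP; split=> x /cellS.
rewrite hat_setX//; last exact: measurable_cell.
rewrite IH lebesgue_measure_itv /= lte_fin gtrN// -EFinB -EFinM opprK.
by rewrite exprSr mulr_natl mulr2n.
Qed.

End cells.

Section jordan.
Local Open Scope ereal_scope.
Context (R : realType) (k : nat).
Implicit Types A B : set 'rV[R]_k.

Definition jordan A := measurable A /\ lebesgue_rV R k (boundary A) = 0.

Lemma measurable_boundary A : measurable (boundary A).
Proof.
rewrite /boundary; apply: measurableD.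
  rewrite -[closure A]setCK; apply: measurableC; apply: open_measurable_rV.
  by apply: closed_openC; exact: closed_closure.
by apply: open_measurable_rV; exact: open_interior.
Qed.

Lemma leb_subset0 A B : measurable A -> measurable B -> A `<=` B ->
  leb R k B = 0 -> leb R k A = 0.
Proof.
move=> mA mB AB B0; apply/eqP; rewrite eq_le measure_ge0 andbT -B0.
by apply: le_measure; rewrite ?inE.
Qed.

Lemma jordanI A B : jordan A -> jordan B -> jordan (A `&` B).
Proof.
move=> [mA A0] [mB B0]; split; first exact: measurableI.
apply: (@leb_subset0 _ (boundary A `|` boundary B)).
- exact: measurable_boundary.
- by apply: measurableU; exact: measurable_boundary.
- move=> x [/closureI[cA cB]]; rewrite interiorI => /not_andP[nA|nB].
    by left.
  by right.
- by rewrite measureU0//; exact: measurable_boundary.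
Qed.

Lemma jordanC A : jordan A -> jordan (~` A).
Proof.
move=> [mA A0]; split; first exact: measurableC.
rewrite -[RHS]A0; congr (lebesgue_rV R k _).
by rewrite /boundary interiorC !setDE setCK -[closure (~` A)]setCK -interiorC setCK setIC.
Qed.

Lemma jordanT : jordan setT.
Proof.
split=> //; rewrite /boundary closureT interiorT setDv.
exact: (measure0 (lebesgue_rV R k)).
Qed.

(** The boundary of the open set where [f] is below [a] lies in the level set of [a]. *)
Lemma jordan_lt (f : 'rV[R]_k -> R) (a : R) : continuous f ->
  leb R k [set x | f x = a] = 0 -> jordan [set x | (f x < a)%R].
Proof.
move=> cf fa0.
have o1 : open [set x | (f x < a)%R].
  by move/continuousP : cf => /(_ [set y | (y < a)%R] (open_lt (y:=a))).
have mf : measurable [set x | f x = a].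
  rewrite (_ : [set x | f x = a] = ~` ([set x | (f x < a)%R] `|` [set x | (a < f x)%R])).
    apply: measurableC; apply: open_measurable_rV; apply: openU => //.
    by move/continuousP : cf => /(_ [set y | (a < y)%R] (open_gt (y:=a))).
  apply/seteqP; split=> x /=; first by move=> ->; rewrite ltxx; case.
  by move=> /not_orP[/negP + /negP]; rewrite -!leNgt => h1 h2; apply/le_anti/andP.
split; first exact: open_measurable_rV.
apply: (leb_subset0 (measurable_boundary _) mf _ fa0) => x [cx].
rewrite (interior_id _).1// => /negP; rewrite -leNgt => ax.
apply/le_anti; rewrite ax andbT.
have : closed [set x | (f x <= a)%R].
  by move/continuous_closedP : cf => /(_ [set y | (y <= a)%R] (closed_le (y:=a))).
move=> /closure_id clE.
suff : [set x | (f x <= a)%R] x by [].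
rewrite clE.
by move: x cx {ax}; apply: closure_subset => y /ltW.
Qed.

Lemma jordan_halfspace i a : jordan [set x : 'rV[R]_k | (x ord0 i < a)%R].
Proof.
apply: jordan_lt; last exact: leb_hyperplane.
exact: coord_continuous.
Qed.

(** An intersection of halfspaces. The positive radius makes this reading correct in dimension zero
    too, where the empty intersection is the whole space. *)
Lemma jordan_cube n : jordan (@cube R k n.+1).
Proof.
pose F (i : 'I_k) : set 'rV[R]_k :=
  [set x | x ord0 i < n.+1%:R]%R `&` [set x | - x ord0 i < n.+1%:R]%R.
rewrite (_ : @cube R k n.+1 = \big[setI/[set: 'rV[R]_k]]_(i < k) F i); last first.
  rewrite -bigcap_seq; apply/seteqP; split=> x /= h.
    move=> i _ /=; have := le_lt_trans (le_coord_norm x i) h.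
    by rewrite ltr_norml ltrNl => /andP[].
  rewrite /cube /= [X in (X < _)%R]mx_normrE; apply: bigmax_lt => // -[j i] _ /=.
  rewrite ord1 ltr_norml ltrNl; have := h i; rewrite /= mem_index_enum.
  by move=> /(_ isT)[-> ->].
apply: (big_ind jordan) => [|A B|i _]; [exact: jordanT|exact: jordanI|].
apply: jordanI; first exact: (jordan_halfspace i n.+1%:R).
apply: (@jordan_lt (fun x => - x ord0 i)%R).
  move=> x; apply: (@continuousN _ R^o).  exact: (@coord_continuous R 1 k ord0 i x).
rewrite (_ : [set x | _] = [set x : 'rV[R]_k | x ord0 i = - n.+1%:R]%R).
  exact: leb_hyperplane.
by apply/seteqP; split=> x /=; [move=> <-; rewrite opprK|move=> ->; rewrite opprK].
Qed.

End jordan.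

(** * Measurability of composite maps *)

Section measurability_tactic.
Local Open Scope ereal_scope.
Context (R : realType) d (T : measurableType d).

Lemma mfun_fst d1 d2 (T1 : measurableType d1) (T2 : measurableType d2)
    (g : T -> T1 * T2) :
  measurable_fun setT g -> measurable_fun setT (fun x => (g x).1).
Proof. exact: (measurableT_comp measurable_fst). Qed.

Lemma mfun_snd d1 d2 (T1 : measurableType d1) (T2 : measurableType d2)
    (g : T -> T1 * T2) :
  measurable_fun setT g -> measurable_fun setT (fun x => (g x).2).
Proof. exact: (measurableT_comp measurable_snd). Qed.

Lemma mfun_indic d1 (T1 : measurableType d1) (A : set T1) (g : T -> T1) :
  measurable A -> measurable_fun setT g ->
  measurable_fun setT (fun x => (\1_A (g x))%:E : \bar R).
Proof. by move=> mA mg; exact: (measurableT_comp (measurable_indicE mA) mg). Qed.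

Lemma mfun_mule (f g : T -> \bar R) :
  measurable_fun setT f -> measurable_fun setT g ->
  measurable_fun setT (fun x => f x * g x).
Proof. exact: emeasurable_funM. Qed.

Lemma mfun_snoc k (f : T -> 'rV[R]_k) (g : T -> measurableTypeR R) :
  measurable_fun setT f -> measurable_fun setT g ->
  measurable_fun setT (fun x => snoc (f x, g x)).
Proof.
by move=> mf mg; apply: (measurableT_comp (@measurable_snoc R k));
  exact: measurable_fun_pair.
Qed.

Lemma mfun_init k (f : T -> 'rV[R]_k.+1) :
  measurable_fun setT f -> measurable_fun setT (fun x => init (f x)).
Proof. exact: (measurableT_comp (@measurable_init R k)). Qed.

Lemma mfun_coord k (f : T -> 'rV[R]_k) i :
  measurable_fun setT f ->
  measurable_fun setT (fun x => f x ord0 i : measurableTypeR R).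
Proof. exact: (measurableT_comp (measurable_coord i)). Qed.

Lemma mfun_act k dF (F : measurableType dF) (th : action R k F)
    (f : T -> 'rV[R]_k) (g : T -> F) :
  measurable_fun setT f -> measurable_fun setT g ->
  measurable_fun setT (fun x => th (f x) (g x)).
Proof.
move=> mf mg.
exact: (measurableT_comp (measurable_act th) (measurable_fun_pair mf mg)).
Qed.

Section tshift.
Context k dE (E : measurableType dE) (th : action R k E).

Definition tshift (v : 'rV[R]_k) (z : E * lf_measure R k) : E * lf_measure R k :=
  (th v z.1, shift v z.2).

Lemma mfun_tshift (f : T -> 'rV[R]_k) (g : T -> E * lf_measure R k) :
  measurable_fun setT f -> measurable_fun setT g ->
  measurable_fun setT (fun x => tshift (f x) (g x)).
Proof.
move=> mf mg; apply: measurable_fun_pair.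
  by apply: mfun_act => //; exact: mfun_fst.
by apply: measurable_shift => //; exact: mfun_snd.
Qed.

End tshift.

End measurability_tactic.

(** Joint measurability by recursion on the body of the map; integrals and inverse masses are left
    to their own lemmas. *)
Ltac mfun := repeat first
  [ assumption
  | exact: measurable_id
  | exact: measurable_cst
  | exact: measurable_fst
  | exact: measurable_snd
  | match goal with
    | |- measurable_fun setT (fun x => (_, _)) => apply: measurable_fun_pair
    | |- measurable_fun setT (fun x => fst _) => apply: mfun_fst
    | |- measurable_fun setT (fun x => snd _) => apply: mfun_snd
    | |- measurable_fun setT (fun x => (indic _ _)%:E) => apply: mfun_indic
    | |- measurable_fun setT (fun x => (_ * _)%E) => apply: mfun_mule
    | |- measurable_fun setT (fun x => (_ - _)%R) => apply: measurable_subr2_rV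
    | |- measurable_fun setT (fun x => (_ + _)%R) => apply: measurable_addr_rV
    | |- measurable_fun setT (fun x => (- _)%R) => apply: measurable_oppr_rV
    | |- measurable_fun setT (@Algebra.opp _) =>
        apply: (measurable_oppr_rV (@measurable_id _ _ _))
    | |- measurable_fun setT (@init _ _) => apply: measurable_init
    | |- measurable_fun setT (fun x => shift _ _) => apply: measurable_shift
    | |- measurable_fun setT (fun x => hat _) => apply: measurable_hat
    | |- measurable_fun setT (fun x => unhat _) => apply: measurable_unhat
    | |- measurable_fun setT (fun x => snoc _) => apply: mfun_snoc
    | |- measurable_fun setT (fun x => init _) => apply: mfun_init
    | |- measurable_fun setT (fun x => (_ : 'rV__) _ _) => apply: mfun_coord
    | |- measurable_fun setT (fun x => tshift _ _ _) => apply: mfun_tshift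
    | |- measurable_fun setT (fun x => act _ _ _) => apply: mfun_act
    | H : measurable_fun setT ?f |- measurable_fun setT (fun x => ?f _) =>
        apply: (measurableT_comp H)
    end ].

(** * Recentred windows and their masses *)

Section lf_integrals.
Local Open Scope ereal_scope.
Context (R : realType) (k : nat).
Local Notation V := 'rV[R]_k.
Local Notation M := (lf_measure R k).

Lemma indic_ge0 T (A : set T) x : 0 <= (\1_A x)%:E :> \bar R.
Proof. by rewrite lee_fin. Qed.

(* [C - u], so that [inv_mass mu (recentre C u)] normalizes [mu] on [C - u];
   it is [0] when [C - u] has mass [0]. *)
Definition recentre (C : set V) (u : V) : set V := (fun v => (v + u)%R) @^-1` C.

Definition inv_mass (mu : M) (B : set V) : \bar R := ((fine (mu B))^-1)%:E.

Lemma inv_mass_ge0 (mu : M) B : 0 <= inv_mass mu B.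
Proof. by rewrite lee_fin invr_ge0 fine_ge0. Qed.

Lemma recentreE (mu : M) C u : mu (recentre C u) = shift (- u) mu C.
Proof. by rewrite shiftE /recentre opprK. Qed.

Lemma measurable_recentre (C : set V) u : measurable C -> measurable (recentre C u).
Proof.
move=> mC; apply: preimage_measurable mC.
by apply: measurable_addr_rV.
Qed.

Lemma recentre_fin (mu : M) (C : set V) u : measurable C -> bounded_set C ->
  mu (recentre C u) \is a fin_num.
Proof.
by move=> mC bC; rewrite recentreE ge0_fin_numE//; exact: lf_fin.
Qed.

Section param.
Context d (T : measurableType d) (f : T -> M) (g : T -> V) (C : set V).
Hypotheses (mf : measurable_fun setT f) (mg : measurable_fun setT g).
Hypothesis mC : measurable C.

Lemma measurable_recentre_mass :
  measurable_fun setT (fun x => f x (recentre C (g x))).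
Proof.
under eq_fun do rewrite recentreE.
by apply: (measurableT_comp (measurable_lf_eval mC)); mfun.
Qed.

Lemma measurable_inv_mass :
  measurable_fun setT (fun x => inv_mass (f x) (recentre C (g x))).
Proof.
apply/measurable_EFinP.
(* The inverse is read as the power with exponent -1, with which it agrees at 0 as well. *)
rewrite (_ : (fun x => _) = fun x => (fine (f x (recentre C (g x))) `^ (-1)))%R; last first.
  by apply/funext => x; rewrite powR_inv1// fine_ge0.
apply: (measurableT_comp (measurable_powR _)).
exact: (measurableT_comp (fine_measurable measurableT) measurable_recentre_mass).
Qed.

End param.

Lemma ge0_integral_null d (T : measurableType d) (mu : {measure set T -> \bar R})
    (N : set T) (h : T -> \bar R) :
  measurable N -> mu N = 0 -> measurable_fun setT h -> (forall x, 0 <= h x) ->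
  (forall x, ~ N x -> h x = 0) -> \int[mu]_x h x = 0.
Proof.
move=> mN N0 mh h0 hN; rewrite (ge0_negligible_integral mN)// integral0_eq//.
by move=> x [_ /hN].
Qed.

End lf_integrals.

(** * From mass-stationarity to the Mecke identity *)

Lemma adde_cancelr (R : realDomainType) (a b c d : \bar R) :
  c = d -> d \is a fin_num -> (a + c = b + d)%E -> a = b.
Proof.
move=> -> dfin abd; rewrite -[a](@addeK _ d)// -[b](@addeK _ d)//.
by congr (_ - _)%E.
Qed.

Section mecke.
Local Open Scope ereal_scope.
Context (R : realType) (k : nat) dE (E : measurableType dE).
Variable th : action R k E.
Local Notation tshift := (tshift th).
Local Notation V := 'rV[R]_k.
Local Notation M := (lf_measure R k).

(** Moving the origin from [u] to [v + u] moves the measure and the window together, so the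
    normalizing mass is the same at both ends of the move. This is why it can be cancelled. *)
Lemma tshift_recentre (v u : V) (z : E * M) (C : set V) :
  (tshift v z).2 (recentre C (v + u)) = z.2 (recentre C u).
Proof.
rewrite /tshift /= shiftE; congr (z.2 _).
by apply/seteqP; split=> x; rewrite /recentre /= addrA subrK.
Qed.

(** If the recentred window has mass 0, both sides vanish: the inner integral on the right lives on
    that window. The value 0 of [inv_mass] there is therefore the right one. *)
Lemma mass_cancel (G : set V) (u : V) (z : E * M) (h : E * M * V -> \bar R) :
  measurable G -> bounded_set G -> measurable_fun setT h -> (forall y, 0 <= h y) ->
  inv_mass z.2 (recentre G u) * \int[z.2]_v ((\1_G (v + u)%R)%:E *
    (h (tshift v z, (v + u)%R) * (tshift v z).2 (recentre G (v + u)))) =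
  \int[z.2]_v ((\1_G (v + u)%R)%:E * h (tshift v z, (v + u)%R)).
Proof.
move=> mG bG mh h0.
have mi : measurable_fun setT
    (fun v : V => (\1_G (v + u)%R)%:E * h (tshift v z, (v + u)%R)).
  by mfun.
have i0 (v : V) : 0 <= (\1_G (v + u)%R)%:E * h (tshift v z, (v + u)%R).
  by rewrite mule_ge0.
under eq_integral do rewrite tshift_recentre muleA.
rewrite ge0_integralZr// /inv_mass.
have cfin := recentre_fin z.2 u mG bG.
have [c0|c0] := eqVneq (z.2 (recentre G u)) 0.
  rewrite c0 mule0 mule0; apply/esym.
  apply: (ge0_integral_null (measurable_recentre u mG) c0 mi i0) => v Gv.
  by rewrite indicE memNset// mul0e.
rewrite [X in _ * X]muleC muleA -[X in _ * X * _]fineK// -EFinM.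
rewrite mulVf ?mul1e//.
by apply: contra c0 => /eqP c0; rewrite -(fineK cfin) c0.
Qed.

Context dO (Omega : measurableType dO).
Variable P : {measure set Omega -> \bar R}.
Variables (X : Omega -> E) (xi : Omega -> M).
Hypotheses (mX : measurable_fun setT X) (mxi : measurable_fun setT xi).

(** Mass-stationarity on the window [C] with [U] and [V] integrated out; the factor [1 / lambda (C)]
    of the law of [U], common to both sides, is dropped. *)
Definition ms_identity (C : set V) (f : E * M * V -> \bar R) :=
  \int[P]_w \int[leb R k]_u ((\1_C u)%:E * (inv_mass (xi w) (recentre C u) *
    \int[xi w]_v ((\1_C (v + u)%R)%:E * f (tshift v (X w, xi w), (v + u)%R)))) =
  \int[P]_w \int[leb R k]_u ((\1_C u)%:E * f (X w, xi w, u)).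

Definition ms := forall C : set V, measurable C -> bounded_set C ->
  0 < lebesgue_rV R k C -> lebesgue_rV R k (boundary C) = 0 ->
  forall f, measurable_fun setT f -> (forall y, 0 <= f y) -> ms_identity C f.

Definition mecke := forall g : E * M * V -> \bar R,
  measurable_fun setT g -> (forall y, 0 <= g y) ->
  \int[P]_w \int[xi w]_v g (tshift v (X w, xi w), (- v)%R) =
  \int[P]_w \int[xi w]_v g (X w, xi w, v).

Lemma measurable_integral_lf2 d (T : measurableType d) (zeta : T -> M)
    (mu : {measure set V -> \bar R}) (f : T * (V * V) -> \bar R) :
  measurable_fun setT zeta -> sigma_finite setT mu ->
  measurable_fun setT f -> (forall y, 0 <= f y) ->
  measurable_fun setT (fun x => \int[mu]_u \int[zeta x]_v f (x, (u, v))).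
Proof.
move=> mzeta smu mf f0.
have mz1 : measurable_fun setT (fun y : T * V => zeta y.1) by mfun.
have mf1 : measurable_fun setT (fun y : (T * V) * V => f (y.1.1, (y.1.2, y.2))) by mfun.
have mI := measurable_lf_integral mz1 (fun=> f0 _) mf1.
by apply: (measurable_integral_snd mI _ smu) => y; apply: integral_ge0.
Qed.

Section joint_measures.
Let Z w := (X w, xi w).

Let mZ : measurable_fun setT Z. Proof. exact: measurable_fun_pair. Qed.

Let kap (w : Omega) : {measure set (V * V) -> \bar R} :=
  (leb R k \x sigma_finite_of (sigma_finite_lf (xi w))).

Let mkap : xsection_measurable kap.
Proof.
move=> S mS.
pose S' : set ((Omega * V) * V) := (fun x => (x.1.1, (x.1.2, x.2))) @^-1` S.
have mS' : measurable S' by apply: preimage_measurable mS; mfun.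
have mxi1 : measurable_fun setT (fun x : Omega * V => xi x.1) by mfun.
have := measurable_integral_snd (measurable_lf_xsection mxi1 mS') (fun=> measure_ge0 _ _)
  (sigma_finite_lf (leb R k)).
congr (measurable_fun _ _); apply/funext => w.
apply: eq_integral => u _ /=; congr (xi w _).
apply/seteqP; split=> v /set_mem h; apply/mem_set; first exact/mem_set.
exact: (set_mem h).
Qed.

Let N := semidirect P mkap.

Let integral_N (f : Omega * (V * V) -> \bar R) :
  measurable_fun setT f -> (forall z, 0 <= f z) ->
  \int[N]_z f z = \int[P]_w \int[leb R k]_u \int[xi w]_v f (w, (u, v)).
Proof.
move=> mf f0; rewrite integral_semidirect//; apply: eq_integral => w _.
have mfw := measurable_fun_pair2 w mf.
exact: (@fubini_tonelli1 _ _ _ _ _ (sigma_finite_of (sigma_finite_lf (leb R k)))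
  (sigma_finite_of (sigma_finite_lf (xi w))) (fun z => f (w, z)) mfw (fun=> f0 _)).
Qed.

(** The measure [P (dw) du xi_w (dv)], known from here on only through its integrals. *)
Lemma joint_measure : exists N' : {measure set (Omega * (V * V)) -> \bar R},
  forall f, measurable_fun setT f -> (forall z, 0 <= f z) -> \int[N']_z f z =
    \int[P]_w \int[leb R k]_u \int[xi w]_v f (w, (u, v)).
Proof. by exists N => f mf f0; exact: integral_N. Qed.

Let phi1 (x : Omega * (V * V)) : E * M * (V * V) :=
  (tshift x.2.2 (Z x.1), ((x.2.2 + x.2.1)%R, x.2.1)).
Let phi2 (x : Omega * (V * V)) : E * M * (V * V) :=
  (Z x.1, (x.2.1, (x.2.2 + x.2.1)%R)).

Let mphi1 : measurable_fun setT phi1.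
Proof. by rewrite /phi1; mfun. Qed.

Let mphi2 : measurable_fun setT phi2.
Proof. by rewrite /phi2; mfun. Qed.

Let integral_pushN (phi : Omega * (V * V) -> E * M * (V * V)) :
  measurable_fun setT phi -> exists N' : {measure set (E * M * (V * V)) -> \bar R},
  forall f, measurable_fun setT f -> (forall z, 0 <= f z) -> \int[N']_z f z =
    \int[P]_w \int[leb R k]_u \int[xi w]_v f (phi (w, (u, v))).
Proof.
move=> mphi.
exists (image_measure N mphi).
move=> f mf f0; rewrite [LHS](integral_pushT N mphi)// integral_N//.
exact: (measurableT_comp mf mphi).
Qed.

(** Both measures describe a pair of positions [u] and [v + u]. Under [N2] the configuration is seen
    from [u], under [N1] from [v + u], and the point of view always comes first. The Mecke identity
    says that the two ends may be exchanged, that is, [N1 = N2]. *)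
Lemma mecke_measures : exists N1 N2 : {measure set (E * M * (V * V)) -> \bar R},
  forall f, measurable_fun setT f -> (forall z, 0 <= f z) ->
    \int[N1]_z f z = \int[P]_w \int[leb R k]_u \int[xi w]_v
      f (tshift v (X w, xi w), ((v + u)%R, u)) /\
    \int[N2]_z f z = \int[P]_w \int[leb R k]_u \int[xi w]_v
      f (X w, xi w, (u, (v + u)%R)).
Proof.
have [N1 IN1] := integral_pushN mphi1; have [N2 IN2] := integral_pushN mphi2.
by exists N1, N2 => f mf f0; split; [exact: IN1|exact: IN2].
Qed.

End joint_measures.

Section equality.
Variables N1 N2 : {measure set (E * M * (V * V)) -> \bar R}.
Hypothesis IN1 : forall f, measurable_fun setT f -> (forall z, 0 <= f z) ->
  \int[N1]_z f z = \int[P]_w \int[leb R k]_u \int[xi w]_v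
    f (tshift v (X w, xi w), ((v + u)%R, u)).
Hypothesis IN2 : forall f, measurable_fun setT f -> (forall z, 0 <= f z) ->
  \int[N2]_z f z = \int[P]_w \int[leb R k]_u \int[xi w]_v
    f (X w, xi w, (u, (v + u)%R)).
Hypothesis Hms : ms.

Let indicX (A : set (E * M)) (B C : set V) x y z :
  (\1_(A `*` (B `*` C)) (x, (y, z)))%:E =
  (\1_A x)%:E * ((\1_B y)%:E * (\1_C z)%:E) :> \bar R.
Proof. by rewrite !indicE !in_setX /=; do 3 case: (_ \in _); rewrite /= ?(mule0, mul0e, mule1). Qed.

Let indic_sub (B C : set V) y : B `<=` C ->
  (\1_C y)%:E * (\1_B y)%:E = (\1_B y)%:E :> \bar R.
Proof.
move=> BC; rewrite !indicE -EFinM; case: (boolP (y \in B)) => [yB|_].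
  by rewrite (mem_set (BC _ (set_mem yB))) mulr1.
by rewrite mulr0.
Qed.

(** The identity on the window [G] for the indicator of [A] and [G'], weighted by the mass of
    [G - u]. On the left the weight cancels the normalization; on the right it is the measure of the
    third factor [G]. *)
Let star (G : set V) (A : set (E * M)) (G' : set V) :
  jordan G -> bounded_set G -> measurable A -> measurable G' -> G' `<=` G ->
  N1 (A `*` (G' `*` G)) = N2 (A `*` (G' `*` G)).
Proof.
move=> [mG G0] bG mA mG' G'G.
have mS : measurable (A `*` (G' `*` G)) by do 2 apply: measurableX => //.
rewrite -(integral_indicT N1 mS) (IN1 (measurable_indicE mS) (indic_ge0 _ _)).
rewrite -(integral_indicT N2 mS) (IN2 (measurable_indicE mS) (indic_ge0 _ _)).
pose h (y : E * M * V) : \bar R := (\1_A y.1)%:E * (\1_G' y.2)%:E.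
have mh : measurable_fun setT h by rewrite /h; mfun.
have h0 y : 0 <= h y by rewrite mule_ge0.
pose hm (y : E * M * V) : \bar R := h y * y.1.2 (recentre G y.2).
have mhm : measurable_fun setT hm.
  apply: mfun_mule => //; apply: measurable_recentre_mass => //; mfun.
have hm0 y : 0 <= hm y by rewrite mule_ge0.
have E1 w u : \int[xi w]_v (\1_(A `*` (G' `*` G)) (tshift v (X w, xi w), ((v + u)%R, u)))%:E
    = (\1_G u)%:E * \int[xi w]_v ((\1_G (v + u)%R)%:E * h (tshift v (X w, xi w), (v + u)%R)).
  have mGh : measurable_fun setT (fun v : V =>
    (\1_G (v + u)%R)%:E * h (tshift v (X w, xi w), (v + u)%R)) by mfun.
  rewrite -ge0_integralZl// => [|v _]; last by rewrite mule_ge0.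
  apply: eq_integral => v _; rewrite indicX /h /=.
  by rewrite [X in _ = _ * X]muleCA indic_sub// muleA muleC.
have E2 w u : \int[xi w]_v (\1_(A `*` (G' `*` G)) (X w, xi w, (u, (v + u)%R)))%:E
    = (\1_G u)%:E * hm (X w, xi w, u).
  under eq_integral do rewrite indicX muleA.
  have mG1 : measurable_fun setT (fun v : V => (\1_G (v + u)%R)%:E : \bar R) by mfun.
  rewrite ge0_integralZl// ?mule_ge0//.
  rewrite /hm /h /= muleA [(\1_G u)%:E * _]muleCA indic_sub//.
  congr (_ * _); rewrite -(integral_indicT (lf_val (xi w)) (measurable_recentre u mG)).
  by apply: eq_integral.
under eq_integral do under eq_integral do rewrite E1.
under [RHS]eq_integral do under eq_integral do rewrite E2.
(* Mass-stationarity speaks only of windows of positive volume; on a null window both sides are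
   0. *)
have [G_0|G_0] := eqVneq (lebesgue_rV R k G) 0.
  rewrite !integral0_eq// => w _.
    apply: (ge0_integral_null mG G_0); first by mfun.
    - by move=> u; rewrite mule_ge0.
    - by move=> u Gu; rewrite indicE memNset// mul0e.
  apply: (ge0_integral_null mG G_0).
  - apply: mfun_mule; first by mfun.
    pose H (x : V * V) := (\1_G (x.2 + x.1)%R)%:E *
      h (tshift x.2 (X w, xi w), (x.2 + x.1)%R).
    have mH : measurable_fun setT H by rewrite /H; mfun.
    have H0 x : 0 <= H x by rewrite mule_ge0.
    exact: (measurable_integral_snd mH H0 (sigma_finite_lf (xi w))).
  - move=> u; rewrite mule_ge0//; apply: integral_ge0 => v _.
    by rewrite mule_ge0.
  - by move=> u Gu; rewrite indicE memNset// mul0e.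
have := Hms mG bG _ G0 mhm hm0; rewrite lt0e G_0 measure_ge0 /= => /(_ isT).
rewrite /ms_identity => msG.
rewrite -[RHS]msG; apply: eq_integral => w _; apply: eq_integral => u _.
by congr (_ * _); rewrite (mass_cancel _ (X w, xi w)).
Qed.

(* For [G1 `<=` K `\` G2] the pair [(G1, G2)] is reached as the difference of
   [(G1, K)] and [(G1, K `\` G2)], whence the finiteness assumption. *)
Let rectangle n (A : set (E * M)) (G1 G2 : set V) :
  measurable A -> measurable G1 -> jordan G2 -> G1 `<=` cube n.+1 ->
  N2 (A `*` (G1 `*` cube n.+1)) < +oo ->
  N1 (A `*` (G1 `*` (G2 `&` cube n.+1))) = N2 (A `*` (G1 `*` (G2 `&` cube n.+1))).
Proof.
set K := cube n.+1 => mA mG1 jG2 G1K fin.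
have mG2 := jG2.1.
have jK : jordan K by exact: jordan_cube.
have bK : bounded_set K by exact: bounded_cube.
have bsub (B : set V) : B `<=` K -> bounded_set B.
  by move=> BK; move/bounded_rVP: bK => [b Kb]; apply/bounded_rVP; exists b => x /BK/Kb.
have mR (B C : set V) : measurable B -> measurable C -> measurable (A `*` (B `*` C)).
  by move=> mB mC; do 2 apply: measurableX => //.
have mK := jK.1.
have mGa := measurableI _ _ mG1 mG2.
have mGb := measurableD mG1 mG2.
have mG2K := measurableI _ _ mG2 mK.
have mG2cK := measurableI _ _ (measurableC mG2) mK.
have split1 : A `*` (G1 `*` (G2 `&` K)) =
    A `*` ((G1 `&` G2) `*` (G2 `&` K)) `|` A `*` ((G1 `\` G2) `*` (G2 `&` K)).
  apply/seteqP; split=> -[x [y z]] /=; last by tauto.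
  by case: (pselect (G2 y)); tauto.
have split2 : A `*` ((G1 `\` G2) `*` K) =
    A `*` ((G1 `\` G2) `*` (G2 `&` K)) `|` A `*` ((G1 `\` G2) `*` (~` G2 `&` K)).
  apply/seteqP; split=> -[x [y z]] /=; last by tauto.
  by case: (pselect (G2 z)); tauto.
have disj1 : A `*` ((G1 `&` G2) `*` (G2 `&` K)) `&` A `*` ((G1 `\` G2) `*` (G2 `&` K)) = set0.
  by apply/seteqP; split=> -[x [y z]] //=; tauto.
have disj2 : A `*` ((G1 `\` G2) `*` (G2 `&` K)) `&` A `*` ((G1 `\` G2) `*` (~` G2 `&` K)) = set0.
  by apply/seteqP; split=> -[x [y z]] //=; tauto.
rewrite split1 !(measureU _ (mR _ _ mGa mG2K) (mR _ _ mGb mG2K) disj1).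
congr (_ + _).
  apply: star => //.
  - exact: jordanI.
  - by apply: bsub; exact: subIsetr.
  - by move=> x [G1x G2x]; split => //; exact: G1K.
have e1 := star jK bK mA mGb (fun x h => G1K x h.1).
have e2 : N1 (A `*` ((G1 `\` G2) `*` (~` G2 `&` K))) =
    N2 (A `*` ((G1 `\` G2) `*` (~` G2 `&` K))).
  apply: star => //.
  - by apply: jordanI => //; exact: jordanC.
  - by apply: bsub; exact: subIsetr.
  - by move=> x [G1x G2x]; split => //; exact: G1K.
have fin2 : N2 (A `*` ((G1 `\` G2) `*` (~` G2 `&` K))) \is a fin_num.
  rewrite ge0_fin_numE//; apply: le_lt_trans fin.
  apply: le_measure; rewrite ?inE; [exact: mR|exact: mR|].
  by move=> [x [y z]] /=; tauto.
move: e1; rewrite split2 !(measureU _ (mR _ _ mGb mG2K) (mR _ _ mGb mG2cK) disj2).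
by move/(adde_cancelr e2 fin2); apply.
Qed.

(** A pi-system whose last factor alone is restricted to sets with null boundary, the only ones that
    [rectangle] reaches. *)
Let gen : set (set (E * M * (V * V))) := [set S | exists A G1 G2,
  [/\ measurable A, measurable G1, jordan G2 & S = A `*` (G1 `*` G2)]].

Let gen_measurable : gen `<=` measurable.
Proof.
by move=> _ [A [G1 [G2 [mA mG1 [mG2 _] ->]]]]; do 2 apply: measurableX => //.
Qed.

(** The three projections are measurable for the sigma-algebra generated by [gen], the last one
    because halfspaces have null boundary; hence so is the identity. *)
Let measurable_gen S : measurable S -> <<s gen >> S.
Proof.
pose T' := g_sigma_algebraType gen.
have m1 : measurable_fun setT (fun x : T' => x.1 : E * M).
  move=> _ B mB; rewrite setTI; apply: sub_sigma_algebra.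
  exists B, setT, setT; split => //; first exact: (jordanT R k).
  by apply/seteqP; split=> -[x [y z]] //= [].
have m2 : measurable_fun setT (fun x : T' => x.2.1 : V).
  move=> _ B mB; rewrite setTI; apply: sub_sigma_algebra.
  exists setT, B, setT; split => //; first exact: (jordanT R k).
  by apply/seteqP; split=> -[x [y z]] //=; tauto.
have m3 : measurable_fun setT (fun x : T' => x.2.2 : V).
  apply: measurable_rVP => i.
  apply: (measurability _ (RGenInftyO.measurableE R)) => _ [_ [a ->] <-].
  rewrite setTI; apply: sub_sigma_algebra.
  exists setT, setT, [set x : V | (x ord0 i < a)%R]; split => //.
    exact: jordan_halfspace.
  by apply/seteqP; split=> -[x [y z]] /=; rewrite in_itv /=; tauto.
have mid : measurable_fun setT (fun x : T' => (x.1, (x.2.1, x.2.2)) : E * M * (V * V)).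
  by do 2 apply: measurable_fun_pair => //.
move=> mS; have := mid measurableT S mS; rewrite setTI.
by congr (<<s gen >> _); apply/seteqP; split=> -[x [y z]].
Qed.

Hypothesis sfin : sigma_finite setT (pushforward P (fun w => (X w, xi w))).

Let N12 S : measurable S -> N1 S = N2 S.
Proof.
have [F FT mF] := sfin.
(* On [W t] the law of [(X, xi)] is finite and the mass of a cube is bounded. If [u] and [v + u]
   have norm below [n + 1], then [v] has norm below [2 (n + 1)], which is the radius of that
   cube. *)
pose W (t : nat * nat * nat) : set (E * M) :=
  F t.1.1 `&` [set z : E * M | z.2 (cube (t.1.2 + t.1.2).+2) <= t.2%:R%:E].
have mW t : measurable (W t).
  apply: measurableI; first exact: (mF _).1.
  rewrite -[X in measurable X]setTI; apply: emeasurable_fun_infty_c => //.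
  exact: (measurableT_comp (measurable_lf_eval (measurable_cube _)) measurable_snd).
pose K (t : nat * nat * nat) : set V := cube t.1.2.+1.
pose g t := W t `*` (K t `*` K t).
have mg t : measurable (g t).
  by apply: measurableX => //; apply: measurableX; exact: measurable_cube.
apply: (measure_eq_cover mg).
  move=> [[x mu] [u v]].
  have [i _ Fi] : (\bigcup_i F i) (x, mu) by rewrite -FT.
  pose n := maxn (Num.truncn `|u|%R) (Num.truncn `|v|%R).
  have Kn y : (Num.truncn `|y|%R <= n)%N -> (@cube R k n.+1) y.
    by move=> yn; rewrite /cube /= (lt_le_trans (truncnS_gt _))// ler_nat.
  have := @lf_fin _ _ mu _ (@measurable_cube R k (n + n).+2) (@bounded_cube R k _).
  rewrite -ge0_fin_numE// => /fineK fE.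
  exists ((i, n), (Num.truncn (fine (mu (cube (n + n).+2)))).+1).
  split; [split => //=|by split; apply: Kn; rewrite ?leq_maxl ?leq_maxr].
  by rewrite -fE lee_fin ltW// truncnS_gt.
move=> t A mA Ag.
(* The mass is at most the product of the volume of [K t], the law of [W t] and the bound [t.2]. *)
have fing : N2 (g t) < +oo.
  have mK : measurable (K t) by exact: measurable_cube.
  have bnd w u : \int[xi w]_v (\1_(g t) (X w, xi w, (u, (v + u)%R)))%:E <=
      (\1_(K t) u)%:E * ((\1_(W t) (X w, xi w))%:E * t.2%:R%:E).
    have [uK|uK] := boolP (u \in K t); last first.
      rewrite [leRHS]muleC [\1_(K t) u]indicE (negPf uK) mule0 integral0_eq// => v _.
      by rewrite indicX [\1_(K t) u]indicE (negPf uK) mul0e mule0.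
    have [wW|wW] := boolP ((X w, xi w) \in W t); last first.
      rewrite [\1_(W t) _]indicE (negPf wW) mul0e mule0 integral0_eq// => v _.
      by rewrite indicX [\1_(W t) _]indicE (negPf wW) mul0e.
    rewrite ![in leRHS]indicE uK wW !mul1e.
    apply: le_trans (set_mem wW).2 => /=.
    rewrite -(integral_indicT (lf_val (xi w)) (measurable_cube _)).
    apply: ge0_le_integral => //; [by mfun|exact: (measurable_indicE (@measurable_cube R k _))|].
    move=> v _; rewrite lee_fin !indicE ler_nat.
    have [|//] := boolP (_ \in g t); move=> /set_mem[_ [/= _ vuK]].
    rewrite mem_set// /cube /=.
    have := set_mem uK; rewrite /K /cube /= => nu; rewrite /K /cube /= in vuK.
    rewrite -[v](addrK u) (le_lt_trans (ler_normB _ _))//.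
    have -> : ((t.1.2 + t.1.2)%N.+2%:R = t.1.2.+1%:R + t.1.2.+1%:R :> R)%R.
      by rewrite -natrD addSn addnS.
    exact: ltrD.
  rewrite -(integral_indicT N2 (mg t)) (IN2 (measurable_indicE (mg t)) (indic_ge0 _ _)).
  apply: (@le_lt_trans _ _ (\int[P]_w (leb R k (K t) *
      ((\1_(W t) (X w, xi w))%:E * t.2%:R%:E)))).
    apply: ge0_le_integral => //.
    - by move=> w _; do 2 (apply: integral_ge0 => ? _).
    - apply: (measurable_integral_lf2 (f := fun x =>
        (\1_(g t) (X x.1, xi x.1, (x.2.1, (x.2.2 + x.2.1)%R)))%:E)) => //.
        exact: sigma_finite_lf.
      by mfun.
    - by mfun.
    - move=> w _; rewrite -(integral_indicT (lf_val (leb R k)) mK) -ge0_integralZr// ?mule_ge0//;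
        last by mfun.
      apply: ge0_le_integral => //.
      + by move=> u _; apply: integral_ge0.
      + pose H (x : V * V) : \bar R := (\1_(g t) (X w, xi w, (x.1, (x.2 + x.1)%R)))%:E.
        have mH : measurable_fun setT H by rewrite /H; mfun.
        have H0 x : 0 <= H x by exact: indic_ge0.
        exact: (measurable_integral_snd mH H0 (sigma_finite_lf (xi w))).
      + by mfun.
  under eq_integral do rewrite muleCA.
  rewrite ge0_integralZr// ?mule_ge0//; last by mfun.
  have mWP : measurable ((fun w => (X w, xi w)) @^-1` W t).
    by apply: preimage_measurable (mW t); mfun.
  have -> : \int[P]_w (\1_(W t) (X w, xi w))%:E = P ((fun w => (X w, xi w)) @^-1` W t).
    by rewrite -(integral_indicT P mWP).
  have KE : leb R k (K t) \is a fin_num.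
    by rewrite ge0_fin_numE//; apply: lf_fin; [|exact: bounded_cube].
  rewrite lte_mul_pinfty//.
  - rewrite ge0_fin_numE//; apply: le_lt_trans (mF t.1.1).2.
    apply: le_measure; rewrite ?inE//.
    + by apply: preimage_measurable (mF t.1.1).1; mfun.
    + by move=> w [].
  - by rewrite -(fineK KE) -EFinM ltry.
have rect B G1 G2 : measurable B -> measurable G1 -> jordan G2 -> 
    N1 (g t `&` (B `*` (G1 `*` G2))) = N2 (g t `&` (B `*` (G1 `*` G2))).
  move=> mB mG1 jG2.
  have -> : g t `&` (B `*` (G1 `*` G2)) =
      (W t `&` B) `*` ((G1 `&` K t) `*` (G2 `&` K t)).
    by apply/seteqP; split=> -[x [y z]]; rewrite /g /=; tauto.
  apply: rectangle => //.
  - exact: measurableI.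
  - by apply: measurableI => //; exact: measurable_cube.
  - apply: le_lt_trans fing; apply: le_measure; rewrite ?inE//.
    + apply: measurableX; first exact: measurableI.
      by apply: measurableX; [apply: measurableI => //|]; exact: measurable_cube.
    + by move=> [x [y z]] [/= [? _] [[_ ?] ?]].
pose m1 := mrestr N1 (mg t); pose m2 := mrestr N2 (mg t).
have : m1 A = m2 A.
  apply: (@g_sigma_algebra_measure_unique _ _ _ gen gen_measurable (fun=> setT)).
  - move=> _; exists setT, setT, setT; split => //; first exact: (jordanT R k).
    by apply/seteqP; split=> -[x [y z]].
  - by apply/seteqP; split=> // x _; exists 0%N.
  - move=> _ _ [A1 [B1 [C1 [? ? ? ->]]]] [A2 [B2 [C2 [? ? ? ->]]]].
    exists (A1 `&` A2), (B1 `&` B2), (C1 `&` C2).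
    split; [exact: measurableI|exact: measurableI|exact: jordanI|].
    by apply/seteqP; split=> -[x [y z]] /=; tauto.
  - move=> _ [B [G1 [G2 [mB mG1 jG2 ->]]]].
    by have := rect B G1 G2 mB mG1 jG2; rewrite setIC.
  - move=> _; suff : N1 (setT `&` g t) < +oo by [].
    rewrite setTI; have := rect setT setT setT measurableT measurableT (jordanT R k).
    have -> : g t `&` (setT `*` (setT `*` setT)) = g t.
      by apply/seteqP; split=> -[x [y z]] /=; tauto.
    by move=> ->.
  - exact: measurable_gen.
by have -> : m1 A = N1 (A `&` g t) by []; have -> : m2 A = N2 (A `&` g t) by [];
  rewrite setIidl.
Qed.

Lemma mecke_of_measures : mecke.
Proof.
move=> g mg g0; pose K := @cell R k 1.
have mK : measurable K by exact: measurable_cell.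
have lebK : leb R k K = ((2 * 1) ^+ k)%:E by exact: leb_cell.
(* Only the difference of the two positions enters [g]; the first position is confined to a cell. By
   translation invariance each side is then the Mecke integral times the volume of the cell, a
   positive real that cancels. *)
pose f (x : E * M * (V * V)) := g (x.1, (x.2.2 - x.2.1)%R) * (\1_K x.2.1)%:E.
have mf : measurable_fun setT f by rewrite /f; mfun.
have f0 x : 0 <= f x by rewrite mule_ge0.
have : \int[N1]_z f z = \int[N2]_z f z by apply: eq_integral_measure; exact: N12.
rewrite (IN1 mf f0) (IN2 mf f0).
have slf := @sigma_finite_lf R k.
have E1 w : \int[leb R k]_u \int[xi w]_v f (tshift v (X w, xi w), ((v + u)%R, u)) =
    (\int[xi w]_v g (tshift v (X w, xi w), (- v)%R)) * leb R k K.
  pose H (x : V * V) := f (tshift x.2 (X w, xi w), ((x.2 + x.1)%R, x.1)).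
  have mH : measurable_fun setT H by rewrite /H; mfun.
  rewrite [LHS](tonelli mH (fun=> f0 _) (slf (leb R k)) (slf (xi w))).
  rewrite -ge0_integralZr//; last by mfun.
  apply: eq_integral => v _; rewrite /H /f /=.
  under eq_integral do rewrite opprD addrCA subrr addr0 addrC.
  rewrite ge0_integralZl//; last by mfun.
  rewrite (integral_lebD v (measurable_indicE mK))//.
  by rewrite integral_indicT.
have E2 w : \int[leb R k]_u \int[xi w]_v f (X w, xi w, (u, (v + u)%R)) =
    (\int[xi w]_v g (X w, xi w, v)) * leb R k K.
  pose H (x : V * V) := f (X w, xi w, (x.1, (x.2 + x.1)%R)).
  have mH : measurable_fun setT H by rewrite /H; mfun.
  rewrite [LHS](tonelli mH (fun=> f0 _) (slf (leb R k)) (slf (xi w))).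
  rewrite -ge0_integralZr//; last by mfun.
  apply: eq_integral => v _; rewrite /H /f /=.
  under eq_integral do rewrite addrK.
  by rewrite ge0_integralZl// ?integral_indicT//; mfun.
have mg1 : measurable_fun setT
    (fun y : Omega * V => g (tshift y.2 (X y.1, xi y.1), (- y.2)%R)) by mfun.
have mg2 : measurable_fun setT (fun y : Omega * V => g (X y.1, xi y.1, y.2)) by mfun.
have mI1 := measurable_lf_integral mxi (fun=> g0 _) mg1.
have mI2 := measurable_lf_integral mxi (fun=> g0 _) mg2.
have I1 : \int[P]_w \int[leb R k]_u \int[xi w]_v f (tshift v (X w, xi w), ((v + u)%R, u))
    = (\int[P]_w \int[xi w]_v g (tshift v (X w, xi w), (- v)%R)) * leb R k K.
  rewrite -(ge0_integralZr P measurableT mI1)//.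
    by apply: eq_integral => w _; exact: E1.
  by move=> w _; apply: integral_ge0.
have I2 : \int[P]_w \int[leb R k]_u \int[xi w]_v f (X w, xi w, (u, (v + u)%R))
    = (\int[P]_w \int[xi w]_v g (X w, xi w, v)) * leb R k K.
  rewrite -(ge0_integralZr P measurableT mI2)//.
    by apply: eq_integral => w _; exact: E2.
  by move=> w _; apply: integral_ge0.
move=> I12; have cK : (0 < (2 * 1) ^+ k :> R)%R by rewrite exprn_gt0.
apply: (pmule_inj cK); rewrite -lebK [LHS]muleC [RHS]muleC.
exact: etrans (esym I1) (etrans I12 I2).
Qed.

End equality.

Theorem mecke_of_ms : sigma_finite setT (pushforward P (fun w => (X w, xi w))) ->
  ms -> mecke.
Proof.
move=> sfin Hms; have [N1 [N2 IN]] := mecke_measures.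
have IN1 f mf f0 := (IN f mf f0).1.
have IN2 f mf f0 := (IN f mf f0).2.
exact: (mecke_of_measures IN1 IN2 Hms sfin).
Qed.

End mecke.

(** * From the Mecke identity to invariance under preserving shifts *)

Section ae_transfer.
Local Open Scope ereal_scope.
Context (R : realType).

Lemma measure_setI_full d (T : measurableType d) (mu : {measure set T -> \bar R})
    (S G : set T) :
  measurable S -> measurable G -> mu (~` G) = 0 -> mu (S `&` G) = mu S.
Proof.
move=> mS mG G0; rewrite -[in RHS](setIT S) -(setUv G) setIUr measureU0//.
- exact: measurableI.
- by apply: measurableI => //; exact: measurableC.
- apply/eqP; rewrite eq_le measure_ge0 andbT -G0; apply: le_measure; rewrite ?inE.
  + by apply: measurableI => //; exact: measurableC.
  + exact: measurableC.
  + exact: subIsetr.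
Qed.

End ae_transfer.

Lemma lf_cube_gt0 (R : realType) (k : nat) (mu : lf_measure R k) :
  (0 < mu setT)%E -> exists n, (0 < mu (cube n))%E.
Proof.
move=> mu0; apply/not_existsP => h.
have mu_cube n : mu (cube n) = 0%E.
  by apply/eqP; rewrite eq_le measure_ge0 andbT leNgt; apply/negP/h.
have : mu (cube n) @[n --> \oo] --> mu setT.
  rewrite -(@bigcup_cube R k); apply: (@nondecreasing_cvg_mu _ _ _ mu (@cube R k)).
  - by move=> n; exact: measurable_cube.
  - by rewrite bigcup_cube.
  - by move=> m n mn; apply/subsetPset; exact: subset_cube.
under eq_fun do rewrite mu_cube.
move=> mu0'; have h0 := cvg_unique (@ereal_hausdorff R) (cvg_cst _) mu0'.
by rewrite -h0 ltxx in mu0.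
Qed.

Section product_law.
Local Open Scope ereal_scope.
Context (R : realType) (k : nat) dE (E : measurableType dE).
Context dO (Omega : measurableType dO) (P : {measure set Omega -> \bar R}).
Variables (X : Omega -> E) (xi : Omega -> lf_measure R k).
Hypotheses (mX : measurable_fun setT X) (mxi : measurable_fun setT xi).
Hypothesis sfin : sigma_finite setT (pushforward P (fun w => (X w, xi w))).
Context dO' (Omega' : measurableType dO') (P' : {measure set Omega' -> \bar R}).
Variable p : Omega' -> Omega.
Hypothesis ext : extension P P' p.
Context dF (F : measurableType dF) (Y : Omega' -> F).
Hypothesis mY : measurable_fun setT Y.
Variable nu : probability F R.
Hypothesis indep : forall A B, measurable A -> measurable B ->
  P' (Y @^-1` A `&` (fun w => (X (p w), hat (xi (p w)))) @^-1` B) =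
  nu A * pushforward P' (fun w => (X (p w), hat (xi (p w)))) B.

Let mp : measurable_fun setT p := ext.1.

(** Independence is given for [hat xi]; an event about [xi] is turned into one about [hat xi]
    through [unhat]. *)
Let rectangle_law A B : measurable A -> measurable B ->
  P' (Y @^-1` A `&` (fun w => (X (p w), xi (p w))) @^-1` B) =
  nu A * P ((fun w => (X w, xi w)) @^-1` B).
Proof.
move=> mA mB.
pose B' : set (E * lf_measure R k.+1) := (fun z => (z.1, unhat z.2)) @^-1` B.
have mB' : measurable B' by apply: preimage_measurable mB; mfun.
have BB' : (fun w => (X (p w), hat (xi (p w)))) @^-1` B' =
    (fun w => (X (p w), xi (p w))) @^-1` B.
  by apply/seteqP; split=> w; rewrite /B' /= (lf_equiv_mem_pair _ (unhat_hat _) mB).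
have := indep mA mB'; rewrite /pushforward BB' => ->; congr (_ * _).
have mXB : measurable ((fun w => (X w, xi w)) @^-1` B).
  by apply: preimage_measurable mB; mfun.
by rewrite -(ext.2 _ mXB).
Qed.

(** Since the law of [(X, xi)] is sigma-finite, its values on rectangles identify the joint law with
    the background as a product measure, to which Tonelli's theorem applies. *)
Lemma integral_product_law (f : F * (E * lf_measure R k) -> \bar R) :
  measurable_fun setT f -> (forall x, 0 <= f x) ->
  \int[P']_w f (Y w, (X (p w), xi (p w))) = \int[P]_w \int[nu]_y f (y, (X w, xi w)).
Proof.
move=> mf f0.
have mZ : measurable_fun setT (fun w => (X w, xi w)) by mfun.
have mZY : measurable_fun setT (fun w => ((X (p w), xi (p w)), Y w)) by mfun.
pose Q : {measure set (E * lf_measure R k) -> \bar R} :=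
  image_measure P mZ.
pose m' : {measure set ((E * lf_measure R k) * F) -> \bar R} :=
  image_measure P' mZY.
pose sQ := @sigma_finite_of R _ _ Q sfin.
have QE S : measurable S -> (sQ \x nu) S = m' S.
  apply: product_measure_unique => A B mA mB.
  rewrite muleC [RHS](_ : _ = nu B * P ((fun w => (X w, xi w)) @^-1` A))//.
  rewrite -rectangle_law//.
  by rewrite /m' /= /pushforward; congr (P' _); apply/seteqP; split=> w /=; tauto.
pose f' (z : (E * lf_measure R k) * F) := f (z.2, z.1).
have mf' : measurable_fun setT f' by rewrite /f'; mfun.
transitivity (\int[m']_z f' z).
  exact: esym (integral_pushT P' mZY mf' (fun=> f0 _)).
transitivity (\int[sQ \x nu]_z f' z).
  by apply: eq_integral_measure => S mS; exact: esym (QE S mS).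
have h := @fubini_tonelli1 _ _ _ _ _ sQ nu f' mf' (fun=> f0 _).
apply: etrans h _.
apply: (integral_pushT P mZ).
- exact: (measurable_fun_fubini_tonelli_F f' mf' (fun=> f0 _)).
- by move=> z; apply: integral_ge0 => y _; exact: f0.
Qed.

End product_law.

Section invariance.
Local Open Scope ereal_scope.
Context (R : realType) (k : nat) dE (E : measurableType dE).
Variable th : action R k E.
Context dO (Omega : measurableType dO) (P : {measure set Omega -> \bar R}).
Variables (X : Omega -> E) (xi : Omega -> lf_measure R k).
Hypotheses (mX : measurable_fun setT X) (mxi : measurable_fun setT xi).
Hypothesis sfin : sigma_finite setT (pushforward P (fun w => (X w, xi w))).
Hypothesis Hmecke : mecke th P X xi.
Context dO' (Omega' : measurableType dO') (P' : {measure set Omega' -> \bar R}).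
Variable p : Omega' -> Omega.
Hypothesis ext : extension P P' p.
Context dF (F : measurableType dF) (thF : action R k.+1 F) (Y : Omega' -> F).
Hypothesis mY : measurable_fun setT Y.
Variable nu : probability F R.
Hypothesis nu_stationary : forall t A, measurable A -> pushforward nu (thF t) A = nu A.
Hypothesis indep : forall A B, measurable A -> measurable B ->
  P' (Y @^-1` A `&` (fun w => (X (p w), hat (xi (p w)))) @^-1` B) =
  nu A * pushforward P' (fun w => (X (p w), hat (xi (p w)))) B.

Local Notation V := 'rV[R]_k.+1.
Local Notation M := (lf_measure R k.+1).
Local Notation L := (@lebesgue_measure R).

Let mp : measurable_fun setT p := ext.1.

Let T (v : V) (z : F * E * M) : F * E * M :=
  (thF v z.1.1, extend_action th v z.1.2, shift v z.2).

Let integral_stationary v (f : F -> \bar R) :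
  measurable_fun setT f -> (forall x, 0 <= f x) ->
  \int[nu]_y f (thF v y) = \int[nu]_y f y.
Proof.
move=> mf f0.
have mth : measurable_fun setT (thF v).
  by have := mfun_act thF (measurable_cst v) (@measurable_id _ F setT).
rewrite -(integral_pushT nu mth mf f0).
apply: (@eq_integral_measure _ _ _
  (image_measure nu mth) nu).
exact: nu_stationary.
Qed.

Let mfun_T d0 (S : measurableType d0) (f : S -> V) (g : S -> F * E * M) :
  measurable_fun setT f -> measurable_fun setT g ->
  measurable_fun setT (fun x => T (f x) (g x)).
Proof.
move=> mf mg; rewrite /T.
by apply: measurable_fun_pair; [apply: measurable_fun_pair|]; mfun.
Qed.

Let z' w : F * E * M := (Y w, X (p w), hat (xi (p w))).

(** Given [(X, xi)], the background is averaged by its law [nu], which is invariant under every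
    shift [v], and the last coordinate of [v] by [lambda_1], which is invariant under reflection.
    What remains is the Mecke identity for [xi]. *)
Lemma hat_mecke (g : F * E * M * V -> \bar R) :
  measurable_fun setT g -> (forall x, 0 <= g x) ->
  \int[P']_w \int[hat (xi (p w))]_v g (T v (z' w), (- v)%R) =
  \int[P']_w \int[hat (xi (p w))]_v g (z' w, v).
Proof.
move=> mg g0.
pose snu := sigma_finiteT nu.
pose f1 (x : F * (E * lf_measure R k)) :=
  \int[hat x.2.2]_v g (T v (x.1, x.2.1, hat x.2.2), (- v)%R).
pose f2 (x : F * (E * lf_measure R k)) :=
  \int[hat x.2.2]_v g (x.1, x.2.1, hat x.2.2, v).
pose S := (F * (E * lf_measure R k) * V)%type.
have mhat : measurable_fun setT (fun x : F * (E * lf_measure R k) => hat x.2.2) by mfun.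
have mg1 : measurable_fun setT
    (fun x : S => g (T x.2 (x.1.1, x.1.2.1, hat x.1.2.2), (- x.2)%R)).
  apply: (measurableT_comp mg); apply: measurable_fun_pair; last by mfun.
  by apply: mfun_T; mfun.
have mg2 : measurable_fun setT (fun x : S => g (x.1.1, x.1.2.1, hat x.1.2.2, x.2)).
  by mfun.
have mf1 : measurable_fun setT f1 := measurable_lf_integral mhat (fun=> g0 _) mg1.
have mf2 : measurable_fun setT f2 := measurable_lf_integral mhat (fun=> g0 _) mg2.
have f10 x : 0 <= f1 x by apply: integral_ge0.
have f20 x : 0 <= f2 x by apply: integral_ge0.
have L1 : \int[P']_w \int[hat (xi (p w))]_v g (T v (z' w), (- v)%R) =
  \int[P]_w \int[nu]_y f1 (y, (X w, xi w)).
  by rewrite -(integral_product_law mX mxi sfin ext mY indep mf1 f10).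
have L2 : \int[P']_w \int[hat (xi (p w))]_v g (z' w, v) =
  \int[P]_w \int[nu]_y f2 (y, (X w, xi w)).
  by rewrite -(integral_product_law mX mxi sfin ext mY indep mf2 f20).
(* The function [g] after averaging over the background and the last coordinate. *)
pose G (x : E * lf_measure R k * 'rV[R]_k) :=
  \int[L]_r \int[nu]_y g (y, x.1.1, hat x.1.2, snoc (x.2, r)).
have mG0 : measurable_fun setT (fun x : E * lf_measure R k * 'rV[R]_k * measurableTypeR R =>
    \int[nu]_y g (y, x.1.1.1, hat x.1.1.2, snoc (x.1.2, x.2))).
  apply: (measurable_integral_snd (f := fun x :
    (E * lf_measure R k * 'rV[R]_k * measurableTypeR R) * F =>
    g (x.2, x.1.1.1.1, hat x.1.1.1.2, snoc (x.1.1.2, x.1.2)))) => //.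
  by mfun.
have mG : measurable_fun setT G.
  apply: (measurable_integral_snd mG0) => //; last exact: sigma_finite_lebesgue.
  by move=> x; apply: integral_ge0.
have G0 x : 0 <= G x by do 2 (apply: integral_ge0 => ? _).
have H1 w : \int[nu]_y f1 (y, (X w, xi w)) =
    \int[xi w]_v G (tshift th v (X w, xi w), (- v)%R).
  pose h (x : F * V) := g (T x.2 (x.1, X w, hat (xi w)), (- x.2)%R).
  have mh : measurable_fun setT h.
    apply: (measurableT_comp mg); apply: measurable_fun_pair; last by mfun.
    by apply: mfun_T; mfun.
  have sh := sigma_finite_lf (hat (xi w)).
  apply: etrans (tonelli mh (fun=> g0 _) snu sh) _.
  pose j (x : V * F) := g (x.2, th (init x.1) (X w), hat (shift (init x.1) (xi w)), (- x.1)%R).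
  have mj : measurable_fun setT j by rewrite /j; mfun.
  pose H (v : V) := \int[nu]_y j (v, y).
  have mH : measurable_fun setT H := measurable_integral_snd mj (fun=> g0 _) snu.
  have H0 v : 0 <= H v by apply: integral_ge0 => y _; exact: g0.
  transitivity (\int[hat (xi w)]_v H v).
    apply: eq_integral => v _; rewrite /h /T /=.
    pose q (y : F) := g (y, th (init v) (X w), shift v (hat (xi w)), (- v)%R).
    have mq : measurable_fun setT q by rewrite /q; mfun.
    apply: etrans (integral_stationary v mq (fun=> g0 _)) _.
    apply: eq_integral => y _; rewrite /q /j /=.
    pose q2 (eta : M) := g (y, th (init v) (X w), eta, (- v)%R).
    have mq2 : measurable_fun setT q2 by rewrite /q2; mfun.
    exact: (lf_equiv_ereal mq2 (shift_hat v (xi w))).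
  apply: etrans (integral_hat (xi w) mH H0) _.
  apply: eq_integral => v _; rewrite /G /tshift /=.
  pose q (r : measurableTypeR R) :=
    \int[nu]_y g (y, th v (X w), hat (shift v (xi w)), snoc ((- v)%R, r)).
  have mq : measurable_fun setT q by
    exact: (measurable_fun_pair2 (th v (X w), shift v (xi w), (- v)%R) mG0).
  have q0 r : 0 <= q r by apply: integral_ge0.
  (* The Mecke map sends [v] to [- v] in every coordinate; the sign of the last one is absorbed
     here. *)
  rewrite -(integral_lebesgueN mq q0); apply: eq_integral => r _.
  apply: eq_integral => y _; rewrite /j /= init_snoc /=.
  by rewrite snocN.
have H2 w : \int[nu]_y f2 (y, (X w, xi w)) = \int[xi w]_v G (X w, xi w, v).
  pose h (x : F * V) := g (x.1, X w, hat (xi w), x.2).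
  have mh : measurable_fun setT h by rewrite /h; mfun.
  have sh := sigma_finite_lf (hat (xi w)).
  apply: etrans (tonelli mh (fun=> g0 _) snu sh) _.
  pose j (x : V * F) := g (x.2, X w, hat (xi w), x.1).
  have mj : measurable_fun setT j by rewrite /j; mfun.
  have mH := measurable_integral_snd mj (fun=> g0 _) snu.
  by apply: (integral_hat (xi w) mH) => v; apply: integral_ge0 => y _; exact: g0.
apply: etrans L1 _; apply/esym; apply: etrans L2 _; apply/esym.
transitivity (\int[P]_w \int[xi w]_v G (tshift th v (X w, xi w), (- v)%R)).
  by apply: eq_integral => w _; exact: H1.
apply: etrans (Hmecke mG G0) _.
by apply: eq_integral => w _; exact: esym (H2 w).
Qed.

Variable pi : F * M -> V.
Hypothesis mpi : measurable_fun setT pi.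
Hypothesis pi_preserves : forall w B, measurable B ->
  hat (xi (p w)) (allocation thF pi (Y w) (hat (xi (p w))) @^-1` B) =
  hat (xi (p w)) B.
Hypothesis nonzero : P [set w | xi w setT = 0] = 0.

Let pz (z : F * E * M) := pi (z.1.1, z.2).

Let T_comp (q : F * E * M -> \bar R) s t z :
  measurable_fun setT q -> q (T s (T t z)) = q (T (s + t)%R z).
Proof.
move=> mq; rewrite /T /= !actD.
pose q2 (eta : M) := q (thF s (thF t z.1.1), th (init s) (th (init t) z.1.2), eta).
have mq2 : measurable_fun setT q2 by rewrite /q2; mfun.
rewrite (_ : th (init (s + t)%R) z.1.2 = th (init s) (th (init t) z.1.2)); last first.
  by rewrite initD actD.
exact: (lf_equiv_ereal mq2 (shift_shift s t z.2)).
Qed.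

Let nz (B : set V) : set (F * E * M) := [set z : F * E * M | 0 < z.2 B].

Let measurable_nz B : measurable B -> measurable (nz B).
Proof.
move=> mB.
rewrite -[X in measurable X]setTI; apply: emeasurable_fun_o_infty => //.
exact: (measurableT_comp (measurable_lf_eval mB) measurable_snd).
Qed.

Let psi w := T (pi (Y w, hat (xi (p w)))) (z' w).

Let mz' : measurable_fun setT z'. Proof. by rewrite /z'; mfun. Qed.

Let mpsi : measurable_fun setT psi.
Proof. by apply: mfun_T; mfun. Qed.

Let mpz : measurable_fun setT pz. Proof. by rewrite /pz; mfun. Qed.

(* The test function in [hat_mecke] transports the unit mass spread by [inv_mass]
   around the shifted origin; [allocation] turns one side into an integral against
   the image of [hat (xi (p w))], which is [hat (xi (p w))] again. *)
Let invariant_nz A n : measurable A ->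
  P' (psi @^-1` (A `&` nz (cube n))) = P' (z' @^-1` (A `&` nz (cube n))).
Proof.
move=> mA; pose B : set V := cube n.
have mB : measurable B by exact: measurable_cube.
have B0 : recentre B 0 = B.
  by apply/seteqP; split=> u; rewrite /recentre /= addr0.
pose q (x : F * E * M * V) :=
  (\1_A x.1)%:E * ((\1_B x.2)%:E * inv_mass x.1.2 (recentre B 0)).
have mq : measurable_fun setT q.
  apply: mfun_mule; first by mfun.
  by apply: mfun_mule; [mfun|apply: measurable_inv_mass => //; mfun].
have q0 x : 0 <= q x by rewrite mule_ge0// mule_ge0// inv_mass_ge0.
have qE (z : F * E * M) : \int[z.2]_u q (z, u) = (\1_(A `&` nz B) z)%:E.
  have q20 u : 0 <= (\1_B u)%:E * inv_mass z.2 (recentre B 0).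
    by rewrite mule_ge0// inv_mass_ge0.
  rewrite /q /= ge0_integralZl//; last by mfun.
  rewrite ge0_integralZr//; [|by mfun|exact: inv_mass_ge0].
  rewrite integral_indicT// B0 /inv_mass.
  rewrite !indicE in_setI.
  have Bfin : z.2 B \is a fin_num.
    by rewrite ge0_fin_numE//; apply: lf_fin => //; exact: bounded_cube.
  have [zB0|zB0] := eqVneq (z.2 B) 0.
    by rewrite zB0 mul0e mule0 [z \in nz B]memNset ?andbF// /nz /= zB0 ltxx.
  rewrite [z \in nz B]mem_set; last by rewrite /nz /= lt0e zB0 measure_ge0.
  rewrite -{1}(fineK Bfin) -EFinM mulfV ?andbT -?EFinM ?mulr1//.
  by apply: contra zB0 => /eqP zB0; rewrite -(fineK Bfin) zB0.
pose g (x : F * E * M * V) := q (T (pz x.1) x.1, (x.2 - pz x.1)%R).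
have mg : measurable_fun setT g.
  apply: (measurableT_comp mq); apply: measurable_fun_pair; last by mfun.
  by apply: mfun_T; mfun.
have mAn : measurable (A `&` nz B) by apply: measurableI => //; exact: measurable_nz.
have PE (f : Omega' -> F * E * M) : measurable_fun setT f ->
    P' (f @^-1` (A `&` nz B)) = \int[P']_w (\1_(A `&` nz B) (f w))%:E.
  by move=> mf; rewrite -(integral_indicT P' (preimage_measurable mf mAn)).
rewrite (PE _ mpsi) (PE _ mz').
transitivity (\int[P']_w \int[hat (xi (p w))]_v g (z' w, v)).
  apply: eq_integral => w _; rewrite -qE /g /=.
  pose r (u : V) := q (psi w, u).
  have mr : measurable_fun setT r by rewrite /r; mfun.
  by apply: etrans (integral_shift _ (hat (xi (p w))) mr (fun=> q0 _)) _.
apply: etrans (esym (hat_mecke mg (fun=> q0 _))) _.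
transitivity (\int[P']_w \int[hat (xi (p w))]_v q (T v (z' w), (- v)%R)).
  apply: eq_integral => w _.
  pose r (v : V) := q (T v (z' w), (- v)%R).
  have mr : measurable_fun setT r.
    apply: (measurableT_comp mq); apply: measurable_fun_pair; last by mfun.
    by apply: mfun_T; mfun.
  pose tau := allocation thF pi (Y w) (hat (xi (p w))).
  have mtau : measurable_fun setT tau by rewrite /tau /allocation; mfun.
  transitivity (\int[hat (xi (p w))]_v r (tau v)).
    apply: eq_integral => v _; rewrite /g /r /=.
    (* Moving by [v] and then by the shift [rho] chosen there is moving by [tau v], and the mark
       [- v - rho] is [- tau v]: the integrand depends on [v] only through [tau v]. *)
    set rho := pz (T v (z' w)).
    have -> : tau v = (rho + v)%R by rewrite addrC.
    rewrite -opprD [(v + rho)%R]addrC.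
    pose qv (z : F * E * M) := q (z, (- (rho + v))%R).
    have mqv : measurable_fun setT qv by rewrite /qv; mfun.
    exact: (T_comp rho v (z' w) mqv).
  apply: etrans (esym (integral_pushT (hat (xi (p w))) mtau mr (fun=> q0 _))) _.
  apply: (@eq_integral_measure _ _ _
    (image_measure (hat (xi (p w))) mtau) (hat (xi (p w)))).
  exact: pi_preserves.
apply: etrans (hat_mecke mq q0) _.
by apply: eq_integral => w _; rewrite -qE.
Qed.

Let increasing_nz A (f : Omega' -> F * E * M) :
  measurable A -> measurable_fun setT f ->
  P' (f @^-1` (A `&` nz (cube n))) @[n --> \oo] --> P' (f @^-1` (A `&` nz setT)).
Proof.
move=> mA mf.
have -> : f @^-1` (A `&` nz setT) = \bigcup_n (f @^-1` (A `&` nz (cube n))).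
  apply/seteqP; split=> w.
    by move=> [Afw /lf_cube_gt0[n fn]]; exists n.
  move=> [n _ [Afw fn]]; split => //; apply: lt_le_trans fn _.
  by apply: le_measure; rewrite ?inE//; exact: measurable_cube.
apply: (@nondecreasing_cvg_mu _ _ _ P' (fun n => f @^-1` (A `&` nz (cube n)))).
- move=> n; apply: preimage_measurable mf _; apply: measurableI => //.
  by apply: measurable_nz; exact: measurable_cube.
- apply: bigcup_measurable => n _.
  apply: preimage_measurable mf _; apply: measurableI => //.
  by apply: measurable_nz; exact: measurable_cube.
- move=> m n mn; apply/subsetPset => w [Afw fm]; split => //.
  apply: lt_le_trans fm _; apply: le_measure; rewrite ?inE; try exact: measurable_cube.
  exact: subset_cube.
Qed.

(** Configurations that charge some cube exhaust all but the event [xi = 0]. Shifts keep the total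
    mass, so the same null event is discarded on both sides. *)
Lemma preserving_shift_invariant A : measurable A ->
  P' (psi @^-1` A) = P' (z' @^-1` A).
Proof.
move=> mA; have mT := measurable_nz measurableT.
have full (f : Omega' -> F * E * M) : measurable_fun setT f ->
    (forall w, (f w).2 setT = hat (xi (p w)) setT) ->
    P' (f @^-1` (A `&` nz setT)) = P' (f @^-1` A).
  move=> mf fT; rewrite preimage_setI; apply: measure_setI_full.
  - exact: preimage_measurable mf mA.
  - exact: preimage_measurable mf mT.
  - have mN : measurable [set w | xi w setT = 0].
      exact: preimage_measurable (measurableT_comp (measurable_lf_eval measurableT) mxi)
        (emeasurable_set1 0).
    have := ext.2 _ mN; rewrite nonzero => pN.
    apply/eqP; rewrite eq_le measure_ge0 andbT -pN; apply: le_measure; rewrite ?inE.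
    + by apply: measurableC; exact: preimage_measurable mf mT.
    + exact: preimage_measurable mp mN.
    + move=> w /= /negP; rewrite fT -leNgt => hat0; apply/eqP.
      rewrite eq_le measure_ge0 andbT -(unhat_hat (xi (p w)) measurableT) unhatE.
      apply: le_trans hat0; apply: le_measure; rewrite ?inE//.
      by rewrite preimage_setT setTI; exact: measurable_unit_slab.
rewrite -(full _ mpsi); last by move=> w; exact: shiftE.
have fullz := full _ mz' (fun=> erefl); rewrite -fullz.
have c1 := increasing_nz mA mpsi.
have c2 := increasing_nz mA mz'.
have cE : (fun n => P' (psi @^-1` (A `&` nz (cube n)))) =
    (fun n => P' (z' @^-1` (A `&` nz (cube n)))).
  by apply/funext => n; exact: invariant_nz.
rewrite cE in c1.
exact: (cvg_unique (@ereal_hausdorff R) c1 c2).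
Qed.

End invariance.

Section support.
Local Open Scope ereal_scope.
Context (R : realType) (k : nat).
Context dO (Omega : measurableType dO) (P : {measure set Omega -> \bar R}).
Variable xi : Omega -> lf_measure R k.
Hypothesis mxi : measurable_fun setT xi.
Hypothesis supp : {ae P, forall w, msupport (xi w) 0%R}.

Lemma support_nonzero : P [set w | xi w setT = 0] = 0.
Proof.
have mN : measurable [set w | xi w setT = 0].
  exact: preimage_measurable (measurableT_comp (measurable_lf_eval measurableT) mxi)
    (emeasurable_set1 0).
apply/(negligibleP _ mN); apply: negligibleS supp => w /= xi0 /(_ setT openT I).
by rewrite xi0 ltxx.
Qed.

End support.

Theorem invariant_of_mecke (R : realType) (k : nat) dE (E : measurableType dE)
    (th : action R k E) dO (Omega : measurableType dO)
    (P : {measure set Omega -> \bar R})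
    (X : Omega -> E) (xi : Omega -> lf_measure R k) :
  measurable_fun setT X -> measurable_fun setT xi ->
  sigma_finite setT (pushforward P (fun w => (X w, xi w))) ->
  {ae P, forall w, msupport (xi w) 0} -> mecke th P X xi ->
  invariant_under_preserving_shifts (extend_action th) P X (fun w => hat (xi w)).
Proof.
move=> mX mxi sfin supp Hm dO' Omega' P' p ext X' zeta' dF F thF Y mY.
move=> [nu [nu_stat indep]] pi [mpi pi_pres] A mA.
exact: (preserving_shift_invariant mX mxi sfin Hm ext mY nu_stat indep mpi
  pi_pres (support_nonzero mxi supp) mA).
Qed.

(** * Sampling U and V *)

Section uniqueness.
Local Open Scope ereal_scope.
Context (R : realType).

Lemma measure_unique_rectangles d1 d2 (T1 : measurableType d1)
    (T2 : measurableType d2) (m1 m2 : {measure set (T1 * T2) -> \bar R})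
    (F : (set T1)^nat) :
  \bigcup_n F n = setT -> (forall n, measurable (F n)) ->
  (forall n, m1 (F n `*` setT) < +oo) ->
  (forall A B, measurable A -> measurable B -> m1 (A `*` B) = m2 (A `*` B)) ->
  forall S, measurable S -> m1 S = m2 S.
Proof.
move=> FT mF Ffin m12 S mS.
pose C : set (set (T1 * T2)) := [set A `*` B | A in measurable & B in measurable].
apply: (measure_unique C (fun n => F n `*` setT)) => //.
- exact: measurable_prod_measurableType.
- move=> _ _ [X1 mX1 [X2 mX2 <-]] [Y1 mY1 [Y2 mY2 <-]].
  exists (X1 `&` Y1); first exact: measurableI.
  by exists (X2 `&` Y2); [exact: measurableI|rewrite setXI].
- by move=> n; exists (F n) => //; exists setT.
- by rewrite -setX_bigcupl FT setXTT.
- by move=> _ [A mA [B mB <-]]; exact: m12.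
Qed.

(** The measure with density [h], obtained as the first marginal of the semidirect product of [N]
    with the kernel that puts mass [h x] on the single point of [unit]. *)
Lemma density_measure d (T : measurableType d) (N : {measure set T -> \bar R})
    (h : T -> R) : measurable_fun setT h -> (forall x, 0 <= h x)%R ->
  exists N' : {measure set T -> \bar R},
  forall f, measurable_fun setT f -> (forall x, 0 <= f x) ->
    \int[N']_x f x = \int[N]_x ((h x)%:E * f x).
Proof.
move=> mh h0.
pose kap (x : T) : {measure set unit -> \bar R} := mscale (NngNum (h0 x)) (dirac tt).
have mkap : xsection_measurable kap.
  move=> S mS; rewrite (_ : (fun x => _) =
      fun x => (h x)%:E * (\1_((fun x => (x, tt)) @^-1` S) x)%:E); last first.
    apply/funext => x; rewrite /kap /= /mscale /= diracE; congr (_ * _).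
    rewrite indicE; congr (_%:R%:E); congr (nat_of_bool _).
    by apply/idP/idP => /set_mem Sx; apply/mem_set; [exact: (set_mem Sx)|exact: mem_set].
  apply: emeasurable_funM; first exact/measurable_EFinP.
  apply: measurable_indicE; apply: preimage_measurable mS.
  exact: measurable_fun_pair.
exists (image_measure
  (semidirect N mkap) (@measurable_fst _ _ T unit)).
move=> f mf f0.
apply: etrans (integral_pushT _ _ mf f0) _; first exact: measurable_fst.
rewrite integral_semidirect//; last exact: (measurableT_comp mf measurable_fst).
apply: eq_integral => x _.
rewrite ge0_integral_mscale// integral_dirac//.
by rewrite diracT mul1e.
Qed.

(** Division of extended reals and the real inverse treat a zero denominator differently, but the
    numerator is then 0 as well. *)
Lemma cond_measureE d (T : measurableType d) (mu : {measure set T -> \bar R})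
    (D B : set T) : measurable D -> measurable B -> mu D \is a fin_num ->
  cond_measure mu D B = mu (B `&` D) * ((fine (mu D))^-1)%:E.
Proof.
move=> mD mB Dfin; rewrite /cond_measure.
have [D0|D0] := eqVneq (mu D) 0.
  have -> : mu (B `&` D) = 0.
    apply/eqP; rewrite eq_le measure_ge0 andbT -D0.
    by apply: le_measure; rewrite ?inE//; exact: measurableI.
  by rewrite !mul0e.
congr (_ * _); rewrite -{1}(fineK Dfin) inver ifF//.
by apply/negbTE; apply: contra D0 => /eqP D0; rewrite -(fineK Dfin) D0.
Qed.

End uniqueness.

Section sampling.
Local Open Scope ereal_scope.
Context (R : realType) (k : nat).
Context dO (Omega : measurableType dO) (P : {measure set Omega -> \bar R}).
Variable xi : Omega -> lf_measure R k.
Hypothesis mxi : measurable_fun setT xi.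
Hypothesis supp : {ae P, forall w, msupport (xi w) 0%R}.
Local Notation V := 'rV[R]_k.
Variable C : set V.
Hypotheses (mC : measurable C) (bC : bounded_set C).
Hypotheses (C0 : 0 < lebesgue_rV R k C) (dC : lebesgue_rV R k (boundary C) = 0).

Let c : R := (fine (leb R k C))^-1.

Let Cfin : leb R k C \is a fin_num.
Proof. by rewrite ge0_fin_numE//; exact: lf_fin. Qed.

Let c0 : (0 <= c)%R. Proof. by rewrite invr_ge0 fine_ge0. Qed.

Let cC : c%:E * leb R k C = 1.
Proof.
rewrite /c -[X in _ * X]fineK// -EFinM mulVf//.
by rewrite gt_eqF// fine_gt0// C0 /= -ge0_fin_numE.
Qed.

(** A point [u] of [C] off the boundary is interior, so that [C - u] is a neighbourhood of 0. Here
    the support condition and the null boundary meet. *)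
Lemma msupport_recentre (mu : lf_measure R k) u :
  msupport mu 0%R -> C u -> ~ boundary C u -> 0 < mu (recentre C u).
Proof.
move=> mu0 Cu bu; have iu : interior C u.
  by apply: contrapT => niu; apply: bu; split => //; exact: subset_closure.
pose U := recentre (interior C) u.
have oU : open U.
  have : continuous (fun v : V => v + u)%R.
    move=> v; apply: (@continuousD R V V id (fun=> u)).
      exact: cvg_id.
    exact: cst_continuous.
  by move/continuousP; apply; exact: open_interior.
apply: lt_le_trans (mu0 _ oU _) _; first by rewrite /U /recentre /= add0r.
apply: le_measure; rewrite ?inE.
- exact: open_measurable_rV.
- exact: measurable_recentre.
- by move=> v; exact: interior_subset.
Qed.

Let inv_mass_mass (mu : lf_measure R k) u : mu (recentre C u) != 0 ->
  inv_mass mu (recentre C u) * mu (recentre C u) = 1.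
Proof.
move=> mu0; have mufin := recentre_fin mu u mC bC.
rewrite /inv_mass -[X in _ * X]fineK// -EFinM mulVf//.
by apply: contra mu0 => /eqP mu0; rewrite -(fineK mufin) mu0.
Qed.

Lemma ge0_integral_eq_off d (T : measurableType d) (mu : {measure set T -> \bar R})
    (N : set T) (f g : T -> \bar R) : measurable N -> mu N = 0 ->
  measurable_fun setT f -> (forall x, 0 <= f x) ->
  measurable_fun setT g -> (forall x, 0 <= g x) ->
  (forall x, ~ N x -> f x = g x) -> \int[mu]_x f x = \int[mu]_x g x.
Proof.
move=> mN N0 mf f0 mg g0 fg.
rewrite (ge0_negligible_integral mN measurableT mf (fun x _ => f0 x) N0).
rewrite (ge0_negligible_integral mN measurableT mg (fun x _ => g0 x) N0).
by apply: eq_integral => x /set_mem [_ Nx]; exact: fg.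
Qed.

(** The density of the law of [(w, U, V)] with respect to [P (dw) du xi_w (dv)]: [1 / lambda (C)] on
    [C] for [U], then [1 / xi_w (C - U)] on [C - U] for [V]. *)
Let h (z : Omega * (V * V)) : R :=
  (c * (\1_C z.2.1 * ((fine (xi z.1 (recentre C z.2.1)))^-1 * \1_C (z.2.2 + z.2.1))))%R.

Let hE z : (h z)%:E = c%:E * ((\1_C z.2.1)%:E *
  (inv_mass (xi z.1) (recentre C z.2.1) * (\1_C (z.2.2 + z.2.1)%R)%:E)).
Proof. by rewrite /h !EFinM. Qed.

Lemma sampling_measure : exists P' : {measure set (Omega * (V * V)) -> \bar R},
  forall f, measurable_fun setT f -> (forall x, 0 <= f x) -> \int[P']_z f z =
    \int[P]_w \int[leb R k]_u (c%:E * ((\1_C u)%:E *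
      (inv_mass (xi w) (recentre C u) *
       \int[xi w]_v ((\1_C (v + u)%R)%:E * f (w, (u, v)))))).
Proof.
have [N IN] := joint_measure P mxi.
have mi : measurable_fun setT (fun z : Omega * (V * V) =>
    inv_mass (xi z.1) (recentre C z.2.1)).
  by apply: measurable_inv_mass => //; mfun.
have mh : measurable_fun setT h.
  apply/measurable_EFinP; rewrite (_ : EFin \o h = fun z => c%:E * ((\1_C z.2.1)%:E *
    (inv_mass (xi z.1) (recentre C z.2.1) * (\1_C (z.2.2 + z.2.1)%R)%:E))).
    by mfun.
  by apply/funext => z; rewrite -hE.
have h0 z : (0 <= h z)%R.
  by rewrite -lee_fin hE; repeat apply: mule_ge0 => //; exact: inv_mass_ge0.
have [P' IP'] := density_measure N mh h0.
exists P' => f mf f0; rewrite IP'// IN; last 2 first.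
- by apply: mfun_mule => //; exact/measurable_EFinP.
- by move=> z; rewrite mule_ge0// lee_fin.
apply: eq_integral => w _; apply: eq_integral => u _.
pose r (v : V) := (\1_C (v + u)%R)%:E * f (w, (u, v)).
have mr : measurable_fun setT r by rewrite /r; mfun.
have r0 v : 0 <= r v by rewrite mule_ge0.
rewrite -[X in _ = _ * (_ * X)](ge0_integralZl (xi w) measurableT mr)//; last first.
  exact: inv_mass_ge0.
have mr2 : measurable_fun setT (fun v => inv_mass (xi w) (recentre C u) * r v) by mfun.
have r20 v : 0 <= inv_mass (xi w) (recentre C u) * r v by rewrite mule_ge0// inv_mass_ge0.
rewrite -[X in _ = _ * X](ge0_integralZl (xi w) measurableT mr2)//.
rewrite -ge0_integralZl//; last 2 first.
- by mfun.
- by move=> v _; rewrite mule_ge0.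
by apply: eq_integral => v _; rewrite hE /r /= !muleA.
Qed.

Section sampled.
Variable P' : {measure set (Omega * (V * V)) -> \bar R}.
Hypothesis IP' : forall f, measurable_fun setT f -> (forall x, 0 <= f x) ->
  \int[P']_z f z = \int[P]_w \int[leb R k]_u (c%:E * ((\1_C u)%:E *
      (inv_mass (xi w) (recentre C u) *
       \int[xi w]_v ((\1_C (v + u)%R)%:E * f (w, (u, v)))))).

(** Integrating [V] out leaves a mass times its inverse. This is 1 for almost every [w] and every
    [u] of [C] off the boundary, by [msupport_recentre]. *)
Lemma integral_sampled_U (f : Omega * V -> \bar R) :
  measurable_fun setT f -> (forall x, 0 <= f x) ->
  \int[P']_z f (z.1, z.2.1) =
  \int[P]_w \int[leb R k]_u (c%:E * ((\1_C u)%:E * f (w, u))).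
Proof.
move=> mf f0; pose f' (z : Omega * (V * V)) := f (z.1, z.2.1).
have mf' : measurable_fun setT f' by rewrite /f'; mfun.
apply: etrans (IP' mf' (fun=> f0 _)) _; rewrite /f' /=.
have mF : measurable_fun setT (fun x : Omega * V =>
    inv_mass (xi x.1) (recentre C x.2) * (xi x.1 (recentre C x.2) * f x)).
  apply: mfun_mule; first by apply: measurable_inv_mass => //; mfun.
  by apply: mfun_mule => //; apply: measurable_recentre_mass => //; mfun.
have F0 x : 0 <= inv_mass (xi x.1) (recentre C x.2) * (xi x.1 (recentre C x.2) * f x).
  by rewrite mule_ge0 ?mule_ge0// inv_mass_ge0.
have E w u : inv_mass (xi w) (recentre C u) * \int[xi w]_v ((\1_C (v + u)%R)%:E * f (w, u))
  = inv_mass (xi w) (recentre C u) * (xi w (recentre C u) * f (w, u)).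
  congr (_ * _); rewrite ge0_integralZr//; last by mfun.
  congr (_ * _); rewrite -(integral_indicT (lf_val (xi w)) (measurable_recentre u mC)).
  by apply: eq_integral.
transitivity (\int[P]_w \int[leb R k]_u (c%:E * ((\1_C u)%:E *
    (inv_mass (xi w) (recentre C u) * (xi w (recentre C u) * f (w, u)))))).
  by apply: eq_integral => w _; apply: eq_integral => u _; rewrite E.
have sl := sigma_finite_lf (leb R k).
apply: ge0_ae_eq_integral => //.
- apply: (measurable_integral_snd (f := fun x : Omega * V =>
    c%:E * ((\1_C x.2)%:E * (inv_mass (xi x.1) (recentre C x.2) *
    (xi x.1 (recentre C x.2) * f x))))) => //.
    by mfun.
  by move=> x; rewrite mule_ge0// mule_ge0.
- apply: (measurable_integral_snd (f := fun x : Omega * V =>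
    c%:E * ((\1_C x.2)%:E * f x))) => //.
    by mfun.
  by move=> x; rewrite mule_ge0// mule_ge0.
- by move=> w _; apply: integral_ge0 => u _; rewrite mule_ge0// mule_ge0//; exact: (F0 (w, u)).
- by move=> w _; apply: integral_ge0 => u _; rewrite mule_ge0// mule_ge0.
- apply: filterS supp => w w0 _.
  apply: (ge0_integral_eq_off (measurable_boundary C) dC).
  + by apply: mfun_mule; [mfun|apply: mfun_mule; [mfun|exact: (measurable_fun_pair2 w mF)]].
  + by move=> u; rewrite mule_ge0// mule_ge0//; exact: (F0 (w, u)).
  + by mfun.
  + by move=> u; rewrite mule_ge0// mule_ge0.
  + move=> u bu; congr (_ * _).
    have [uC|uC] := boolP (u \in C); last by rewrite indicE (negPf uC) !mul0e.
    congr (_ * _); rewrite muleA inv_mass_mass ?mul1e//.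
    by rewrite gt_eqF//; apply: msupport_recentre => //; exact: set_mem.
Qed.

Lemma sampled_extension : extension P P' fst.
Proof.
split=> [|A mA]; first exact: measurable_fst.
have mA' : measurable (fst @^-1` A : set (Omega * (V * V))).
  exact: preimage_measurable measurable_fst mA.
rewrite /pushforward -(integral_indicT P' mA').
pose f (x : Omega * V) : \bar R := (\1_A x.1)%:E.
have mf : measurable_fun setT f by rewrite /f; mfun.
apply: etrans (integral_sampled_U mf (fun=> indic_ge0 _ _ _)) _.
rewrite -(integral_indicT P mA); apply: eq_integral => w _ /=.
rewrite /f /= ge0_integralZl//; last by mfun.
rewrite ge0_integralZr//; last by mfun.
by rewrite (integral_indicT (lf_val (leb R k)) mC) muleA cC mul1e.
Qed.

Context dE (E : measurableType dE) (X : Omega -> E).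
Hypothesis mX : measurable_fun setT X.

Lemma sampled_U : conditional_distribution P' (fun z => z.2.1)
  (fun z => (X z.1, xi z.1)) (fun=> cond_measure (lebesgue_rV R k) C).
Proof.
move=> A B mA mB.
pose Z w := (X w, xi w).
have mZ : measurable_fun setT Z by rewrite /Z; mfun.
have mAZ : measurable ((fun z : Omega * (V * V) => (X z.1, xi z.1)) @^-1` A).
  by apply: preimage_measurable mA; mfun.
have mAZ' : measurable (Z @^-1` A) by exact: preimage_measurable mZ mA.
have mBU : measurable ((fun z : Omega * (V * V) => z.2.1) @^-1` B).
  by apply: preimage_measurable mB; mfun.
rewrite integral_cst// -(integral_indicT P' (measurableI _ _ mAZ mBU)).
have -> : P' ((fun z => (X z.1, xi z.1)) @^-1` A) = P (Z @^-1` A).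
  by rewrite -(sampled_extension.2 _ mAZ').
pose f (x : Omega * V) : \bar R := (\1_A (X x.1, xi x.1))%:E * (\1_B x.2)%:E.
have mf : measurable_fun setT f by rewrite /f; mfun.
transitivity (\int[P']_z f (z.1, z.2.1)).
  by apply: eq_integral => z _; rewrite /f !indicE in_setI -EFinM -natrM mulnb.
have f0 x : 0 <= f x by rewrite mule_ge0.
apply: etrans (integral_sampled_U mf f0) _.
have mBC := measurableI _ _ mB mC.
have Cf : lebesgue_rV R k C \is a fin_num by exact: Cfin.
rewrite -[X in X * _]/(cond_measure (lebesgue_rV R k) C B) cond_measureE//.
transitivity (\int[P]_w ((c%:E * leb R k (B `&` C)) * (\1_(Z @^-1` A) w)%:E)).
  apply: eq_integral => w _.
  rewrite /f /= ge0_integralZl//; last by mfun.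
  rewrite -muleA; congr (_ * _).
  rewrite -(integral_indicT (lf_val (leb R k)) mBC) -ge0_integralZr//; last by mfun.
  apply: eq_integral => u _; rewrite muleCA muleC; congr (_ * _).
  by rewrite !indicE in_setI -EFinM -natrM mulnb andbC.
rewrite ge0_integralZl// ?mule_ge0//; last by mfun.
by rewrite integral_indicT// [X in X * _]muleC.
Qed.

Lemma recentre_image u : [set y - u | y in C]%R = recentre C u.
Proof. by rewrite addr_image_rV /recentre; apply/seteqP; split=> x /=; rewrite opprK. Qed.

Lemma sampled_V : conditional_distribution P' (fun z => z.2.2)
  (fun z => ((X z.1, xi z.1), z.2.1))
  (fun z => cond_measure z.1.2 [set y - z.2 | y in C]%R).
Proof.
move=> A B mA mB.
have mAZ : measurable ((fun z : Omega * (V * V) => (X z.1, xi z.1, z.2.1)) @^-1` A).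
  by apply: preimage_measurable mA; mfun.
have mBV : measurable ((fun z : Omega * (V * V) => z.2.2) @^-1` B).
  by apply: preimage_measurable mB; mfun.
pose mass (x : Omega * V) := xi x.1 (B `&` recentre C x.2).
have mmass : measurable_fun setT mass.
  pose S : set ((Omega * V) * V) := (fun y => y.2) @^-1` B `&`
    (fun y => y.2 + y.1.2)%R @^-1` C.
  have mS : measurable S.
    by apply: measurableI; [apply: preimage_measurable mB|apply: preimage_measurable mC]; mfun.
  have mxi1 : measurable_fun setT (fun x : Omega * V => xi x.1) by mfun.
  have := measurable_lf_xsection mxi1 mS; congr (measurable_fun _ _).
  apply/funext => x; rewrite /mass; congr (xi x.1 _).
  by apply/seteqP; split=> v; [move/set_mem|move=> Sv; apply/mem_set].
pose f (x : Omega * V) : \bar R := (\1_A (X x.1, xi x.1, x.2))%:E *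
  (mass x * inv_mass (xi x.1) (recentre C x.2)).
have mf : measurable_fun setT f.
  rewrite /f; apply: mfun_mule; first by mfun.
  apply: mfun_mule => //; apply: measurable_inv_mass => //; mfun.
have f0 x : 0 <= f x by rewrite mule_ge0// mule_ge0// inv_mass_ge0.
transitivity (\int[P']_z f (z.1, z.2.1)); last first.
  rewrite [RHS]integral_mkcond; apply: eq_integral => z _.
  rewrite patchE /f /= indicE.
  have -> : ((X z.1, xi z.1, z.2.1) \in A) =
      (z \in (fun z : Omega * (V * V) => (X z.1, xi z.1, z.2.1)) @^-1` A).
    by apply/idP/idP => /set_mem Az; apply/mem_set.
  case: ifPn => _; last by rewrite mul0e.
  rewrite mul1e recentre_image cond_measureE//; first exact: measurable_recentre.
  exact: recentre_fin.
apply: etrans _ (esym (integral_sampled_U mf f0)).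
pose g (z : Omega * (V * V)) : \bar R :=
  (\1_A (X z.1, xi z.1, z.2.1))%:E * (\1_B z.2.2)%:E.
have mg : measurable_fun setT g by rewrite /g; mfun.
have g0 z : 0 <= g z by rewrite mule_ge0.
rewrite -(integral_indicT P' (measurableI _ _ mAZ mBV)).
transitivity (\int[P']_z g z).
  by apply: eq_integral => z _; rewrite /g !indicE in_setI -EFinM -natrM mulnb.
apply: etrans (IP' mg g0) _; apply: eq_integral => w _; apply: eq_integral => u _.
rewrite /g /f /= [X in _ = _ * (_ * (_ * X))]muleC.
rewrite [X in _ = _ * (_ * X)]muleCA; congr (_ * (_ * (_ * _))).
have mBr := measurableI _ _ mB (measurable_recentre u mC).
rewrite /mass /= -(integral_indicT (lf_val (xi w)) mBr) -ge0_integralZl//; last by mfun.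
apply: eq_integral => v _; rewrite muleCA; congr (_ * _).
by rewrite !indicE in_setI -EFinM -natrM mulnb andbC.
Qed.

End sampled.

End sampling.

Section laws.
Local Open Scope ereal_scope.
Context (R : realType).

Lemma integral_same_distribution d1 d2 (T1 : measurableType d1)
    (T2 : measurableType d2) (P : {measure set T1 -> \bar R})
    (f g : T1 -> T2) (h : T2 -> \bar R) :
  measurable_fun setT f -> measurable_fun setT g -> same_distribution P f g ->
  measurable_fun setT h -> (forall x, 0 <= h x) ->
  \int[P]_x h (f x) = \int[P]_x h (g x).
Proof.
move=> mf mg fg mh h0; rewrite -(integral_pushT P mf mh h0) -(integral_pushT P mg mh h0).
exact: (@eq_integral_measure _ _ _
  (image_measure P mf)
  (image_measure P mg)).
Qed.

End laws.

(** * Mass-stationarity as an integral identity *)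

Section mass_stationary_identity.
Local Open Scope ereal_scope.
Context (R : realType) (k : nat) dE (E : measurableType dE).
Variable th : action R k E.
Context dO (Omega : measurableType dO) (P : {measure set Omega -> \bar R}).
Variables (X : Omega -> E) (xi : Omega -> lf_measure R k).
Hypotheses (mX : measurable_fun setT X) (mxi : measurable_fun setT xi).
Hypothesis sfin : sigma_finite setT (pushforward P (fun w => (X w, xi w))).
Hypothesis supp : {ae P, forall w, msupport (xi w) 0%R}.
Local Notation V := 'rV[R]_k.
Local Notation M := (lf_measure R k).

Section identity.
Variable C : set V.
Hypotheses (mC : measurable C) (bC : bounded_set C).
Hypotheses (C0 : 0 < lebesgue_rV R k C) (dC : lebesgue_rV R k (boundary C) = 0).

Let c : R := (fine (leb R k C))^-1.

Let c0 : (0 < c)%R.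
Proof.
by rewrite invr_gt0 fine_gt0// C0 /=; exact: lebesgue_rV_lf.
Qed.

Variable P' : {measure set (Omega * (V * V)) -> \bar R}.
Hypothesis IP' : forall f, measurable_fun setT f -> (forall x, 0 <= f x) ->
  \int[P']_z f z = \int[P]_w \int[leb R k]_u (c%:E * ((\1_C u)%:E *
      (inv_mass (xi w) (recentre C u) *
       \int[xi w]_v ((\1_C (v + u)%R)%:E * f (w, (u, v)))))).
Variable f : E * M * V -> \bar R.
Hypotheses (mf : measurable_fun setT f) (f0 : forall x, 0 <= f x).

(** On the explicit extension both sides of mass-stationarity carry the common factor [c], which is
    real and positive. *)
Lemma ms_identity_sampled : ms_identity th P X xi C f <->
  \int[P']_z f (tshift th z.2.2 (X z.1, xi z.1), (z.2.2 + z.2.1)%R) =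
  \int[P']_z f (X z.1, xi z.1, z.2.1).
Proof.
have ce0 : 0 <= c%:E by rewrite lee_fin ltW.
pose f1 (z : Omega * (V * V)) :=
  f (tshift th z.2.2 (X z.1, xi z.1), (z.2.2 + z.2.1)%R).
have mf1 : measurable_fun setT f1 by rewrite /f1; mfun.
pose f2 (x : Omega * V) := f (X x.1, xi x.1, x.2).
have mf2 : measurable_fun setT f2 by rewrite /f2; mfun.
have -> : \int[P']_z f (X z.1, xi z.1, z.2.1) =
    c%:E * \int[P]_w \int[leb R k]_u ((\1_C u)%:E * f (X w, xi w, u)).
  apply: etrans (integral_sampled_U mxi supp mC bC dC IP' mf2 (fun=> f0 _)) _.
  have mI : measurable_fun setT (fun x : Omega * V => (\1_C x.2)%:E * f2 x) by mfun.
  have I0 x : 0 <= (\1_C x.2)%:E * f2 x by rewrite mule_ge0//; exact: f0.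
  have mJ := measurable_integral_snd mI I0 (sigma_finite_lf (leb R k)).
  rewrite -(ge0_integralZl P measurableT mJ _ ce0); last first.
    by move=> w _; apply: integral_ge0 => u _; exact: (I0 (w, u)).
  apply: eq_integral => w _.
  by rewrite -(ge0_integralZl (leb R k) measurableT (measurable_fun_pair2 w mI) _ ce0).
have -> : \int[P']_z f (tshift th z.2.2 (X z.1, xi z.1), (z.2.2 + z.2.1)%R) =
    c%:E * \int[P]_w \int[leb R k]_u ((\1_C u)%:E * (inv_mass (xi w) (recentre C u) *
     \int[xi w]_v ((\1_C (v + u)%R)%:E * f (tshift th v (X w, xi w), (v + u)%R)))).
  apply: etrans (IP' mf1 (fun=> f0 _)) _.
  pose S := ((Omega * V) * V)%type.
  have mxi1 : measurable_fun setT (fun x : Omega * V => xi x.1) by mfun.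
  have mK : measurable_fun setT (fun x : S => (\1_C (x.2 + x.1.2)%R)%:E *
      f (tshift th x.2 (X x.1.1, xi x.1.1), (x.2 + x.1.2)%R)) by mfun.
  have mL := measurable_lf_integral mxi1 (fun x : S => mule_ge0 (indic_ge0 _ C _) (f0 _)) mK.
  have mI : measurable_fun setT (fun x : Omega * V =>
      (\1_C x.2)%:E * (inv_mass (xi x.1) (recentre C x.2) *
     \int[xi x.1]_v ((\1_C (v + x.2)%R)%:E * f (tshift th v (X x.1, xi x.1), (v + x.2)%R)))).
    apply: mfun_mule; first by mfun.
    by apply: mfun_mule => //; apply: measurable_inv_mass => //; mfun.
  have I0 (x : Omega * V) : 0 <= (\1_C x.2)%:E * (inv_mass (xi x.1) (recentre C x.2) *
     \int[xi x.1]_v ((\1_C (v + x.2)%R)%:E * f (tshift th v (X x.1, xi x.1), (v + x.2)%R))).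
    rewrite mule_ge0// mule_ge0 ?inv_mass_ge0//.
    by apply: integral_ge0 => v _; rewrite mule_ge0.
  have mJ := measurable_integral_snd mI I0 (sigma_finite_lf (leb R k)).
  rewrite -(ge0_integralZl P measurableT mJ _ ce0); last first.
    by move=> w _; apply: integral_ge0 => u _; exact: (I0 (w, u)).
  apply: eq_integral => w _.
  rewrite -(ge0_integralZl (leb R k) measurableT (measurable_fun_pair2 w mI) _ ce0)//.
split=> [e|]; first exact: (congr1 (fun x => c%:E * x) e).
exact: (pmule_inj c0).
Qed.

End identity.

Theorem ms_of_mass_stationary : mass_stationary th P X xi -> ms th P X xi.
Proof.
move=> Hms C mC bC C0 dC f mf f0.
have [P' IP'] := sampling_measure P mxi mC.
apply/(ms_identity_sampled mC bC C0 dC IP' mf f0).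
have mp : measurable_fun setT (fun z : Omega * (V * V) => z.1) by mfun.
have mU : measurable_fun setT (fun z : Omega * (V * V) => z.2.1) by mfun.
have mV : measurable_fun setT (fun z : Omega * (V * V) => z.2.2) by mfun.
have sd := Hms C mC bC C0 dC _ _ P' _ _ _
  (sampled_extension mxi supp mC bC C0 dC IP') mU mV
  (sampled_U mxi supp mC bC C0 dC IP' mX) (sampled_V mxi supp mC bC dC IP' mX).
apply: (integral_same_distribution _ _ sd mf f0).
  by rewrite /comp /=; mfun.
by rewrite /comp /=; mfun.
Qed.

Section model_law.
Variable C : set V.
Hypotheses (mC : measurable C) (bC : bounded_set C).
Hypotheses (C0 : 0 < lebesgue_rV R k C).

Let Cf : lebesgue_rV R k C \is a fin_num.
Proof. by rewrite ge0_fin_numE//; exact: lebesgue_rV_lf. Qed.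

Let condC_ge0 B : measurable B -> 0 <= cond_measure (lebesgue_rV R k) C B.
Proof.
by move=> mB; rewrite cond_measureE// mule_ge0// lee_fin invr_ge0 fine_ge0.
Qed.

Let condC_fin B : measurable B -> cond_measure (lebesgue_rV R k) C B < +oo.
Proof.
move=> mB; rewrite cond_measureE// lte_mul_pinfty ?ltry//.
rewrite ge0_fin_numE//; apply: lebesgue_rV_lf; first exact: measurableI.
move/bounded_rVP : bC => [b Cb]; apply/bounded_rVP; exists b => x [_ /Cb].
exact.
Qed.

(** The law of [(X, xi)] and the two conditional distributions fix the measure of rectangles, for
    [((X, xi), U)] and then with [V] adjoined. Sigma-finiteness of the law of [(X, xi)] makes
    rectangles decisive, so any extension may be exchanged for the sampled one. *)
Lemma model_law d1 (O1 : measurableType d1) (P1 : {measure set O1 -> \bar R})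
    (p1 : O1 -> Omega) (U1 V1 : O1 -> V)
    d2 (O2 : measurableType d2) (P2 : {measure set O2 -> \bar R})
    (p2 : O2 -> Omega) (U2 V2 : O2 -> V) :
  extension P P1 p1 -> measurable_fun setT U1 -> measurable_fun setT V1 ->
  extension P P2 p2 -> measurable_fun setT U2 -> measurable_fun setT V2 ->
  conditional_distribution P1 U1 (fun w => (X (p1 w), xi (p1 w)))
    (fun=> cond_measure (lebesgue_rV R k) C) ->
  conditional_distribution P2 U2 (fun w => (X (p2 w), xi (p2 w)))
    (fun=> cond_measure (lebesgue_rV R k) C) ->
  conditional_distribution P1 V1 (fun w => ((X (p1 w), xi (p1 w)), U1 w))
    (fun z => cond_measure z.1.2 [set y - z.2 | y in C]%R) ->
  conditional_distribution P2 V2 (fun w => ((X (p2 w), xi (p2 w)), U2 w))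
    (fun z => cond_measure z.1.2 [set y - z.2 | y in C]%R) ->
  forall S : set (E * M * V * V), measurable S ->
    P1 ((fun w => ((X (p1 w), xi (p1 w)), U1 w, V1 w)) @^-1` S) =
    P2 ((fun w => ((X (p2 w), xi (p2 w)), U2 w, V2 w)) @^-1` S).
Proof.
move=> ext1 mU1 mV1 ext2 mU2 mV2 cU1 cU2 cV1 cV2.
have [F FT mF] := sfin.
pose Z w := (X w, xi w).
have mZ : measurable_fun setT Z by rewrite /Z; mfun.
have mp1 := ext1.1; have mp2 := ext2.1.
have mZ1 : measurable_fun setT (fun w => (X (p1 w), xi (p1 w))) by mfun.
have mZ2 : measurable_fun setT (fun w => (X (p2 w), xi (p2 w))) by mfun.
have ZU d (O : measurableType d) (Q : {measure set O -> \bar R}) (p : O -> Omega)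
    (U : O -> V) : extension P Q p -> measurable_fun setT U ->
    conditional_distribution Q U (fun w => (X (p w), xi (p w)))
      (fun=> cond_measure (lebesgue_rV R k) C) ->
    forall A B, measurable A -> measurable B ->
    Q ((fun w => ((X (p w), xi (p w)), U w)) @^-1` (A `*` B)) =
    cond_measure (lebesgue_rV R k) C B * P (Z @^-1` A).
  move=> ext mU cU A B mA mB.
  have mA' : measurable (Z @^-1` A) by exact: preimage_measurable mZ mA.
  have mpA : measurable ((fun w => (X (p w), xi (p w))) @^-1` A).
    exact: preimage_measurable ext.1 mA'.
  apply: etrans (cU A B mA mB) _.
  by rewrite integral_cst//; congr (_ * _); rewrite -(ext.2 _ mA').
have mZU1 : measurable_fun setT (fun w => ((X (p1 w), xi (p1 w)), U1 w)) by mfun.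
have mZU2 : measurable_fun setT (fun w => ((X (p2 w), xi (p2 w)), U2 w)) by mfun.
pose l1 : {measure set (E * M * V) -> \bar R} :=
  image_measure P1 mZU1.
pose l2 : {measure set (E * M * V) -> \bar R} :=
  image_measure P2 mZU2.
have Ffin n : cond_measure (lebesgue_rV R k) C setT * P (Z @^-1` F n) < +oo.
  have cfin := condC_fin measurableT.
  rewrite lte_mul_pinfty//; first exact: condC_ge0.
  - by rewrite ge0_fin_numE//; exact: condC_ge0.
  - exact: (mF n).2.
have l12 S : measurable S -> l1 S = l2 S.
  apply: (@measure_unique_rectangles _ _ _ _ _ l1 l2 F) => //.
  - by move=> n; have [] := mF n.
  - move=> n; apply: (eq_ind_r (fun x => x < +oo) (Ffin n)).
    exact: ZU ext1 mU1 cU1 _ _ (mF n).1 measurableT.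
  - move=> A B mA mB; apply: etrans (ZU _ _ _ _ _ ext1 mU1 cU1 _ _ mA mB) _.
    exact: esym (ZU _ _ _ _ _ ext2 mU2 cU2 _ _ mA mB).
have mZUV1 : measurable_fun setT (fun w => ((X (p1 w), xi (p1 w)), U1 w, V1 w)) by mfun.
have mZUV2 : measurable_fun setT (fun w => ((X (p2 w), xi (p2 w)), U2 w, V2 w)) by mfun.
pose j1 : {measure set (E * M * V * V) -> \bar R} :=
  image_measure P1 mZUV1.
pose j2 : {measure set (E * M * V * V) -> \bar R} :=
  image_measure P2 mZUV2.
move=> S mS; suff : j1 S = j2 S by [].
apply: (@measure_unique_rectangles _ _ _ _ _ j1 j2 (fun n => F n `*` setT)) => //.
- by rewrite -setX_bigcupl -FT setXTT.
- by move=> n; apply: measurableX => //; have [] := mF n.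
- move=> n.
  have le1 : P1 ((fun w => ((X (p1 w), xi (p1 w)), U1 w, V1 w)) @^-1`
        (F n `*` setT `*` setT)) <=
      P1 ((fun w => ((X (p1 w), xi (p1 w)), U1 w)) @^-1` (F n `*` setT)).
    apply: le_measure; rewrite ?inE.
    + apply: (preimage_measurable mZUV1).
      by do 2 apply: measurableX => //; have [] := mF n.
    + apply: (preimage_measurable mZU1).
      by apply: measurableX => //; have [] := mF n.
    + by move=> w [].
  apply: le_lt_trans le1 _; apply: (eq_ind_r (fun x => x < +oo) (Ffin n)).
  exact: ZU ext1 mU1 cU1 _ _ (mF n).1 measurableT.
- move=> A B mA mB.
  apply: etrans (cV1 A B mA mB) _; apply: etrans _ (esym (cV2 A B mA mB)).
  pose f (x : E * M * V) : \bar R := (\1_A x)%:E *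
    (x.1.2 (B `&` recentre C x.2) * inv_mass x.1.2 (recentre C x.2)).
  have mf : measurable_fun setT f.
    apply: mfun_mule; first by mfun.
    apply: mfun_mule; last by apply: measurable_inv_mass => //; mfun.
    pose S' : set ((E * M * V) * V) := (fun y => y.2) @^-1` B `&`
      (fun y => y.2 + y.1.2)%R @^-1` C.
    have mS' : measurable S'.
      by apply: measurableI; [apply: preimage_measurable mB|apply: preimage_measurable mC]; mfun.
    have mx : measurable_fun setT (fun x : E * M * V => x.1.2) by mfun.
    have := measurable_lf_xsection mx mS'; congr (measurable_fun _ _).
    apply/funext => x; congr (x.1.2 _).
    by apply/seteqP; split=> v; [move/set_mem|move=> Sv; apply/mem_set].
  have f0 x : 0 <= f x by rewrite mule_ge0// mule_ge0// inv_mass_ge0.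
  have fE d (O : measurableType d) (Q : {measure set O -> \bar R}) (z : O -> E * M * V) :
      measurable_fun setT z ->
      \int[Q]_(w in z @^-1` A) cond_measure (z w).1.2 [set y - (z w).2 | y in C]%R B =
      \int[Q]_w f (z w).
    move=> mz; rewrite [LHS]integral_mkcond; apply: eq_integral => w _.
    rewrite patchE /f indicE.
    have -> : (z w \in A) = (w \in z @^-1` A).
      by apply/idP/idP => /set_mem Az; apply/mem_set.
    case: ifPn => _; last by rewrite mul0e.
    rewrite mul1e recentre_image cond_measureE//; first exact: measurable_recentre.
    exact: recentre_fin.
  apply: etrans (fE _ _ _ _ mZU1) _; apply: etrans _ (esym (fE _ _ _ _ mZU2)).
  rewrite -(integral_pushT P1 mZU1 mf f0) -(integral_pushT P2 mZU2 mf f0).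
  exact: (@eq_integral_measure _ _ _ l1 l2).
Qed.

End model_law.

Theorem mass_stationary_of_ms :
  (forall C : set V, measurable C -> bounded_set C ->
    0 < lebesgue_rV R k C -> lebesgue_rV R k (boundary C) = 0 ->
    forall S : set (E * M * V), measurable S ->
    ms_identity th P X xi C (fun x => (\1_S x)%:E)) ->
  mass_stationary th P X xi.
Proof.
move=> Hms C mC bC C0 dC dO' Omega' P' p U V0 ext mU mV X' xi' cU cV S mS.
have mp := ext.1.
have [Q IQ] := sampling_measure P mxi mC.
have extQ := sampled_extension mxi supp mC bC C0 dC IQ.
have cUQ := sampled_U mxi supp mC bC C0 dC IQ mX.
have cVQ := sampled_V mxi supp mC bC dC IQ mX.
have mUQ : measurable_fun setT (fun z : Omega * (V * V) => z.2.1) by mfun.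
have mVQ : measurable_fun setT (fun z : Omega * (V * V) => z.2.2) by mfun.
have law := model_law mC bC ext mU mV extQ mUQ mVQ cU cUQ cV cVQ.
have mSi : measurable_fun setT (fun x => (\1_S x)%:E : \bar R) by exact: measurable_indicE.
have /(ms_identity_sampled mC bC C0 dC IQ mSi (indic_ge0 _ _)) := Hms C mC bC C0 dC S mS.
pose S1 : set (E * M * V * V) :=
  (fun x => (tshift th x.2 x.1.1, (x.2 + x.1.2)%R)) @^-1` S.
have mS1 : measurable S1 by apply: preimage_measurable mS; mfun.
pose S2 : set (E * M * V * V) := (fun x => x.1) @^-1` S.
have mS2 : measurable S2 by apply: preimage_measurable mS; mfun.
move=> e; apply: etrans (law S1 mS1) _; apply: etrans _ (esym (law S2 mS2)).
have mg : measurable_fun setT (fun z : Omega * (V * V) =>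
    ((X z.1, xi z.1), z.2.1, z.2.2)) by mfun.
rewrite -(integral_indicT Q (preimage_measurable mg mS1)).
rewrite -(integral_indicT Q (preimage_measurable mg mS2)).
exact: e.
Qed.

End mass_stationary_identity.

(** * Quantiles of measures on R^k *)

Section ternary.
Context (R : realType).
Implicit Types b : nat -> bool.

(** Base 3 with digits 0 and 2, as for the Cantor set: unlike binary expansions these are unique, so
    every digit can be read off the number. *)
Fixpoint ternary_sum n b : R :=
  if n is m.+1 then (2 * (b 0%N)%:R + ternary_sum m (b \o S)) / 3 else 0.

Lemma ternary_sum_itv n b : 0 <= ternary_sum n b <= 1.
Proof.
elim: n b => [|n IH] b /=; first by rewrite lexx ler01.
have /andP[h0 h1] := IH (b \o S).
by apply/andP; split; case: (b 0%N); rewrite ?mulr1n ?mulr0n; lra.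
Qed.

Lemma ternary_sum_nd b : nondecreasing_seq (ternary_sum^~ b).
Proof.
apply/nondecreasing_seqP => n; elim: n b => [|n IH] b.
  by have /andP[] := ternary_sum_itv 1 b.
by rewrite /= ler_pM2r ?invr_gt0// lerD2l; exact: IH.
Qed.

Definition ternary b : R := limn (ternary_sum^~ b).

Lemma cvg_ternary b : ternary_sum n b @[n --> \oo] --> ternary b.
Proof.
apply: nondecreasing_is_cvgn; first exact: ternary_sum_nd.
by exists 1 => _ [n _ <-]; have /andP[] := ternary_sum_itv n b.
Qed.

Lemma ternary_itv b : 0 <= ternary b <= 1.
Proof.
have c : cvgn (ternary_sum^~ b) by apply/cvg_ex; exists (ternary b); exact: cvg_ternary.
apply/andP; split; [apply: limr_ge|apply: limr_le] => //.
  by apply: nearW => n; have /andP[] := ternary_sum_itv n b.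
by apply: nearW => n; have /andP[] := ternary_sum_itv n b.
Qed.

Lemma ternaryE b : ternary b = (2 * (b 0%N)%:R + ternary (b \o S)) / 3.
Proof.
have c1 : ternary_sum n.+1 b @[n --> \oo] --> ternary b.
  by rewrite (cvg_shiftS (ternary_sum^~ b)); exact: cvg_ternary.
have c2 : ternary_sum n.+1 b @[n --> \oo] -->
    (2 * (b 0%N)%:R + ternary (b \o S)) / 3.
  rewrite /=; apply: cvgMl; apply: cvgD; first exact: cvg_cst.
  exact: cvg_ternary.
exact: (cvg_unique (@norm_hausdorff _ R^o) c1 c2).
Qed.

(** The expanding map that drops the leading digit. The threshold 1/2 lies in the gap between 1/3
    and 2/3, which no such expansion enters. *)
Definition ternary_shift (c : R) : R := 3 * c - 2 * (2^-1 < c)%R%:R.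

Lemma ternary_bit b : (2^-1 < ternary b) = b 0%N.
Proof.
rewrite ternaryE; have /andP[h0 h1] := ternary_itv (b \o S).
case: (b 0%N); rewrite ?mulr1n ?mulr0n; last apply/negbTE; rewrite -?leNgt; lra.
Qed.

Lemma ternary_shiftE b : ternary_shift (ternary b) = ternary (b \o S).
Proof. by rewrite /ternary_shift ternary_bit {1}ternaryE; field. Qed.

Lemma ternary_bits b n : (2^-1 < iter n ternary_shift (ternary b)) = b n.
Proof.
elim: n b => [|n IH] b; first exact: ternary_bit.
by rewrite iterSr ternary_shiftE IH.
Qed.

Lemma measurable_natr_bool :
  measurable_fun setT (fun c : bool => c%:R : measurableTypeR R).
Proof. by []. Qed.

Lemma measurable_ternary d (T : measurableType d) (b : T -> nat -> bool) :
  (forall n, measurable_fun setT (b ^~ n)) ->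
  measurable_fun setT (fun x => ternary (b x) : measurableTypeR R).
Proof.
move=> mb; apply: (measurable_fun_cvg (h := fun n x => ternary_sum n (b x))).
  move=> n; elim: n b mb => [|n IH] b mb; first exact: measurable_cst.
  have mS := IH (fun x => b x \o S) (fun m => mb m.+1).
  have m0 : measurable_fun setT (fun x => (b x 0%N)%:R : R).
    exact: (measurableT_comp measurable_natr_bool (mb 0%N)).
  apply: measurable_funM; last exact: measurable_cst.
  by apply: measurable_funD => //; exact: measurable_funM.
by move=> x _; exact: cvg_ternary.
Qed.

Lemma measurable_ternary_bit n :
  measurable_fun setT (fun c : measurableTypeR R => 2^-1 < iter n ternary_shift c).
Proof.
have mit : measurable_fun setT (iter n ternary_shift : measurableTypeR R -> measurableTypeR R).
  elim: n => [|n IH] /=; first exact: measurable_id.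
  apply: measurable_funB; first exact: measurable_funM.
  apply: measurable_funM => //; apply: (measurableT_comp measurable_natr_bool).
  exact: measurable_fun_ltr.
exact: measurable_fun_ltr.
Qed.

End ternary.

Section countable_sup.
Local Open Scope ereal_scope.
Context (R : realType) (I : countType).

(** Written as the tail supremum of a sequence from index 0, a form in which measurability is
    inherited; codes of no index contribute -oo. *)
Definition countable_sup (u : I -> \bar R) : \bar R :=
  esups (fun n => if unpickle n is Some i then u i else -oo) 0%N.

Lemma countable_sup_gt u y : (y < countable_sup u) <-> exists i, y < u i.
Proof.
split=> [/ereal_sup_gt[_ [n _ <-]]|[i yi]].
  by case: unpickle => [i yi|]; [exists i|rewrite ltNge leNye].
apply: lt_le_trans yi _; apply: ereal_sup_ubound.
by exists (pickle i) => //; rewrite pickleK.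
Qed.

Lemma measurable_countable_sup d (T : measurableType d) (u : T -> I -> \bar R) :
  (forall i, measurable_fun setT (u ^~ i)) ->
  measurable_fun setT (fun x => countable_sup (u x)).
Proof.
move=> mu; apply: (measurable_fun_esups (f := fun n x =>
  if unpickle n is Some i then u x i else -oo)) => n.
by case: unpickle => [i|]; [exact: mu|exact: measurable_cst].
Qed.

End countable_sup.

Section encoding.
Context (R : realType) (k : nat).
Local Notation V := 'rV[R]_k.

(* The answers to all tests [q < x_i] with [q] rational, written as ternary digits
   0 and 2, embed R^k in the line with a Borel left inverse. *)
Definition coord_bits (x : V) (n : nat) : bool :=
  if unpickle n is Some (i, q) then ratr (q : rat) < x ord0 (i : 'I_k) else false.

Definition rV_encode (x : V) : measurableTypeR R := ternary R (coord_bits x).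

Definition rV_decode (c : measurableTypeR R) : V :=
  \row_i fine (countable_sup (fun q : rat =>
    if 2^-1 < iter (pickle (i, q)) (@ternary_shift R) c then (ratr q)%:E else -oo%E)).

(** A real number is the supremum of the rationals below it, and the digits tell which rationals
    these are. *)
Lemma rV_encodeK : cancel rV_encode rV_decode.
Proof.
move=> x; apply/rowP => i; rewrite mxE.
pose u (q : rat) := (if (ratr q < x ord0 i)%R then (ratr q)%:E else -oo%E) : \bar R.
rewrite (_ : countable_sup _ = countable_sup u); last first.
  congr countable_sup; apply/funext => q.
  by rewrite /rV_encode ternary_bits /coord_bits pickleK.
suff -> : countable_sup u = (x ord0 i)%:E by [].
apply/le_anti/andP; split; rewrite leNgt; apply/negP.
  move=> /countable_sup_gt[q]; rewrite /u; case: ifPn => // qx.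
  by rewrite lte_fin => /(lt_trans qx); rewrite ltxx.
move=> ux.
have [y yu yx] : exists2 y : R, (countable_sup u <= y%:E)%E & y < x ord0 i.
  move: ux; case: (countable_sup u) => [r||] //.
    by rewrite lte_fin; exists r.
  by move=> _; exists (x ord0 i - 1); [exact: leNye|rewrite ltrBlDr ltrDl].
have [q] := rat_in_itvoo yx; rewrite in_itv /= => /andP[yq qx].
have : (y%:E < countable_sup u)%E.
  by apply/countable_sup_gt; exists q; rewrite /u qx lte_fin.
by rewrite ltNge yu.
Qed.

Lemma measurable_rV_encode : measurable_fun setT rV_encode.
Proof.
apply: measurable_ternary => n; rewrite /coord_bits.
case: unpickle => [[i q]|]; last exact: measurable_cst.
by apply: measurable_fun_ltr => //; exact: measurable_coord.
Qed.

Lemma measurable_rV_decode : measurable_fun setT rV_decode.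
Proof.
apply: measurable_rVP => i; under eq_fun do rewrite mxE.
apply: (measurableT_comp (fine_measurable measurableT)).
apply: measurable_countable_sup => q.
by apply: measurable_fun_ifT => //; exact: measurable_ternary_bit.
Qed.

End encoding.

Section sampler.
Local Open Scope ereal_scope.
Context (R : realType) (k : nat) (a : R) (K : set 'rV[R]_k).
Hypotheses (a0 : (0 < a)%R) (mK : measurable K) (bK : bounded_set K).
Local Notation V := 'rV[R]_k.
Local Notation M := (lf_measure R k).
Local Notation L := (@lebesgue_measure R).

(** Quantiles need an order, so they are taken on the line: this is the distribution function of the
    encoded image of [mu] on [K]. *)
Definition encode_cdf (mu : M) (y : R) : \bar R :=
  mu (K `&` [set x | (rV_encode x <= y)%R]).

(* For [t] uniform on [-a, a) the level is uniform on [0, mu K]. *)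
Definition quantile (p : M * measurableTypeR R) : \bar R :=
  countable_sup (fun q : rat =>
    if encode_cdf p.1 (ratr q) < ((a - p.2) / (2 * a))%:E * p.1 K
    then (ratr q)%:E else -oo).

Definition sampler (p : M * measurableTypeR R) : V := @rV_decode R k (fine (quantile p)).

Let measurable_le y : measurable (K `&` [set x : V | (rV_encode x <= y)%R]).
Proof.
apply: measurableI => //.
apply: (@preimage_measurable _ _ _ _ (@rV_encode R k) [set` `]-oo, y]]).
  exact: measurable_rV_encode.
exact: measurable_itv.
Qed.

Lemma measurable_quantile : measurable_fun setT (fun p => fine (quantile p)).
Proof.
apply: (measurableT_comp (fine_measurable measurableT)).
apply: measurable_countable_sup => q.
apply: measurable_fun_ifT => //; apply: measurable_fun_lte.
  exact: (measurableT_comp (measurable_lf_eval (measurable_le _)) measurable_fst).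
apply: mfun_mule.
  by apply/measurable_EFinP; apply: measurable_funM => //; exact: measurable_funB.
exact: (measurableT_comp (measurable_lf_eval mK) measurable_fst).
Qed.

Lemma measurable_sampler : measurable_fun setT sampler.
Proof. exact: (measurableT_comp (@measurable_rV_decode R k) measurable_quantile). Qed.

Section law.
Variable mu : M.
Hypothesis muK : 0 < mu K.

Let F := encode_cdf mu.
Let level (t : R) : \bar R := ((a - t) / (2 * a))%:E * mu K.

Let Kfin : mu K \is a fin_num.
Proof. by rewrite ge0_fin_numE//; exact: lf_fin. Qed.

Let F_nd y z : (y <= z)%R -> F y <= F z.
Proof.
move=> yz; apply: le_measure; rewrite ?inE; [exact: measurable_le..|].
by move=> x [Kx /= xy]; split => //=; exact: le_trans yz.
Qed.

(** Right continuity, from continuity from above of a finite measure. The witness is rational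
    because [quantile] is a supremum over rationals. *)
Let F_right y (s : \bar R) : F y < s -> exists2 q : rat, (y < ratr q)%R & F (ratr q) < s.
Proof.
move=> Fys.
have c : F (y + n.+1%:R^-1)%R @[n --> \oo] --> F y.
  have -> : F y = mu (\bigcap_n (K `&` [set x : V | (rV_encode x <= y + n.+1%:R^-1)%R])).
    congr (mu _); apply/seteqP; split=> x /=.
      by move=> [Kx xy] n _; split => //=; rewrite (le_trans xy)// lerDl.
    move=> h; split; first by have [] := h 0%N I.
    rewrite leNgt; apply/negP => yx.
    have [n] := ltr_add_invr yx.
    by rewrite ltNge; have [_ /= ->] := h n I.
  apply: (@nonincreasing_cvg_mu _ _ _ mu
    (fun n => K `&` [set x : V | (rV_encode x <= y + n.+1%:R^-1)%R])).
  - by rewrite (le_lt_trans (le_measure _ _ _ (@subIsetl _ _ _)))// ?inE// -ge0_fin_numE.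
  - by move=> n; exact: measurable_le.
  - by apply: bigcapT_measurable => n; exact: measurable_le.
  - move=> m n mn; apply/subsetPset => x [Kx /= xn]; split => //=.
    by rewrite (le_trans xn)// lerD2l lef_pV2 ?posrE// ler_nat.
apply: contrapT => nq; move: Fys; rewrite ltNge => /negP; apply.
rewrite -(cvg_lim (@ereal_hausdorff R) c); apply: lime_ge.
  by apply/cvg_ex; exists (F y).
apply: nearW => n; rewrite leNgt; apply/negP => Fn; apply: nq.
have : (y < y + n.+1%:R^-1)%R by rewrite ltrDl.
move=> /rat_in_itvoo[q]; rewrite in_itv /= => /andP[yq qn]; exists q => //.
by apply: le_lt_trans Fn; apply: F_nd; exact: ltW.
Qed.

(** The Galois connection between a distribution function and its quantile function; right
    continuity gives the converse implication. *)
Let quantile_gt (t y : R) : (y%:E < quantile (mu, t)) <-> (F y < level t).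
Proof.
split=> [/countable_sup_gt[q]|].
  case: ifPn => // Fq; rewrite lte_fin => yq.
  by apply: le_lt_trans Fq; apply: F_nd; exact: ltW.
move=> /F_right[q yq Fq]; apply/countable_sup_gt; exists q.
by rewrite [X in if X then _ else _]Fq lte_fin.
Qed.

Let F0 : F (-1)%R = 0.
Proof.
rewrite /F /encode_cdf (_ : _ `&` _ = set0) ?measure0//.
apply/seteqP; split=> // x [_ /=]; have /andP[h _] := ternary_itv R (coord_bits x).
by rewrite leNgt => /negP; apply; rewrite (lt_le_trans _ h)// ltrN10.
Qed.

Let F1 : F 1%R = mu K.
Proof.
congr (mu _); rewrite setIidl// => x _ /=.
by have /andP[] := ternary_itv R (coord_bits x).
Qed.

(** For [t] in [-a, a) the level is positive and at most [mu K], the value 0 being met only at the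
    excluded end [a]. All codes lie in [0, 1], so the quantile lies between -1 and 1. *)
Let quantile_fin (t : R) : [set` `[(- a)%R, a[] t -> quantile (mu, t) \is a fin_num.
Proof.
rewrite /= in_itv /= => /andP[at_ ta].
have h1 : (-1)%:E < quantile (mu, t).
  apply/quantile_gt; rewrite F0 /level mule_gt0// lte_fin divr_gt0//.
    by rewrite subr_gt0.
  by rewrite mulr_gt0.
have h2 : quantile (mu, t) <= 1%:E.
  rewrite leNgt; apply/negP => /quantile_gt; rewrite F1 /level.
  rewrite ltNge => /negP; apply; rewrite -[leRHS]mul1e lee_wpmul2r//.
  by rewrite lee_fin ler_pdivrMr ?mulr_gt0// mul1r; lra.
rewrite fin_numE; apply/andP; split.
  by rewrite gt_eqF// (lt_trans _ h1)// ltNyr.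
by rewrite lt_eqF// (le_lt_trans h2)// ltry.
Qed.

Let J : set (measurableTypeR R) := [set` `[(- a)%R, a[].

Let mJ : measurable J. Proof. exact: measurable_itv. Qed.

Let Q (t : measurableTypeR R) : measurableTypeR R := fine (quantile (mu, t)).

Let mQ : measurable_fun setT Q.
Proof. exact: (measurable_fun_pair2 mu measurable_quantile). Qed.

Let m1 : {measure set (measurableTypeR R) -> \bar R} :=
  image_measure (mrestr L mJ) mQ.

Let m2 : {measure set (measurableTypeR R) -> \bar R} :=
  image_measure (mrestr mu mK)
    (@measurable_rV_encode R k).

Let m1E A : m1 A = L (Q @^-1` A `&` J). Proof. by []. Qed.

Let m2E A : m2 A = mu (@rV_encode R k @^-1` A `&` K). Proof. by []. Qed.

Let scaled_ray y : m1 [set` `]y, +oo[] * mu K = (2 * a)%:E * m2 [set` `]y, +oo[].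
Proof.
have Fy_fin : F y \is a fin_num.
  rewrite ge0_fin_numE//; apply: le_lt_trans (_ : mu K < +oo); last first.
    by rewrite -ge0_fin_numE.
  by apply: le_measure; rewrite ?inE//; exact: measurable_le.
pose f := fine (F y); pose m := fine (mu K).
have m0 : (0 < m)%R by rewrite fine_gt0// muK /= -ge0_fin_numE.
have f0 : (0 <= f)%R by rewrite fine_ge0.
have fm : (f <= m)%R.
  by apply: fine_le => //; apply: le_measure; rewrite ?inE//; exact: measurable_le.
(* The solution [t] of [(a - t) / (2 * a) * m = f]: the quantile exceeds [y] exactly for [t] in [-a,
   b). *)
pose b := (a - 2 * a * (f / m))%R.
have a2 : (0 <= 2 * a)%R by rewrite mulr_ge0// ltW.
have fm0 : (0 <= 2 * a * (f / m))%R by rewrite mulr_ge0// divr_ge0// ltW.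
have fm1 : (2 * a * (f / m) <= 2 * a)%R by rewrite ler_piMr// ler_pdivrMr// mul1r.
have level_lt t : (f < (a - t) / (2 * a) * m)%R = (t < b)%R.
  rewrite -ltr_pdivrMr// ltr_pdivlMr ?mulr_gt0// /b ltrBrDr -ltrBrDl.
  by rewrite [(f / m * _)%R]mulrC.
have ab : (- a <= b)%R by rewrite /b; lra.
have ba : (b <= a)%R by rewrite /b; lra.
have -> : m1 [set` `]y, +oo[] = (b + a)%:E.
  rewrite m1E (_ : _ `&` _ = [set` `[(- a)%R, b[]).
    rewrite lebesgue_measure_itv /= lte_fin; case: ifPn => [_|].
      by rewrite -EFinB opprK.
    by rewrite -leNgt => ba'; rewrite (_ : b = - a)%R ?addNr//; apply/le_anti/andP.
  apply/seteqP; split=> t /=; rewrite /J /= !in_itv /= andbT.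
    move=> [Qt tJ]; have /andP[-> ta] := tJ.
    have : (y%:E < quantile (mu, t)).
      by rewrite -(fineK (quantile_fin _)) ?lte_fin//= in_itv.
    move=> /quantile_gt; rewrite /level -(fineK Fy_fin) -(fineK Kfin) -EFinM lte_fin.
    by rewrite level_lt.
  move=> /andP[at_ tb]; have tJ : (- a <= t < a)%R by rewrite at_ (lt_le_trans tb).
  split => //; rewrite -lte_fin /Q fineK; last by apply: quantile_fin; rewrite /= in_itv.
  apply/quantile_gt; rewrite /level -(fineK Fy_fin) -(fineK Kfin) -EFinM lte_fin.
  by rewrite level_lt.
have -> : m2 [set` `]y, +oo[] = (m - f)%:E.
  rewrite m2E (_ : _ `&` _ = K `\` (K `&` [set x : V | (rV_encode x <= y)%R])).
    rewrite measureD//; last by rewrite -ge0_fin_numE.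
    rewrite setIA setIid EFinB.
    by congr (_ - _); [exact: esym (fineK Kfin)|exact: esym (fineK Fy_fin)].
  apply/seteqP; split=> x /=; rewrite in_itv /= andbT.
    by move=> [yx Kx]; split => // -[_]; rewrite leNgt yx.
  by move=> [Kx /not_andP[//|/negP]]; rewrite -ltNge.
rewrite -(fineK Kfin) -!EFinM -/m; congr (_%:E); rewrite /b.
by field; rewrite gt_eqF.
Qed.

(** Two finite measures on codes agree on rays, hence on all Borel sets, in particular on the codes
    that decode into [B]; decoding undoes encoding. Stated as a product, so that no mass is divided
    by. *)
Lemma sampler_law B : measurable B ->
  L (J `&` [set t | B (sampler (mu, t))]) * mu K = (2 * a)%:E * mu (B `&` K).
Proof.
move=> mB.
have a2 : (0 <= 2 * a)%R by rewrite mulr_ge0// ltW.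
have fK : (0 <= fine (mu K))%R by rewrite fine_ge0.
pose s1 := mscale (NngNum fK) m1; pose s2 := mscale (NngNum a2) m2.
have s12 y : s1 [set` `]y, +oo[] = s2 [set` `]y, +oo[].
  rewrite /s1 /s2 /mscale /= (fineK Kfin) muleC; exact: scaled_ray.
have eqs A : measurable A -> s1 A = s2 A.
  apply: (@measure_unique _ R (measurableTypeR R) (@RGenOInfty.G R)
    (fun n => [set` `](- n%:R)%R, +oo[]) _ _ _ _ s1 s2).
  - exact: RGenOInfty.measurableE.
  - move=> _ _ [x ->] [y ->]; exists (Num.max x y).
    by apply/seteqP; split=> z /=; rewrite !in_itv /= !andbT gt_max => /andP.
  - by move=> n; exists (- n%:R)%R.
  - apply/seteqP; split=> // x _; exists (Num.truncn `|x|).+1 => //=.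
    rewrite in_itv /= andbT ltrNl (le_lt_trans (ler_norm _))// normrN.
    exact: truncnS_gt.
  - by move=> _ [y ->]; exact: s12.
  - move=> n; apply: lte_mul_pinfty => //.
    apply: (@le_lt_trans _ _ (L J)).
      by apply: le_measure; rewrite ?inE//; apply: measurableI => //;
        rewrite -[X in measurable X]setTI; apply: mQ => //; exact: measurable_itv.
    by rewrite lebesgue_measure_itv /=; case: ifP => _; rewrite ?ltry// -EFinB ltry.
have mD := preimage_measurable (@measurable_rV_decode R k) mB.
have := eqs _ mD; rewrite /s1 /s2 /mscale /= (fineK Kfin) muleC.
congr (_ * _ = _ * _).
- by rewrite setIC.
- congr (mu _); apply/seteqP; split=> x /=; by rewrite rV_encodeK.
Qed.

End law.
End sampler.

(** * The torus background and its resampling shift *)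

Lemma measurable_fun_mem d1 d2 (T1 : measurableType d1) (T2 : measurableType d2)
    (A : set T2) (f : T1 -> T2) :
  measurable A -> measurable_fun setT f -> measurable_fun setT (fun x => f x \in A).
Proof.
move=> mA mf; apply: (@measurable_fun_bool _ _ _ _ true).
have -> : setT `&` (fun x => f x \in A) @^-1` [set true] = f @^-1` A.
  by rewrite setTI; apply/seteqP; split=> x /=; [move=> /set_mem|move=> /mem_set].
exact: preimage_measurable.
Qed.

Section wrap.
Context (R : realType) (k : nat) (a : R).
Hypothesis a0 : (0 < a).
Local Notation V := 'rV[R]_k.

Let a2 : 0 < 2 * a. Proof. exact: mulr_gt0. Qed.

Definition lattice (z : 'rV[int]_k) : V := \row_i (2 * a * (z ord0 i)%:~R).

Definition cell_index (x : V) : 'rV[int]_k :=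
  \row_i Num.floor ((x ord0 i + a) / (2 * a)).

(** The representative in the cell of [x] modulo the lattice; the cell serves as a model of the
    torus. *)
Definition torus_wrap (x : V) : V := x - lattice (cell_index x).

Lemma cell_index_add x z : cell_index (x + lattice z) = cell_index x + z.
Proof.
apply/rowP => i; rewrite !mxE addrAC mulrDl mulrAC divff ?gt_eqF// mul1r.
by rewrite floorDrz ?intr_int// intrKfloor.
Qed.

Lemma latticeN z : lattice (- z) = - lattice z.
Proof. by apply/rowP => i; rewrite !mxE mulrNz mulrN. Qed.

Lemma cell_index_sub x z : cell_index (x - lattice z) = cell_index x - z.
Proof. by rewrite -latticeN cell_index_add. Qed.

Lemma cell_index0 x : cell a x <-> cell_index x = 0.
Proof.
split=> [cx|idx0 i].
  apply/rowP => i; rewrite !mxE; have /andP[h1 h2] := cx i.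
  apply: floor_def; rewrite add0r mulr0z mulr1z ler_pdivlMr// mul0r.
  by rewrite ltr_pdivrMr// mul1r; apply/andP; split; lra.
have := congr1 (fun v : 'rV_k => v ord0 i) idx0; rewrite !mxE => fx.
have := floor_itv ((x ord0 i + a) / (2 * a)); rewrite fx.
rewrite add0r mulr0z mulr1z ler_pdivlMr// mul0r ltr_pdivrMr// mul1r => /andP[h1 h2].
by apply/andP; split; lra.
Qed.

Lemma wrap_cell x : cell a (torus_wrap x).
Proof. by apply/cell_index0; rewrite cell_index_sub subrr. Qed.

Lemma lattice0 : lattice 0 = 0.
Proof. by apply/rowP => i; rewrite !mxE mulr0. Qed.

Lemma wrap_id x : cell a x -> torus_wrap x = x.
Proof. by move=> /cell_index0 x0; rewrite /torus_wrap x0 lattice0 subr0. Qed.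

Lemma latticeD z z' : lattice (z + z') = lattice z + lattice z'.
Proof. by apply/rowP => i; rewrite !mxE intrD mulrDr. Qed.

Lemma wrap_lattice x z : torus_wrap (x + lattice z) = torus_wrap x.
Proof. by rewrite /torus_wrap cell_index_add latticeD opprD addrACA subrr addr0. Qed.

Lemma wrapDl x t : torus_wrap (torus_wrap x + t) = torus_wrap (x + t).
Proof. by rewrite {2}/torus_wrap addrAC -latticeN wrap_lattice. Qed.

Lemma measurable_wrap : measurable_fun setT torus_wrap.
Proof.
apply: measurable_rVP => i.
have -> : (fun t => torus_wrap t ord0 i) = (fun t : V => t ord0 i -
    2 * a * (Num.floor ((t ord0 i + a) / (2 * a)))%:~R).
  by apply/funext => t; rewrite !mxE.
apply: measurable_funB; first exact: measurable_coord.
have mf : measurable_fun setT (fun r : R => (Num.floor ((r + a) / (2 * a)))%:~R : R).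
  apply: nondecreasing_measurable => // x y xy.
  by rewrite ler_int le_floor// ler_pM2r ?invr_gt0// lerD2r.
by apply: measurable_funM => //; exact: (measurableT_comp mf (@measurable_coord R k i)).
Qed.

(** The torus sits inside the whole space, where an action must be defined. Points off the cell stay
    fixed: wrapping them would make the shift by 0 differ from the identity. *)
Let wact (t y : V) : V := if y \in cell a then torus_wrap (y + t) else y.

Let wact0 y : wact 0 y = y.
Proof. by rewrite /wact; case: ifP => // /set_mem cy; rewrite addr0 wrap_id. Qed.

Let wactD s t y : wact (s + t) y = wact s (wact t y).
Proof.
rewrite /wact; case: ifP => [_|->//].
by rewrite mem_set; [rewrite wrapDl -addrA [t + s]addrC|exact: wrap_cell].
Qed.

Let measurable_wact : measurable_fun setT (fun p : V * V => wact p.1 p.2).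
Proof.
apply: measurable_fun_ifT => //.
  by apply: measurable_fun_mem => //; exact: measurable_cell.
by apply: (measurableT_comp measurable_wrap); exact: measurable_addr_rV.
Qed.

Definition torus_action : action R k V := Action wact0 wactD measurable_wact.

Lemma torus_actionE t y :
  torus_action t y = if y \in cell a then torus_wrap (y + t) else y.
Proof. by []. Qed.

Lemma measurable_cell_index z : measurable [set x | cell_index x = z].
Proof.
have -> : [set x | cell_index x = z] = (fun x => x - lattice z) @^-1` (cell a).
  apply/seteqP; split=> x /=; rewrite cell_index0 cell_index_sub; last exact: subr0_eq.
  by move=> ->; rewrite subrr.
exact: preimage_measurable (measurable_subr_rV (lattice z)) (@measurable_cell R k a).
Qed.

(** Rotation of the torus is piecewise translation, with one piece for each lattice vector
    subtracted in wrapping. *)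
Lemma leb_wrap t (A : set V) : measurable A ->
  leb R k (cell a `&` torus_action t @^-1` A) = leb R k (cell a `&` A).
Proof.
have mt : measurable_fun setT (torus_action t) by apply: (measurable_fun_pair2 t measurable_wact).
have mc := @measurable_cell R k a.
pose m1 : {measure set V -> \bar R} :=
  image_measure (mrestr (leb R k) mc) mt.
pose m2 : {measure set V -> \bar R} := mrestr (leb R k) mc.
suff h B : measurable B -> m1 B = m2 B.
  by move=> mA; rewrite setIC [in RHS]setIC; exact: h.
(* A point [x] of the cell in the piece of index [z] comes from [x - t + lattice z], which lies in
   the cell. *)
apply: (@measure_eq_cover R 'rV[int]_k _ _ (fun z : 'rV[int]_k =>
    [set x : V | cell_index (x - t) = - z])).
- move=> z; exact: preimage_measurable (measurable_subr_rV t) (measurable_cell_index (- z)).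
- by move=> x; exists (- cell_index (x - t)) => /=; rewrite opprK.
move=> z D mD Dz.
change (leb R k (torus_action t @^-1` D `&` cell a) = leb R k (D `&` cell a)).
have -> : torus_action t @^-1` D `&` cell a =
    (fun y => y - (lattice z - t)) @^-1` (D `&` cell a).
  apply/seteqP; split=> y.
    move=> [Dty cy]; have {Dty} : D (torus_action t y) by [].
    rewrite torus_actionE mem_set// => Dy.
    have /= := Dz _ Dy; rewrite {1}/torus_wrap addrAC addrK cell_index_sub.
    move/cell_index0: (cy) => ->; rewrite add0r => /oppr_inj yz.
    move: Dy (wrap_cell (y + t)); rewrite /torus_wrap yz.
    by rewrite /= opprB addrA addrAC.
  rewrite /= opprB addrCA addrA [t + y]addrC => -[Dy cy].
  have /= := Dz _ Dy; rewrite addrAC addrK cell_index_sub => /eqP.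
  rewrite -subr_eq0 opprK subrK => /eqP/cell_index0 cy0; split => //.
  suff : D (torus_action t y) by [].
  rewrite torus_actionE mem_set//.
  by rewrite -(wrap_lattice _ (- z)) latticeN wrap_id.
rewrite -shiftE; apply: leb_shift; exact: measurableI.
Qed.

End wrap.

Section uniform_cell.
Local Open Scope ereal_scope.
Context (R : realType) (k : nat) (a : R).
Hypothesis a0 : (0 < a)%R.
Local Notation V := 'rV[R]_k.

Let mc : measurable (@cell R k a) := measurable_cell a.

Let c_ge0 : (0 <= ((2 * a) ^+ k)^-1)%R.
Proof. by rewrite invr_ge0 exprn_ge0// mulr_ge0// ltW. Qed.

Definition uniform_cell : set V -> \bar R :=
  mscale (NngNum c_ge0) (mrestr (leb R k) mc).

HB.instance Definition _ := Measure.on uniform_cell.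

Lemma uniform_cellE A : uniform_cell A =
  (((2 * a) ^+ k)^-1)%:E * leb R k (A `&` cell a).
Proof. by []. Qed.

Let uniform_cellT : uniform_cell setT = 1.
Proof.
rewrite uniform_cellE setTI leb_cell// -EFinM mulVf//.
by rewrite expf_neq0// gt_eqF// mulr_gt0.
Qed.

HB.instance Definition _ :=
  Measure_isProbability.Build _ _ _ uniform_cell uniform_cellT.

Lemma uniform_cell_stationary t A : measurable A ->
  pushforward uniform_cell (torus_action k a0 t) A = uniform_cell A.
Proof.
move=> mA; rewrite /pushforward !uniform_cellE; congr (_ * _).
by have := leb_wrap a0 t mA; rewrite setIC [X in _ = leb R k X]setIC.
Qed.

End uniform_cell.

Section resample.
Local Open Scope ereal_scope.
Context (R : realType) (k : nat) (a : R) (C : set 'rV[R]_k).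
Hypotheses (a0 : (0 < a)%R) (mC : measurable C) (bC : bounded_set C).
Hypothesis Ca : C `<=` cell a.
Local Notation V := 'rV[R]_k.
Local Notation W := 'rV[R]_k.+1.
Local Notation M := (lf_measure R k).
Local Notation L := (@lebesgue_measure R).
Local Notation J := ([set` `[(- a)%R, a[] : set (measurableTypeR R)).

Definition slab : set W := [set x : W | C (init x) /\ J (x ord0 ord_max)].

Lemma measurable_slab : measurable slab.
Proof. exact: measurable_setX_snoc mC (measurable_itv _). Qed.

Lemma slab_cell : slab `<=` cell a.
Proof. by move=> x [/Ca cx Jx]; apply/cellS. Qed.

Lemma bounded_slab : bounded_set slab.
Proof.
apply/bounded_rVP; exists a => x /slab_cell cx; apply: rV_norm_le; first exact: ltW.
by move=> i; have /andP[h1 h2] := cx i; rewrite ler_norml h1 ltW.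
Qed.

Lemma hat_slab (mu : M) : hat mu slab = mu C * (2 * a)%:E.
Proof.
rewrite (hat_setX mu mC (measurable_itv `[(- a)%R, a[)).
by rewrite lebesgue_measure_itv /= lte_fin gtrN// -EFinD opprK mulr2n mulrDl mul1r.
Qed.

(** Sampling from [hat mu] on the slab, not from [mu] on [C]: the sampled point brings a fresh
    uniform last coordinate, without which [hat mu] would not be preserved. *)
Let q (p : M * measurableTypeR R) : W := sampler a slab (hat p.1, p.2).

Let mq : measurable_fun setT q.
Proof.
have mh : measurable_fun setT (fun p : M * measurableTypeR R => (hat p.1, p.2)).
  by apply: measurable_fun_pair; [apply: measurable_hat|]; mfun.
exact: (measurableT_comp (measurable_sampler a measurable_slab) mh).
Qed.

(* The condition on [q] holds almost everywhere; requiring it makes [resample] map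
   the cell into itself at every point. *)
Definition resampled : set (M * W) :=
  [set z : M * W | [/\ C (init z.2), slab (q (z.1, z.2 ord0 ord_max)) & 0 < z.1 C]].

Lemma measurable_resampled : measurable resampled.
Proof.
have -> : resampled = (fun z : M * W => init z.2) @^-1` C `&`
    ((fun z : M * W => q (z.1, z.2 ord0 ord_max)) @^-1` slab `&`
     (fun z : M * W => z.1 C) @^-1` [set` `]0%E, +oo[]).
  apply/seteqP; split=> z /=; rewrite in_itv /= andbT => -[h1].
    by move=> h2 h3.
  by move=> [h2 h3]; split.
apply: measurableI; first by apply: preimage_measurable mC; mfun.
apply: measurableI.
  apply: preimage_measurable measurable_slab.
  by apply: (measurableT_comp mq); mfun.
apply: preimage_measurable; last exact: emeasurable_itv.
by apply: (measurableT_comp (measurable_lf_eval mC)); mfun.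
Qed.

Definition resample (z : M * W) : W :=
  if z \in resampled then q (z.1, z.2 ord0 ord_max) else z.2.

Lemma measurable_resample : measurable_fun setT resample.
Proof.
apply: measurable_fun_ifT.
- by apply: measurable_fun_mem => //; exact: measurable_resampled.
- by apply: (measurableT_comp mq); mfun.
- by mfun.
Qed.

Lemma resample_cell mu x : cell a x -> cell a (resample (mu, x)).
Proof.
by move=> cx; rewrite /resample; case: ifP => // /set_mem[_ /slab_cell].
Qed.

Lemma resample_law (mu : M) B : measurable B -> 0 < mu C ->
  L (J `&` [set r | (slab `&` B) (q (mu, r))]) * mu C = hat mu (slab `&` B).
Proof.
move=> mB C0; have C0' : 0 < hat mu slab by rewrite hat_slab mule_gt0// lte_fin mulr_gt0.
have := sampler_law a0 measurable_slab bounded_slab C0'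
  (measurableI _ _ measurable_slab mB).
rewrite setIAC setIid hat_slab muleA muleC.
have ne : (2 * a != 0)%R by rewrite gt_eqF// mulr_gt0.
move=> /(congr1 (fun e => ((2 * a)^-1)%:E * e)).
by rewrite !muleA -EFinM mulVf// !mul1e.
Qed.

(** By [resample_law] for the full set, the parameters that hit the slab already have length
    [2 * a]. *)
Let resample_miss (mu : M) : 0 < mu C ->
  L (J `&` [set r | ~ slab (q (mu, r))]) = 0.
Proof.
move=> C0; have Cf : mu C \is a fin_num by rewrite ge0_fin_numE//; exact: lf_fin.
have Cm : mu C = (fine (mu C))%:E by rewrite fineK.
have m0 : (fine (mu C) != 0)%R by rewrite gt_eqF// fine_gt0// C0 /= -ge0_fin_numE.
have mqr : measurable_fun setT (fun r => q (mu, r)) by exact: (measurable_fun_pair2 mu mq).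
have mhit : measurable [set r | slab (q (mu, r))].
  exact: (preimage_measurable mqr measurable_slab).
have LJ : L J = (2 * a)%:E.
  by rewrite lebesgue_measure_itv /= lte_fin gtrN// -EFinD opprK mulr2n mulrDl mul1r.
have hit : L (J `&` [set r | slab (q (mu, r))]) = (2 * a)%:E.
  have := resample_law measurableT C0; rewrite setIT hat_slab.
  move=> /(congr1 (fun e => e * ((fine (mu C))^-1)%:E)).
  rewrite Cm [X in _ = X * _]muleC -!muleA -EFinM mulfV// !mule1 => <-.
  by congr (L _); apply/seteqP; split=> r /= [h1 h2]; split => //; case: h2.
have -> : J `&` [set r | ~ slab (q (mu, r))] = J `\` [set r | slab (q (mu, r))] by [].
rewrite measureD//.
  by rewrite [X in X - _]LJ [X in _ - X]hit -EFinB subrr.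
by rewrite [X in X < _]LJ ltry.
Qed.

(** On the slab the resampled point depends on the last coordinate alone, so its law is the same for
    every [u] in [C]; the parameters that miss the slab are null. *)
Lemma resample_uniform (mu : M) u B : measurable B -> C u -> 0 < mu C ->
  L (J `&` [set r | B (resample (mu, snoc (u, r)))]) * mu C = hat mu (slab `&` B).
Proof.
move=> mB Cu C0.
have mqr : measurable_fun setT (fun r => q (mu, r)) by exact: (measurable_fun_pair2 mu mq).
have mhit : measurable [set r | slab (q (mu, r))].
  exact: (preimage_measurable mqr measurable_slab).
have mr : measurable_fun setT (fun r : measurableTypeR R => resample (mu, snoc (u, r))).
  by apply: (measurableT_comp measurable_resample); mfun.
have mJ : measurable J by exact: measurable_itv.
have hit r : slab (q (mu, r)) -> resample (mu, snoc (u, r)) = q (mu, r).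
  move=> hs; have h : resampled (mu, snoc (u, r)).
    by rewrite /resampled /mkset /fst /snd init_snoc snoc_max; split.
  by rewrite /resample (mem_set h) /fst /snd snoc_max.
pose N := J `&` [set r | ~ slab (q (mu, r))].
have mN : measurable N by apply: measurableI => //; exact: measurableC mhit.
have N0 : L (~` ~` N) = 0 by rewrite setCK resample_miss.
rewrite -resample_law//.
congr (_ * _).
rewrite -(measure_setI_full _ (measurableC mN) N0); last first.
  by apply: measurableI => //; exact: (preimage_measurable mr).
congr (L _); apply/seteqP; split=> r.
  move=> [[Jr Br] nN]; split => //.
  have hs : slab (q (mu, r)) by apply: contrapT => h; apply: nN.
  by split => //; have {}Br : B (resample (mu, snoc (u, r))) by []; rewrite hit in Br.
move=> [Jr [hs Bq]]; split; last by move=> [_]; exact.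
by split => //; suff : B (resample (mu, snoc (u, r))) by []; rewrite hit.
Qed.

Let split_slab (m : {measure set W -> \bar R}) S : measurable S ->
  m S = m (S `&` slab) + m (S `&` ~` slab).
Proof.
move=> mS; rewrite -measureU -?setIUr ?setUv ?setIT//.
- by apply: measurableI => //; exact: measurable_slab.
- by apply: measurableI => //; apply: measurableC; exact: measurable_slab.
- by apply/seteqP; split=> // x [[_ h] [_]].
Qed.

(** Off the slab nothing moves. On the slab only the last coordinate is read, so the image of
    [hat mu] is [mu C] times the image of length under [q], which is [hat mu] on the slab again. *)
Lemma resample_preserves (mu : M) B : measurable B -> B `<=` cell a ->
  hat mu [set x | cell a x /\ B (resample (mu, x))] = hat mu B.
Proof.
move=> mB Bc; have [C0|C0] := boolP (0 < mu C); last first.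
  congr (hat mu _); apply/seteqP; split=> x.
    by move=> [_]; rewrite /resample; case: ifP => // /set_mem[_ _ /= h]; rewrite h in C0.
  move=> Bx; split; first exact: Bc.
  by rewrite /resample; case: ifP => // /set_mem[_ _ /= h]; rewrite h in C0.
have mr : measurable_fun setT (fun x => resample (mu, x)).
  exact: (measurable_fun_pair2 mu measurable_resample).
have mqr : measurable_fun setT (fun r => q (mu, r)) by exact: (measurable_fun_pair2 mu mq).
set S := [set x | _ /\ _].
have mS : measurable S.
  by apply: measurableI; [exact: measurable_cell|exact: preimage_measurable mr mB].
apply: etrans (split_slab _ mS) (etrans _ (esym (split_slab _ mB))).
congr (_ + _); last first.
  congr (hat mu _); apply/seteqP; split=> x [].
    move=> [cx Bx] nx; split => //; move: Bx; rewrite /resample; case: ifP => //.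
    move=> /set_mem[/= Cx _ _]; exfalso; apply: nx; split => //.
    by have /cellS[] := cx.
  move=> Bx nx; have cx := Bc _ Bx; split => //; split => //.
  rewrite /resample; case: ifP => // /set_mem[/= Cx _ _]; exfalso; apply: nx; split => //.
  by have /cellS[] := cx.
pose N : set W := [set x | C (init x) /\ (J `&` [set r | ~ slab (q (mu, r))]) (x ord0 ord_max)].
have mmiss : measurable (J `&` [set r | ~ slab (q (mu, r))]).
  apply: measurableI; first exact: measurable_itv.
  by apply: measurableC; exact: (preimage_measurable mqr measurable_slab).
have mN : measurable N by exact: measurable_setX_snoc.
have N0 : hat mu (~` ~` N) = 0.
  by rewrite setCK /N (hat_setX mu mC mmiss) resample_miss// mule0.
rewrite -(measure_setI_full _ (measurableC mN) N0); last first.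
  by apply: measurableI => //; exact: measurable_slab.
have mhit : measurable (J `&` [set r | (slab `&` B) (q (mu, r))]).
  apply: measurableI; first exact: measurable_itv.
  by apply: (preimage_measurable mqr); apply: measurableI => //; exact: measurable_slab.
rewrite [B `&` _]setIC -resample_law// muleC -(hat_setX mu mC mhit).
congr (hat mu _); apply/seteqP; split=> x.
  move=> [[[cx Bx] [Cx Jx]] nN]; split => //; split => //.
  have hs : slab (q (mu, x ord0 ord_max)) by apply: contrapT => h; apply: nN.
  split => //; move: Bx; rewrite /resample mem_set//.
move=> [Cx [Jx [hs Bq]]]; split; last by move=> [_ [_]]; exact.
split => //; split; first by apply/cellS; split => //; exact: Ca.
by rewrite /resample mem_set.
Qed.

End resample.

Section torus_shift.
Local Open Scope ereal_scope.
Context (R : realType) (k : nat) (a : R) (C : set 'rV[R]_k).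
Hypotheses (a0 : (0 < a)%R) (mC : measurable C) (bC : bounded_set C).
Hypothesis Ca : C `<=` cell a.
Local Notation V := 'rV[R]_k.
Local Notation W := 'rV[R]_k.+1.
Local Notation M := (lf_measure R k).
Local Notation torus := (torus_action k.+1 a0).

(* A phase [y] over a point [u] of [C] is sent to a point distributed like the
   restriction to [C] of the measure seen from [u]; the last coordinate of [y],
   which is uniform and carries no mass, is the source of randomness. *)
Definition torus_shift (p : W * lf_measure R k.+1) : W :=
  if p.1 \in cell a then
    (resample a C (shift (- init p.1) (unhat p.2), p.1) - p.1)%R
  else 0%R.

Lemma torus_shiftE y eta : cell a y ->
  torus_shift (y, eta) = (resample a C (shift (- init y) (unhat eta), y) - y)%R.
Proof. by move=> /mem_set cy; rewrite /torus_shift /= cy. Qed.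

Lemma measurable_torus_shift : measurable_fun setT torus_shift.
Proof.
apply: measurable_fun_ifT => //.
  by apply: measurable_fun_mem; [exact: measurable_cell|mfun].
apply: measurable_subr2_rV; last by mfun.
apply: (measurableT_comp (measurable_resample a mC)).
apply: measurable_fun_pair; last by mfun.
apply: measurable_shift; last by apply: measurable_unhat; mfun.
by apply: measurable_oppr_rV; mfun.
Qed.

Lemma recentred_hat (mu : M) (s x : W) :
  lf_equiv (shift (- init x) (unhat (shift s (hat mu)))) (shift (init (s - x)) mu).
Proof.
rewrite initD initN [(init s - init x)%R]addrC.
apply: lf_equiv_trans (shift_shift _ _ _); apply: shift_equiv.
apply: lf_equiv_trans (unhat_hat _); apply: unhat_equiv; exact: shift_hat.
Qed.

Lemma resample_equiv (mu nu : M) x :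
  lf_equiv mu nu -> resample a C (mu, x) = resample a C (nu, x).
Proof.
apply: (@lf_equiv_rV _ _ _ (fun mu : M => resample a C (mu, x))).
exact: (measurable_fun_pair1 x (measurable_resample a mC)).
Qed.

Let tau (y : W) (mu : M) := allocation torus torus_shift y (hat mu).

Let measurable_tau y mu : measurable_fun setT (tau y mu).
Proof.
rewrite /tau /allocation; apply: measurable_addr_rV => //.
apply: (measurableT_comp measurable_torus_shift); apply: measurable_fun_pair.
  by apply: mfun_act.
exact: measurable_shift.
Qed.

(** The measure handed to [resample] depends on [s] only through the lattice point of the cell that
    contains [y + s]. Within one translate of the cell a single measure is resampled. *)
Let tauE y mu s : cell a y ->
  tau y mu s = (lattice a (cell_index a (y + s)) - y +
    resample a C (shift (init (lattice a (cell_index a (y + s)) - y)) mu,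
                 torus_wrap a (y + s)))%R.
Proof.
move=> cy; rewrite /tau /allocation torus_actionE mem_set//.
rewrite /torus_shift mem_set /=; last exact: (wrap_cell a0).
rewrite (resample_equiv _ (recentred_hat _ _ _)).
have -> : (s - torus_wrap a (y + s) = lattice a (cell_index a (y + s)) - y)%R.
  by rewrite /torus_wrap opprB addrC opprD addrA subrK.
rewrite addrCA addrC; congr (_ + _)%R.
by rewrite /torus_wrap opprB addrC opprD addrA subrK.
Qed.

(** Each translate of the cell is mapped into itself and, brought back to the base cell, the
    allocation there is [resample] for one fixed measure. *)
Lemma torus_shift_preserving y (mu : M) B : measurable B ->
  hat mu (allocation torus torus_shift y (hat mu) @^-1` B) = hat mu B.
Proof.
(* Preservation is required at every phase, including the null set off the cell, where the shift is
   0. *)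
have [cy|cy] := pselect (cell a y); last first.
  have ycell : (y \in cell a) = false by exact: memNset.
  have tau_id s : tau y mu s = s.
    by rewrite /tau /allocation torus_actionE /torus_shift ycell /= ycell addr0.
  by move=> mB; congr (hat mu _); apply/seteqP; split=> s; rewrite /preimage /mkset
    -/(tau y mu s) tau_id.
move=> mB.
pose m1 : {measure set W -> \bar R} :=
  image_measure (hat mu) (measurable_tau y mu).
apply: (@measure_eq_cover R 'rV[int]_k.+1 _ _ (fun z : 'rV[int]_k.+1 =>
    [set s : W | cell_index a (y + s) = z]%R) m1 (hat mu)) mB.
- move=> z; have -> : [set s : W | cell_index a (y + s) = z]%R =
      (fun s => s - - y)%R @^-1` [set x | cell_index a x = z].
    by apply/seteqP; split=> s /=; rewrite opprK addrC.
  by apply: preimage_measurable (measurable_subr_rV _) _; exact: measurable_cell_index.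
- by move=> s; exists (cell_index a (y + s)%R).
(* Subtracting [b] carries the points [s] with [y + s] in the cell of index [z] onto the base cell;
   [nu] is [mu] seen from [b]. *)
move=> z D mD Dz; pose b := (lattice a z - y)%R.
have yb : (y + b = lattice a z)%R by rewrite /b addrC subrK.
pose nu := shift (init b) mu.
pose D' : set W := (fun x => x - - b)%R @^-1` D.
have mD' : measurable D' by apply: preimage_measurable (measurable_subr_rV _) mD.
have D'c : D' `<=` cell a.
  move=> x /Dz /=; rewrite opprK [(x + b)%R]addrC addrA yb addrC cell_index_add// => h.
  by apply/cell_index0 => //; move/eqP: h; rewrite -subr_eq0 addrK => /eqP.
have -> : m1 D = hat mu ((fun s => s - b)%R @^-1`
    [set x | cell a x /\ D' (resample a C (nu, x))]).
  have cancel (u v x : W) : (v + (u - v + x) = x + u)%R.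
    by rewrite addrA addrC [(v + _)%R]addrC subrK.
  have wrap_b s : cell_index a (y + s) = z -> torus_wrap a (y + s) = (s - b)%R.
    by move=> sz; rewrite /torus_wrap sz /b opprB addrA [(s + y)%R]addrC.
  rewrite [LHS](_ : _ = hat mu (tau y mu @^-1` D))//.
  congr (hat mu _); apply/seteqP; split=> s.
    move=> Ds; have {Ds} : D (tau y mu s) by [].
    rewrite tauE// => Ds; have /= := Dz _ Ds.
    rewrite cancel cell_index_add//.
    have : cell a (resample a C (shift (init (lattice a (cell_index a (y + s)) - y)) mu,
      torus_wrap a (y + s))) by exact: (resample_cell Ca _ (wrap_cell a0 _)).
    move=> /(cell_index0 a0) -> ; rewrite add0r => sz.
    move: Ds; rewrite sz wrap_b// => Ds; split.
      by rewrite -wrap_b//; exact: (wrap_cell a0).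
    by rewrite /D' /= opprK addrC.
  move=> [/= /(cell_index0 a0) sb Ds].
  have sz : cell_index a (y + s) = z.
    have -> : (y + s = s - b + lattice a z)%R by rewrite /b opprB addrA subrK addrC.
    by rewrite cell_index_add// sb add0r.
  suff : D (tau y mu s) by [].
  by rewrite tauE// sz wrap_b//; move: Ds; rewrite /D' /= opprK addrC.
rewrite -shiftE (shift_hat b mu); last first.
  apply: measurableI; first exact: measurable_cell.
  apply: preimage_measurable mD'.
  exact: (measurable_fun_pair2 nu (measurable_resample a mC)).

apply: etrans (resample_preserves a0 mC bC Ca nu mD' D'c) _.
apply: etrans (esym (shift_hat b mu mD')) _; rewrite shiftE; congr (hat mu _).
by apply/seteqP; split=> s; rewrite /D' /= opprK subrK.
Qed.

End torus_shift.

(** * From invariance to mass-stationarity *)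

Section ms_of_invariant.
Local Open Scope ereal_scope.
Context (R : realType) (k : nat) dE (E : measurableType dE).
Variable th : action R k E.
Local Notation V := 'rV[R]_k.
Local Notation W := 'rV[R]_k.+1.
Local Notation M := (lf_measure R k).
Local Notation L := (@lebesgue_measure R).

Section section_measure.
Variables (a : R) (C : set V).
Hypotheses (a0 : (0 < a)%R) (mC : measurable C) (bC : bounded_set C).
Hypothesis Ca : C `<=` cell a.
Hypothesis dC : lebesgue_rV R k (boundary C) = 0.
Variable S : set (E * M * V).
Hypothesis mS : measurable S.
Local Notation torus := (torus_action k.+1 a0).

(** The event [S] of mass-stationarity read on the triple of background, [X] and [hat xi]: the first
    coordinates of the phase play the part of [U], restricted to [C]. *)
Definition test_set : set (W * E * lf_measure R k.+1) :=
  [set z : W * E * lf_measure R k.+1 | [/\ cell a z.1.1, C (init z.1.1) &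
    S ((z.1.2, unhat z.2), init z.1.1)]].

Lemma measurable_test_set : measurable test_set.
Proof.
have -> : test_set = (fun z : W * E * lf_measure R k.+1 => z.1.1) @^-1` cell a `&`
    ((fun z : W * E * lf_measure R k.+1 => init z.1.1) @^-1` C `&`
     (fun z : W * E * lf_measure R k.+1 => ((z.1.2, unhat z.2), init z.1.1)) @^-1` S).
  by apply/seteqP; split=> z /= [h1]; [move=> h2 h3|move=> [h2 h3]; split].
apply: measurableI; first by apply: preimage_measurable (measurable_cell _); mfun.
apply: measurableI; first by apply: preimage_measurable mC; mfun.
by apply: preimage_measurable mS; mfun.
Qed.

Let S_equiv x (mu nu : M) u : lf_equiv mu nu -> S (x, mu, u) = S (x, nu, u).
Proof.
move=> munu; pose S' : set (E * M) := (fun z : E * M => (z, u)) @^-1` S.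
have mS' : measurable S' by apply: preimage_measurable mS; mfun.
exact: (lf_equiv_mem_pair x munu mS').
Qed.

Let LJ : L [set` `[(- a)%R, a[] = (2 * a)%:E.
Proof.
by rewrite lebesgue_measure_itv /= lte_fin gtrN// -EFinD opprK mulr2n mulrDl mul1r.
Qed.

Lemma leb_test_set x (mu : M) :
  leb R k.+1 ([set y | test_set (y, x, hat mu)] `&` cell a) =
  (2 * a)%:E * \int[leb R k]_u ((\1_C u)%:E * (\1_S ((x, mu), u))%:E).
Proof.
pose Su : set V := (fun u => ((x, mu), u)) @^-1` S.
have mSu : measurable Su by apply: preimage_measurable mS; mfun.
have -> : [set y | test_set (y, x, hat mu)] `&` cell a =
    [set y : W | (C `&` Su) (init y) /\ [set` `[(- a)%R, a[] (y ord0 ord_max)].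
  apply/seteqP; split=> y.
    move=> [[/= cy Cy Sy] _]; have [_ Jy] := (cellS a y).1 cy; split => //; split => //.
    by move: Sy; rewrite (S_equiv _ _ (unhat_hat mu)).
  move=> [[Cy Sy] Jy]; have cy : cell a y by apply/cellS; split => //; exact: Ca.
  by split => //; split => //=; rewrite (S_equiv _ _ (unhat_hat mu)).
rewrite leb_hat (hat_setX _ (measurableI _ _ mC mSu) (measurable_itv _)) LJ muleC.
congr (_ * _); rewrite -integral_indicT; last exact: measurableI.
by apply: eq_integral => u _; rewrite indicI EFinM.
Qed.

Definition moved (y : W) (x : E) (mu : M) : W * E * lf_measure R k.+1 :=
  let t := torus_shift a C (y, hat mu) in
  (torus t y, extend_action th t x, shift t (hat mu)).

Let resample' (y : W) (mu : M) := resample a C (shift (- init y) mu, y).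

(** Resampling stays in the cell, so the torus shift does not wrap: the new phase is the resampled
    point, and the displacement of [(X, xi)] is the difference of the first coordinates. *)
Let test_moved y x mu : cell a y -> test_set (moved y x mu) <->
  C (init (resample' y mu)) /\
  S (tshift th (init (resample' y mu) - init y)%R (x, mu), init (resample' y mu)).
Proof.
move=> cy.
have tE : torus_shift a C (y, hat mu) = (resample' y mu - y)%R.
  have h : lf_equiv (shift (- init y) (unhat (hat mu))) (shift (- init y) mu).
    by apply: shift_equiv; exact: unhat_hat.
  by rewrite (torus_shiftE _ _ cy) (resample_equiv a mC y h).
have cr : cell a (resample' y mu) by exact: (resample_cell Ca _ cy).
have torE : torus (torus_shift a C (y, hat mu)) y = resample' y mu.
  by rewrite tE torus_actionE (mem_set cy) addrC subrK (wrap_id a0 cr).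
rewrite /moved torE tE /test_set /mkset /fst /snd.
have -> : S ((extend_action th (resample' y mu - y)%R x,
    unhat (shift (resample' y mu - y)%R (hat mu))), init (resample' y mu)) =
    S (tshift th (init (resample' y mu) - init y)%R (x, mu), init (resample' y mu)).
  rewrite /tshift /= -initN -initD; apply: S_equiv.
  apply: lf_equiv_trans (unhat_hat _); apply: unhat_equiv; exact: shift_hat.
by split=> [[]|[]].
Qed.

(** The integrand in [u] on the left of [ms_identity], for the indicator of [S]. *)
Definition resampled_kernel (z : (E * M) * V) : \bar R :=
  (\1_C z.2)%:E * (inv_mass z.1.2 (recentre C z.2) *
    \int[z.1.2]_v ((\1_C (v + z.2)%R)%:E * (\1_S (tshift th v z.1, (v + z.2)%R))%:E)).

Lemma measurable_resampled_kernel : measurable_fun setT resampled_kernel.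
Proof.
have mz : measurable_fun setT (fun z : (E * M) * V => z.1.2) by mfun.
have mK : measurable_fun setT (fun x : (E * M) * V * V => (\1_C (x.2 + x.1.2)%R)%:E *
    (\1_S (tshift th x.2 x.1.1, (x.2 + x.1.2)%R))%:E : \bar R) by mfun.
have mI := measurable_lf_integral mz
  (fun x : (E * M) * V * V => mule_ge0 (indic_ge0 _ C _) (indic_ge0 _ S _)) mK.
apply: mfun_mule; first by mfun.
by apply: mfun_mule => //; apply: measurable_inv_mass => //; mfun.
Qed.

Lemma resampled_kernel_ge0 z : 0 <= resampled_kernel z.
Proof.
rewrite mule_ge0// mule_ge0 ?inv_mass_ge0//.
by apply: integral_ge0 => v _; rewrite mule_ge0.
Qed.

Lemma measurable_moved : measurable_fun setT (fun z : W * (E * M) => moved z.1 z.2.1 z.2.2).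
Proof.
have mt : measurable_fun setT
    (fun z : W * (E * M) => torus_shift a C (z.1, hat z.2.2)).
  by apply: (measurableT_comp (measurable_torus_shift a mC)); mfun.
apply: measurable_fun_pair; first apply: measurable_fun_pair.
- by apply: mfun_act => //; mfun.
- by apply: (@mfun_act R _ _ k.+1 _ _ (extend_action th)) => //; mfun.
- by apply: measurable_shift => //; mfun.
Qed.

(** This is [resample_uniform] for the measure seen from [- u], whose mass points [v + u] in [C] are
    the mass points [v] of [mu] in [C - u]. *)
Let slice_law (mu : M) x u : C u -> 0 < mu (recentre C u) ->
  L ([set` `[(- a)%R, a[] `&` [set r | test_set (moved (snoc (u, r)) x mu)]) =
  (2 * a)%:E * (inv_mass mu (recentre C u) *
    \int[mu]_v ((\1_C (v + u)%R)%:E * (\1_S (tshift th v (x, mu), (v + u)%R))%:E)).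
Proof.
move=> Cu mu0; pose nu := shift (- u)%R mu.
have nuC : nu C = mu (recentre C u) by rewrite recentreE.
pose B0 : set V := C `&` (fun x' => (tshift th (x' - u)%R (x, mu), x')) @^-1` S.
have mB0 : measurable B0 by apply: measurableI => //; apply: preimage_measurable mS; mfun.
pose B : set W := (@init R k) @^-1` B0.
have mB : measurable B by apply: preimage_measurable mB0; exact: measurable_init.
have nuC0 : 0 < nu C by rewrite nuC.
have := resample_uniform a0 mC bC Ca mB Cu nuC0.
have -> : slab a C `&` B =
    [set x' : W | B0 (init x') /\ [set` `[(- a)%R, a[] (x' ord0 ord_max)].
  apply/seteqP; split=> x'; first by move=> [[_ Jx] Bx].
  by move=> [Bx Jx]; split => //; split => //; case: Bx.
rewrite (hat_setX nu mB0 (measurable_itv _)) LJ nuC.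
have -> : nu B0 =
    \int[mu]_v ((\1_C (v + u)%R)%:E * (\1_S (tshift th v (x, mu), (v + u)%R))%:E).
  rewrite shiftE -(integral_indicT (lf_val mu)); last first.
    exact: preimage_measurable (measurable_subr_rV (- u)%R) mB0.
  have -> : (fun v : V => v - - u)%R @^-1` B0 =
      recentre C u `&` (fun v : V => (tshift th v (x, mu), (v + u)%R)) @^-1` S.
    have vu v : (v - - u = v + u)%R by rewrite opprK.
    apply/seteqP; split=> v; rewrite /B0 /recentre /preimage /mkset vu.
      by move=> [Cv Sv]; split => //; rewrite -[X in tshift th X](addrK u).
    by move=> [Cv Sv]; split => //; rewrite -[X in tshift th X](addrK u) in Sv.
  by apply: eq_integral => v _; rewrite indicI EFinM.
have -> : [set` `[(- a)%R, a[] `&` [set r | B (resample a C (nu, snoc (u, r)))] =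
    [set` `[(- a)%R, a[] `&` [set r | test_set (moved (snoc (u, r)) x mu)].
  apply/seteqP; split=> r [Jr].
    move=> [Ch Sh]; split => //; apply/test_moved.
      by apply/cellS; rewrite init_snoc snoc_max; split => //; exact: Ca.
    by rewrite /resample' init_snoc.
  move=> /test_moved[].
    by apply/cellS; rewrite init_snoc snoc_max; split => //; exact: Ca.
  by rewrite /resample' init_snoc => Ch Sh; split.
set I := \int[mu]_v _; set l := L _ => lI.
have cfin := recentre_fin mu u mC bC.
have m0 : (fine (mu (recentre C u)) != 0)%R by rewrite gt_eqF// fine_gt0// mu0 /= -ge0_fin_numE.
have := congr1 (fun e => e * inv_mass mu (recentre C u)) lI.
rewrite /inv_mass -{1}(fineK cfin) -muleA -EFinM mulfV// mule1 => ->.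
by rewrite [I * _]muleC -muleA [I * _]muleC.
Qed.

Lemma leb_moved_test_set (mu : M) x : msupport mu 0%R ->
  leb R k.+1 ([set y | test_set (moved y x mu)] `&` cell a) =
  (2 * a)%:E * \int[leb R k]_u resampled_kernel (x, mu, u).
Proof.
move=> supp; set D := _ `&` _.
have mD : measurable D.
  apply: measurableI; last exact: measurable_cell.
  apply: (preimage_measurable _ measurable_test_set).
  exact: (measurable_fun_pair1 (x, mu) measurable_moved).
have mL : measurable_fun setT (fun u : V => L ((fun r => snoc (u, r)) @^-1` D)).
  exact: measurable_snoc_section.
have mF : measurable_fun setT (fun u => resampled_kernel (x, mu, u)).
  exact: (measurable_fun_pair2 (x, mu) measurable_resampled_kernel).
have F0 u : 0 <= resampled_kernel (x, mu, u) by exact: resampled_kernel_ge0.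
have a2 : 0 <= (2 * a)%:E by rewrite lee_fin mulr_ge0// ltW.
rewrite leb_hat (hatE _ mD).
rewrite -(ge0_integralZl (leb R k) measurableT mF (fun u _ => F0 u) a2).
apply: (ge0_integral_eq_off (measurable_boundary C) dC mL) => //.
- by apply: mfun_mule.
- by move=> u; rewrite mule_ge0.
move=> u bu.
have DJ : (fun r => snoc (u, r)) @^-1` D = [set` `[(- a)%R, a[] `&`
    [set r | cell a u /\ test_set (moved (snoc (u, r)) x mu)].
  apply/seteqP; split=> r.
    by move=> [h /cellS[]]; rewrite init_snoc snoc_max.
  move=> [Jr [cu h]]; split => //; apply/cellS; rewrite init_snoc snoc_max; by split.
rewrite DJ /resampled_kernel; have [uC|uC] := boolP (u \in C).
  have Cu := set_mem uC.
  rewrite indicE uC mul1e -slice_law//; last exact: (msupport_recentre mC supp Cu bu).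
  congr (L _); apply/seteqP; split=> r; first by move=> [Jr []].
  by move=> [Jr h]; split => //; split => //; exact: Ca.
(* Over [u] outside [C] nothing is resampled; the phase stays outside [C] and the event fails. *)
rewrite indicE (negPf uC) mul0e mule0 (_ : _ `&` _ = set0) ?measure0//.
apply/seteqP; split=> r // -[Jr [cu]] /test_moved[].
  by apply/cellS; rewrite init_snoc snoc_max; split.
move=> Ch _; apply: (negP uC); apply: mem_set; move: Ch; rewrite /resample' /resample.
by case: ifP => [/set_mem[+ _ _] _|_]; rewrite /snd init_snoc.
Qed.

End section_measure.
End ms_of_invariant.

Section invariance_to_ms.
Local Open Scope ereal_scope.
Context (R : realType) (k : nat) dE (E : measurableType dE).
Variable th : action R k E.
Context dO (Omega : measurableType dO) (P : {measure set Omega -> \bar R}).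
Variables (X : Omega -> E) (xi : Omega -> lf_measure R k).
Hypotheses (mX : measurable_fun setT X) (mxi : measurable_fun setT xi).
Hypothesis supp : {ae P, forall w, msupport (xi w) 0%R}.
Hypothesis inv : invariant_under_preserving_shifts
  (extend_action th) P X (fun w => hat (xi w)).
Local Notation V := 'rV[R]_k.
Local Notation W := 'rV[R]_k.+1.
Local Notation M := (lf_measure R k).

Lemma ms_identity_of_invariant (C : set V) : measurable C -> bounded_set C ->
  lebesgue_rV R k (boundary C) = 0 ->
  forall S : set (E * M * V), measurable S ->
  ms_identity th P X xi C (fun x => (\1_S x)%:E).
Proof.
move=> mC bC dC S mS.
have [a a0 Ca] : exists2 a : R, (0 < a)%R & C `<=` cell a.
  have [n Cn] := bounded_sub_cube bC; exists n.+1%:R => // x /Cn xn i.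
  have := le_lt_trans (le_coord_norm x i) xn.
  rewrite ltr_norml => /andP[h1 h2]; apply/andP; split.
    by rewrite (le_trans _ (ltW h1))// lerN2 ler_nat.
  by rewrite (lt_le_trans h2)// ler_nat.
have [nu [nuE nu_stat]] : exists nu : probability W R,
    (forall A, nu A = (((2 * a) ^+ k.+1)^-1)%:E * leb R k.+1 (A `&` cell a)) /\
    (forall t A, measurable A -> pushforward nu (torus_action k.+1 a0 t) A = nu A).
  exists (@uniform_cell R k.+1 a a0); split; first exact: uniform_cellE.
  exact: uniform_cell_stationary.
have [P' [P'X P'E]] : exists P' : {measure set (Omega * W) -> \bar R},
    (forall A B, measurable A -> measurable B -> P' (A `*` B) = P A * nu B) /\
    (forall D, P' D = \int[P]_w nu (xsection D w)).
  by exists (P \x nu); split => // A B mA mB; exact: product_measure1E.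
have ext : extension P P' fst.
  split=> [|A mA]; first exact: measurable_fst.
  have := P'X A setT mA measurableT; rewrite probability_setT mule1 => <-.
  by rewrite /pushforward; congr (P' _); apply/seteqP; split=> z /=; tauto.
have indep : stationary_independent P' (torus_action k.+1 a0) snd
    (fun w => (X w.1, hat (xi w.1))).
  exists nu; split=> [//|A B mA mB].
  pose Z w := (X w, hat (xi w)).
  have mZ : measurable (Z @^-1` B) by apply: preimage_measurable mB; rewrite /Z; mfun.
  have := ext.2 _ mZ; rewrite /pushforward => eZ.
  transitivity (P' ((Z @^-1` B) `*` A)).
    by congr (P' _); apply/seteqP; split=> z /=; tauto.
  by rewrite P'X// muleC; congr (_ * _); rewrite -eZ.
have pres : preserving_shift (torus_action k.+1 a0) (snd : Omega * W -> W)
    (fun w => hat (xi w.1)) (torus_shift a C).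
  split; first exact: measurable_torus_shift.
  by move=> w B mB; exact: torus_shift_preserving.
have mT := measurable_test_set a mC mS.
have := inv ext measurable_snd indep pres mT; rewrite /pushforward => same.
pose D1 : set (Omega * W) := (fun z => moved th C a0 z.2 (X z.1) (xi z.1)) @^-1` test_set a C S.
pose D2 : set (Omega * W) := (fun z => (z.2, X z.1, hat (xi z.1))) @^-1` test_set a C S.
have mD1 : measurable D1.
  apply: preimage_measurable mT.
  have mz : measurable_fun setT (fun z : Omega * W => (z.2, (X z.1, xi z.1))) by mfun.
  exact: (measurableT_comp (measurable_moved th a0 mC) mz).
have {}same : P' D1 = P' D2 by exact: same.
(* The density of the uniform law on the cell of dimension [k + 1], times the length [2 * a] over
   which its last coordinate is integrated; it appears on both sides. *)
pose c : R := (((2 * a) ^+ k.+1)^-1 * (2 * a))%R.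
have c0 : (0 < c)%R by rewrite mulr_gt0 ?mulr_gt0// invr_gt0 exprn_gt0// mulr_gt0.
have ce0 : 0 <= c%:E by rewrite lee_fin ltW.
pose G1 w := \int[leb R k]_u resampled_kernel th C S (X w, xi w, u).
pose G2 w := \int[leb R k]_u ((\1_C u)%:E * (\1_S ((X w, xi w), u))%:E).
have sl := sigma_finite_lf (leb R k).
have mG1 : measurable_fun setT G1.
  have mz : measurable_fun setT (fun z : Omega * V => (X z.1, xi z.1, z.2)) by mfun.
  have mK := measurableT_comp (measurable_resampled_kernel th mC mS) mz.
  exact: (measurable_integral_snd mK (fun=> resampled_kernel_ge0 _ _ _ _) sl).
have mG2 : measurable_fun setT G2.
  have mK : measurable_fun setT (fun z : Omega * V =>
    (\1_C z.2)%:E * (\1_S ((X z.1, xi z.1), z.2))%:E : \bar R) by mfun.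
  exact: (measurable_integral_snd mK (fun=> mule_ge0 (indic_ge0 _ _ _) (indic_ge0 _ _ _)) sl).
have G1_ge0 w : 0 <= G1 w by apply: integral_ge0 => u _; exact: resampled_kernel_ge0.
have G2_ge0 w : 0 <= G2 w by apply: integral_ge0 => u _; rewrite mule_ge0.
have e1 : P' D1 = c%:E * \int[P]_w G1 w.
  rewrite -(ge0_integralZl P measurableT mG1 (fun w _ => G1_ge0 w) ce0) P'E.
  apply: ge0_ae_eq_integral => //.
  - exact: (measurable_fun_xsection nu mD1).
  - by apply: mfun_mule.
  - by move=> w _; rewrite mule_ge0.
  apply: filterS supp => w w0 _; rewrite nuE.
  have -> : xsection D1 w = [set y | test_set a C S (moved th C a0 y (X w) (xi w))].
    by apply/seteqP; split=> y /=; rewrite /xsection /= inE.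
  by rewrite (leb_moved_test_set th a0 mC bC Ca dC mS)// muleA.
have e2 : P' D2 = c%:E * \int[P]_w G2 w.
  rewrite -(ge0_integralZl P measurableT mG2 (fun w _ => G2_ge0 w) ce0) P'E.
  apply: eq_integral => w _; rewrite nuE.
  have -> : xsection D2 w = [set y | test_set a C S (y, X w, hat (xi w))].
    by apply/seteqP; split=> y /=; rewrite /xsection /= inE.
  by rewrite (leb_test_set a0 mC Ca mS)// muleA.
exact: (pmule_inj c0 (etrans (esym e1) (etrans same e2))).
Qed.

End invariance_to_ms.

Theorem theorem8 (R : realType) (d : nat) (d_gt0 : (0 < d)%N)
    (dO : measure_display) (Omega : measurableType dO)
    (P : {measure set Omega -> \bar R})
    (dE : measure_display) (E : measurableType dE) (th : action R d E)
    (X : Omega -> E) (xi : Omega -> lf_measure R d)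
    (mX : measurable_fun setT X) (mxi : measurable_fun setT xi)
    (sigma_finite_law :
      sigma_finite setT (pushforward P (fun w => (X w, xi w))))
    (zero_in_support : {ae P, forall w, msupport (xi w) 0}) :
  mass_stationary th P X xi <->
  invariant_under_preserving_shifts (extend_action th) P X (fun w => hat (xi w)).
Proof.
split=> [stationary|invariant].
  have mecke_identity := mecke_of_ms mX mxi sigma_finite_law
    (ms_of_mass_stationary mX mxi zero_in_support stationary).
  exact: (invariant_of_mecke mX mxi sigma_finite_law zero_in_support mecke_identity).
apply: (mass_stationary_of_ms mX mxi sigma_finite_law zero_in_support).
move=> C mC bC _ dC S mS.
exact: (ms_identity_of_invariant mX mxi zero_in_support invariant mC bC dC mS).
Qed.
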